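(* The twisted product of Riemann surfaces determined by $\beta$ and $A_1,\dots,A_m$ (as in the context) is extremal if and only if one of the following holds: (1) $\varphi(\beta)=t\cdot(1,0)^{\otimes m}$, $t\in\mathbb R\setminus\{0\}$, i.e. $\langle\mu,\beta\rangle=t$, and $A_i$, $i=1,\ldots,m$, is a polynomial of degree at most $3$. (2) For some $j$, $\varphi(\beta)=\mathrm{ins}_j\big((a,b)\otimes(1,0)^{\otimes(m-1)}\big)$, $b\ne0$, i.e. $\langle\mu,\beta\rangle=a+bx_j$, and $$A_j(x_j)=(a+bx_j)^{m+1}\int\!\!\int\frac{\Upsilon(x_j)}{(a+bx_j)^{m+3}}dx_jdx_j,$$ and $A_i$, $i\ne j$, is a polynomial of degree at most $2$, and $$\gamma_2+b^2\sum_{i\ne j}A_i''=0,$$ where $\Upsilon(x)=\sum_{r=0}^2\gamma_rx^r$. In particular, $A_j(x_j)=\bar\Upsilon(x_j)+(a+bx_j)^{m+1}(\nu_j^0+\nu_j^1x_j)$, where $\deg\bar\Upsilon\le2$ and $\nu_j^0,\nu_j^1\in\mathbb R$. (3) There exist $S\subset\{1,\ldots,m\}$ of cardinality at least two and a vector $(a_j,b_j)$, $b_j\ne0$, for each $j\in S$ such that $\varphi(\beta)=\sum_{j\in S}\mathrm{ins}_j\big((a_j,b_j)\otimes(1,0)^{\otimes(m-1)}\big)$, i.e. $\langle\mu,\beta\rangle=\beta_0+\sum_{j\in S}\beta_jx_j$ for some non-zero $\beta_j\in\mathbb R$, $j\in S$ (and $\beta_0\in\mathbb R$), and either (a) $m=2$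 and $A_j(x_j)=\sum_{r=0}^4a_{jr}x_j^r$, $j=1,2$, are such that $$a_{24}=-\frac{\beta_2^2}{\beta_1^2}a_{14},\qquad a_{23}=-4\frac{\beta_0\beta_2}{\beta_1^2}a_{14}+\frac{\beta_2}{\beta_1}a_{13},\qquad a_{22}=-6\frac{\beta_0^2}{\beta_1^2}a_{14}+3\frac{\beta_0}{\beta_1}a_{13}-a_{12},$$ where $a_{1r}\in\mathbb R$, $r=0,\ldots,4$, and $a_{20},a_{21}\in\mathbb R$; or (b) $m\ge3$ and $A_j$, $j\in S$, is a polynomial of degree at most $1$, $A_r$, $r\notin S$, is a polynomial of degree at most $2$, and $\sum_{r\notin S}A_r''=0$.
   Context: Let $m\ge2$, $W_1=\dots=W_m=\mathbb R^2$. $\mathrm{ins}_j:W_j^*\otimes\bigotimes_{i\ne j}W_i^*\to\bigotimes_iW_i^*$ puts the first factor into the $j$-th slot. The product Segre factorization structure is the inclusion $\varphi$ of $\mathfrak h=\sum_{j=1}^m\mathrm{ins}_j\big(W_j^*\otimes\langle(1,0)^{\otimes(m-1)}\rangle\big)$ into $\bigotimes_iW_i^*$; $\dim\mathfrak h=m+1$. With real variables $x_1,\dots,x_m$ and pairing $\langle(u,v),(a,b)\rangle=ua+vb$ put $\langle\mu,\alpha\rangle=\langle(1,x_1)\otimes\cdots\otimes(1,x_m),\varphi(\alpha)\rangle$; thus $\langle\mu,\alpha\rangle=\alpha_0+\sum_j\alpha_jx_j$ runs over all affine functions. Let $\mu_\beta=\mu/\langle\mu,\beta\rangle$ and $\psi_j(x)\in\mathfrak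 h$ with $\varphi(\psi_j(x))=\mathrm{ins}_j((x,-1)\otimes(1,0)^{\otimes(m-1)})$. Given $0\ne\beta\in\mathfrak h$ and smooth non-vanishing functions $A_j$ on open intervals $I_j$ such that $\langle\mu,\beta\rangle$ does not vanish on $\prod I_j$, the twisted product of Riemann surfaces is the (local) toric Kähler structure in coordinates $(x_1,\dots,x_m,t)$, $t\in\mathfrak t=\mathfrak h/\langle\beta\rangle$, $$g_\beta=\sum_j\Big(\tfrac1{A_j(x_j)\langle\mu,\beta\rangle}dx_j^2+A_j(x_j)\langle\mu,\beta\rangle\langle\partial_{x_j}\mu_\beta,dt\rangle^2\Big),\quad\omega_\beta=\sum_jdx_j\wedge\langle\partial_{x_j}\mu_\beta,dt\rangle,$$ $$J_\beta dx_j=A_j(x_j)\langle\mu,\beta\rangle\langle\partial_{x_j}\mu_\beta,dt\rangle,\quad J_\beta dt=\sum_j\tfrac{\psi_j(x_j)\ \mathrm{mod}\ \beta}{A_j(x_j)}dx_j$$ ($A_j$ such that $g_\beta$ is positive definite). It is extremal if its scalar curvature is a Killing potential; for this geometry this amounts to the existence of $\alpha\in\mathfrak h$ with $$\sum_{j=1}^m\langle\mu,\beta\rangle^{m+3}\partial_{x_j}^2\Big(\frac{A_j(x_j)}{\langle\mu,\beta\rangle^{m+1}}\Big)=\langle\mu,\alpha\rangle .$$ $\int\!\int F\,dx\,dx$ denotes some second antiderivative of $F$ (determined up to adding an affine function). *)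

(* Defs.v *)
From HB Require Import structures.
From mathcomp Require Import all_boot all_order all_algebra.
From mathcomp Require Import all_classical all_reals all_analysis.

Set Implicit Arguments.
Unset Strict Implicit.
Unset Printing Implicit Defensive.

Import Order.TTheory GRing.Theory Num.Theory.
Import numFieldNormedType.Exports.

Local Open Scope classical_set_scope.
Local Open Scope ring_scope.

(** In a coordinate domain of R^n, points are row vectors, tangent vectors are
    columns and covectors are rows.  A bilinear form is given by the matrix
    [g p] with [g p (X, Y) = X^T *m g p *m Y]. *)

Section Riemannian.
Context {R : realType} {n : nat}.
Implicit Types (f : 'rV[R]_n -> R) (g J : 'rV[R]_n -> 'M[R]_n).
Implicit Types (p : 'rV[R]_n) (D : set 'rV[R]_n) (K : 'rV[R]_n -> 'cV[R]_n).

Definition partial (i : 'I_n) f p : R := 'D_(delta_mx 0 i) f p.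

Definition differential f p : 'rV[R]_n := \row_i partial i f p.

Definition positive_definite_on D g : Prop :=
  forall p, D p -> forall X : 'cV[R]_n, X != 0 -> 0 < (X^T *m g p *m X) 0 0.

Definition christoffel g (k i j : 'I_n) p : R :=
  2^-1 * \sum_l invmx (g p) k l *
    (partial i (fun q => g q j l) p + partial j (fun q => g q i l) p
     - partial l (fun q => g q i j) p).

Definition ricci g (i j : 'I_n) p : R :=
  \sum_k (partial k (christoffel g k i j) p
          - partial j (christoffel g k i k) p
          + \sum_l (christoffel g k k l p * christoffel g l i j p
                    - christoffel g k j l p * christoffel g l i k p)).

Definition scalar_curvature g p : R :=
  \sum_i \sum_j invmx (g p) i j * ricci g i j p.

Definition grad g f p : 'cV[R]_n := invmx (g p) *m (differential f p)^T.

Definition lie_metric K g p (i j : 'I_n) : R :=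
  \sum_k (K p k 0 * partial k (fun q => g q i j) p
          + g p k j * partial i (fun q => K q k 0) p
          + g p i k * partial j (fun q => K q k 0) p).

Definition killing_on D g K : Prop :=
  forall p, D p -> forall i j, lie_metric K g p i j = 0.

End Riemannian.

(** The almost complex structure is recorded by its action on 1-forms,
    [alpha |-> alpha *m cplx p].  It acts on tangent vectors by
    [(J alpha) X = - alpha (J X)], hence the sign in [cplx_vector]; with this
    convention [kform (X, Y) = metric (J X, Y)]. *)
Record kahler_data (R : realType) (n : nat) := KahlerData {
  metric : 'rV[R]_n -> 'M[R]_n;
  kform : 'rV[R]_n -> 'M[R]_n;
  cplx : 'rV[R]_n -> 'M[R]_n }.

Section Kahler.
Context {R : realType} {n : nat}.
Implicit Types (M : kahler_data R n) (D : set 'rV[R]_n).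

Definition cplx_vector M (K : 'rV[R]_n -> 'cV[R]_n) p : 'cV[R]_n :=
  - (cplx M p *m K p).

Definition killing_potential_on D M (f : 'rV[R]_n -> R) : Prop :=
  killing_on D (metric M) (cplx_vector M (grad (metric M) f)).

Definition extremal_on D M : Prop :=
  killing_potential_on D M (scalar_curvature (metric M)).

End Kahler.

(** An element of the m-fold tensor power of R^2 (or of its dual) is given by
    its components [T s] in the standard basis, [s : {ffun 'I_m -> 'I_2}]. *)

Definition tensor (R : realType) (m : nat) : vectType R :=
  {ffun {ffun 'I_m -> 'I_2} -> R^o}.

Section Segre.
Context {R : realType} {m : nat}.

Definition vec2 (a b : R) : 'rV[R]_2 := \row_(k < 2) (if k == 0 then a else b).

Definition pure {k : nat} (v : 'I_k -> 'rV[R]_2) : tensor R k :=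
  [ffun s : {ffun 'I_k -> 'I_2} => \prod_i v i 0 (s i)].

Definition tpair (P T : tensor R m) : R := \sum_s (P s : R) * (T s : R).

(* [ins j v T] is ins_j applied to [v (x) T]; the slots other than [j] are
   enumerated by [lift j : 'I_m.-1 -> 'I_m]. *)
Definition ins (j : 'I_m) (v : 'rV[R]_2) (T : tensor R m.-1) : tensor R m :=
  [ffun s : {ffun 'I_m -> 'I_2} =>
     v 0 (s j) * (T [ffun i => s (lift j i)] : R)].

Definition e0pow (k : nat) : tensor R k := pure (fun _ => vec2 1 0).

(* h, as a subspace of the tensor power; the inclusion phi is implicit. *)
Definition segre : {vspace tensor R m} :=
  (\sum_(j < m)
     limg (linfun (fun v : 'rV[R]_2 => ins j v (e0pow m.-1) : tensor R m)))%VS.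

(* <mu, alpha> at the point x *)
Definition mu_pair (x : 'rV[R]_m) (alpha : tensor R m) : R :=
  tpair (pure (fun i => vec2 1 (x 0 i))) alpha.

(* <d mu_beta / d x_j, c> at the point x *)
Definition dmu (beta : tensor R m) (j : 'I_m) (x : 'rV[R]_m) (c : tensor R m) :=
  partial j (fun y => mu_pair y c / mu_pair y beta) x.

Definition psi (j : 'I_m) (x : R) : tensor R m := ins j (vec2 x (-1)) (e0pow m.-1).

End Segre.

(** Coordinates on R^(m + m) are (x_1, ..., x_m, t_1, ..., t_m), where
    t_1, ..., t_m are the coordinates on t = h / <beta> in the basis
    (b_r mod beta); [beta :: b] is a basis of h.  Thus
    dt = \sum_r (b_r mod beta) dt_r. *)

Section TwistedProduct.
Context {R : realType} {m : nat}.
Variables (beta : tensor R m) (b : m.-tuple (tensor R m)) (A : 'I_m -> R -> R).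
Implicit Types (p : 'rV[R]_(m + m)) (j r : 'I_m).

Definition dx j : 'rV[R]_(m + m) := delta_mx 0 (lshift m j).

Definition dt r : 'rV[R]_(m + m) := delta_mx 0 (rshift m r).

(* <d mu_beta / d x_j, dt> *)
Definition theta j p : 'rV[R]_(m + m) :=
  \sum_r dmu beta j (lsubmx p) (tnth b r) *: dt r.

(* coordinate of c mod beta along b_r mod beta *)
Definition coord_mod r (c : tensor R m) : R :=
  coord [tuple of beta :: b] (lift ord0 r) c.

Definition tp_metric p : 'M[R]_(m + m) :=
  \sum_j ((A j (lsubmx p 0 j) * mu_pair (lsubmx p) beta)^-1
            *: ((dx j)^T *m dx j)
          + (A j (lsubmx p 0 j) * mu_pair (lsubmx p) beta)
            *: ((theta j p)^T *m theta j p)).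

Definition tp_kform p : 'M[R]_(m + m) :=
  \sum_j ((dx j)^T *m theta j p - (theta j p)^T *m dx j).

(* [v^T *m w] sends the covector dual to v to w, so this is the linear map on
   covectors with the prescribed values J dx_j and J dt_r. *)
Definition tp_cplx p : 'M[R]_(m + m) :=
  \sum_j (dx j)^T *m ((A j (lsubmx p 0 j) * mu_pair (lsubmx p) beta)
                        *: theta j p)
  + \sum_r (dt r)^T *m
      (\sum_j (coord_mod r (psi j (lsubmx p 0 j)) / A j (lsubmx p 0 j)) *: dx j).

Definition twisted_product : kahler_data R (m + m) :=
  KahlerData tp_metric tp_kform tp_cplx.

End TwistedProduct.

Section Domains.
Context {R : realType} {m : nat}.

Definition open_interval (I : set R) : Prop :=
  [/\ open I, is_interval I & I !=set0].

Definition smooth_on (I : set R) (f : R -> R) : Prop :=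
  forall (k : nat) (x : R), I x -> derivable (derive1n k f) x 1.

Definition box (I : 'I_m -> set R) : set 'rV[R]_m :=
  [set x | forall j, I j (x 0 j)].

Definition tp_domain (I : 'I_m -> set R) : set 'rV[R]_(m + m) :=
  [set p | box I (lsubmx p)].

Definition poly_deg_le_on (I : set R) (d : nat) (f : R -> R) : Prop :=
  exists q : {poly R}, (size q <= d.+1)%N /\ forall x, I x -> f x = q.[x].

Definition second_antiderivative_on (I : set R) (f F : R -> R) : Prop :=
  forall x, I x -> [/\ derivable F x 1, derivable (derive1 F) x 1
                     & derive1n 2 F x = f x].

End Domains.

Section Cases.
Context {R : realType} {m : nat}.
Variables (beta : tensor R m) (I : 'I_m -> set R) (A : 'I_m -> R -> R).

Definition case_const : Prop :=
  exists t : R, [/\ t != 0, beta = t *: e0pow m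
    & forall i, poly_deg_le_on (I i) 3 (A i)].

Definition case_single (j : 'I_m) (a b : R) : Prop :=
  [/\ b != 0, beta = ins j (vec2 a b) (e0pow m.-1),
      forall i, i != j -> poly_deg_le_on (I i) 2 (A i)
    & exists (gamma0 gamma1 gamma2 : R) (F : R -> R),
      [/\ second_antiderivative_on (I j)
            (fun x => (gamma0 + gamma1 * x + gamma2 * x ^+ 2)
                      / (a + b * x) ^+ (m + 3)) F,
          forall x, I j x -> A j x = (a + b * x) ^+ (m + 1) * F x
        & forall x, box I x ->
            gamma2 + b ^+ 2 * \sum_(i | i != j) derive1n 2 (A i) (x 0 i) = 0]].

(* For m = 2, where beta_0 + beta_1 x_1 + beta_2 x_2 = <mu, beta> and the two
   indices are the elements 0 and 1 of 'I_m. *)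
Definition case_quartic (beta0 : R) (beta_ : 'I_m -> R) : Prop :=
  exists (j1 j2 : 'I_m) (a1 a2 : nat -> R),
    [/\ j1 = 0%N :> nat, j2 = 1%N :> nat,
        (forall x, I j1 x -> A j1 x = \sum_(r < 5) a1 r * x ^+ r)
        /\ (forall x, I j2 x -> A j2 x = \sum_(r < 5) a2 r * x ^+ r)
      & [/\ a2 4%N = - (beta_ j2 ^+ 2 / beta_ j1 ^+ 2) * a1 4%N,
            a2 3%N = - 4 * (beta0 * beta_ j2 / beta_ j1 ^+ 2) * a1 4%N
                   + beta_ j2 / beta_ j1 * a1 3%N
          & a2 2%N = - 6 * (beta0 ^+ 2 / beta_ j1 ^+ 2) * a1 4%N
                   + 3 * (beta0 / beta_ j1) * a1 3%N - a1 2%N]].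

Definition case_affine (S : {set 'I_m}) : Prop :=
  [/\ forall j, j \in S -> poly_deg_le_on (I j) 1 (A j),
      forall r, r \notin S -> poly_deg_le_on (I r) 2 (A r)
    & forall x, box I x -> \sum_(r | r \notin S) derive1n 2 (A r) (x 0 r) = 0].

(* Here <mu, beta> = \sum_(j in S) a_j + \sum_(j in S) b_j x_j. *)
Definition case_multiple : Prop :=
  exists (S : {set 'I_m}) (a b : 'I_m -> R),
    [/\ (2 <= #|S|)%N, forall j, j \in S -> b j != 0,
        beta = \sum_(j in S) ins j (vec2 (a j) (b j)) (e0pow m.-1)
      & (m = 2%N /\ case_quartic (\sum_(j in S) a j) b)
        \/ ((3 <= m)%N /\ case_affine S)].

End Cases.

(* Main.v *)
Require Import Defs.
From HB Require Import structures.
From mathcomp Require Import all_boot all_order all_algebra.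
From mathcomp Require Import all_classical all_reals all_analysis.
From mathcomp Require Import ring lra.

Set Implicit Arguments.
Unset Strict Implicit.
Unset Printing Implicit Defensive.

Import Order.TTheory GRing.Theory Num.Theory.
Import numFieldNormedType.Exports.

Local Open Scope classical_set_scope.
Local Open Scope ring_scope.

(** In the coordinates [(x, t)] the metric is [diag (1 / D_j)] plus the fibre
    metric [H = P^T D P], with [D_j = A_j L], [L = <mu, beta>] and [P] the Jacobian
    of the momentum map [<mu, b_r> / L].  Since [d_k P_jr = - (c_k P_jr + c_j P_kr) / L]
    for [c = dL], every connection coefficient is explicit up to conjugation by [P],
    [P] disappears from all traces, and the scalar curvature [s] satisfies
      [- s L = sum_k (A_k'' L^2 - 2 (m+1) c_k A_k' L + (m+1) (m+2) c_k^2 A_k)].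
    The field [J grad s] is vertical with components [P^-1 (d s)] depending on [x]
    only, so it is Killing iff they are constant, iff [s L] is affine.

    It remains to solve "right-hand side = affine function of [x]".  A variable with
    [c_i = 0] enters through [A_i'' L^2] alone, whence [A_i''] is constant as soon as
    [L] is not.  If [c_i] and [c_k] are both nonzero, the [A_i]-terms are, for fixed
    [x_i], quadratic in [x_k] with leading coefficient [A_i'' c_k^2], while all other
    terms are, for fixed [x_k], quadratic in [x_i]; so three values of [x_k] show that
    [A_i''] is quadratic, and comparing the coefficients of the resulting quartic
    polynomials gives the relations. *)

(** * Partial derivatives on boxes *)

(** The entries of [P] depend on the chosen basis of [h / <beta>], so the curvature has to be
    organized around traces. Yet [P] has an explicit inverse: [<mu, psi_j(x_j)>] vanishes at [x] and
    has differential [-dx_j], so pairing the Jacobian with the [psi_j] gives a multiple of the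
    Kronecker delta. The same [psi_j] define [J dt], which is why [J grad s] is [P^-1 (d s)]. That
    this vector is constant means that [s] and some [<mu, alpha> / L] have the same differential;
    the constant of integration is absorbed by adding a multiple of [beta] to [alpha]. The dichotomy
    between [m = 2] and [m >= 3] comes from one number: with [n = m + 1], the coefficient of
    [x_i^3 x_k] in the two-variable equation carries the factor [n - 3]. Since [partial] returns a
    value even where no derivative exists, differentiability must be carried along: [is_derive] does
    so for single formulas, and an inductive class of smooth functions for the metric
    coefficients. *)

Section PointwiseDerivation.
Context {R : realType} {V : normedModType R}.
Implicit Types (f g : V -> R) (x v : V).

Lemma derives_add f g x v df dg : is_derive x v f df -> is_derive x v g dg ->
  is_derive x v (fun y => f y + g y) (df + dg).
Proof. by move=> hf hg; exact: is_deriveD. Qed.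

Lemma derives_mul f g x v df dg : is_derive x v f df -> is_derive x v g dg ->
  is_derive x v (fun y => f y * g y) (df * g x + f x * dg).
Proof.
move=> hf hg; have := is_deriveM hf hg; rewrite addrC.
by rewrite [g x *: df]mulrC.
Qed.

Lemma derives_sub f g x v df dg : is_derive x v f df -> is_derive x v g dg ->
  is_derive x v (fun y => f y - g y) (df - dg).
Proof. by move=> hf hg; exact: is_deriveB. Qed.

Lemma derives_inv f x v df : f x != 0 -> is_derive x v f df ->
  is_derive x v (fun y => (f y)^-1) (- df / f x ^+ 2).
Proof.
move=> fx0 hf; have dfx : derivable f x v by exact: ex_derive.
split; first exact: derivableV.
by rewrite deriveV// derive_val -[_ *: _]/(_ * _) mulNr mulrC mulNr.
Qed.

Lemma derives_div f g x v df dg : g x != 0 ->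
  is_derive x v f df -> is_derive x v g dg ->
  is_derive x v (fun y => f y / g y) (df / g x - f x * dg / g x ^+ 2).
Proof.
move=> gx0 hf hg; apply: is_derive_eq.
  exact: (derives_mul hf (derives_inv gx0 hg)).
by rewrite mulNr mulrN mulrA.
Qed.

Lemma derives_cst (c : R) x v : is_derive x v (fun _ : V => c) 0.
Proof. exact: is_derive_cst. Qed.

Lemma derives_sum (T : finType) (P : pred T) (F : T -> V -> R) x v dF :
  (forall t, P t -> is_derive x v (F t) (dF t)) ->
  is_derive x v (fun y => \sum_(t | P t) F t y) (\sum_(t | P t) dF t).
Proof.
move=> hF; elim: (index_enum T) => [|t s ih].
  under [fun y => _]eq_fun do rewrite big_nil.
  by rewrite big_nil; exact: derives_cst.
under [fun y => _]eq_fun do rewrite big_cons.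
rewrite big_cons; case: ifPn => // Pt.
exact: derives_add (hF t Pt) ih.
Qed.

Lemma derives_near f g x v df : (\near x, f x = g x) ->
  is_derive x v f df -> is_derive x v g df.
Proof.
move=> fg hf; split; first exact: near_eq_derivable fg (ex_derive).
by rewrite -(near_eq_derive _ fg) derive_val.
Qed.

End PointwiseDerivation.

Section Box.
Context {R : realType} {n : nat}.
Implicit Types (f g : 'rV[R]_n -> R) (x : 'rV[R]_n).

Lemma derives_coord (i j : 'I_n) (F : R -> R) x : derivable F (x 0 j) 1 ->
  is_derive x (delta_mx 0 i) (fun y => F (y 0 j)) ((i == j)%:R * derive1 F (x 0 j)).
Proof.
move=> dF; have [ji|ij] := eqVneq i j.
  move: dF; rewrite -ji => dF.
  have q : (fun h : R => h^-1 *: (F ((h *: delta_mx 0 i + x) 0 i) - F (x 0 i)))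
     = (fun h => h^-1 *: (F (h *: 1 + x 0 i) - F (x 0 i))).
    by apply/funext => h; rewrite !mxE !eqxx.
  split; first by move: dF; rewrite /derivable q.
  by rewrite mul1r derive1E /derive q.
have q : (fun h : R => h^-1 *: (F ((h *: delta_mx 0 i + x) 0 j) - F (x 0 j)))
     = (fun h => 0).
  by apply/funext => h; rewrite !mxE eqxx eq_sym (negbTE ij) mulr0 add0r subrr scaler0.
split.
  by rewrite /derivable q; exact: is_cvg_cst.
by rewrite mul0r /derive q; exact: lim_cst.
Qed.

Variable I : 'I_n -> set R.
Hypothesis hI : forall j, open_interval (I j).

Lemma box_near x : box I x -> \near x, box I x.
Proof.
move=> bx; apply: (@filter_forall _ _ (fun j (y : 'rV[R]_n) => I j (y 0 j)) (nbhs x)).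
move=> j; have [oI _ _] := hI j; apply: (@coord_continuous R 1 n 0 j x (I j)).
by apply: open_nbhs_nbhs; split => //; exact: bx.
Qed.

(** Closure of the smooth functions of one coordinate under the field
    operations; on [box I] it is stable under [partial]. *)
Inductive smooth : ('rV[R]_n -> R) -> Prop :=
| smooth_ext f g : (forall x, box I x -> f x = g x) -> smooth f -> smooth g
| smooth_cst c : smooth (fun=> c)
| smooth_coord j F : smooth_on (I j) F -> smooth (fun x => F (x 0 j))
| smooth_add f g : smooth f -> smooth g -> smooth (fun x => f x + g x)
| smooth_mul f g : smooth f -> smooth g -> smooth (fun x => f x * g x)
| smooth_inv f : (forall x, box I x -> f x != 0) -> smooth f ->
    smooth (fun x => (f x)^-1).

(** Both claims go through one induction: the product and quotient rules that exhibit the partial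
    derivative as smooth need the derivability of the parts. The extensionality case uses that the
    box is open, so that equality on it is equality near each of its points. *)
Lemma smooth_derives f i : smooth f -> 
  (forall x, box I x -> derivable f x (delta_mx 0 i)) /\ smooth (partial i f).
Proof.
elim=> {f} [f g fg _ [df sf]|c|j F sF|f g sf [df sdf] sg [dg sdg]
           |f g sf [df sdf] sg [dg sdg]|f f0 sf [df sdf]].
- have nfg x : box I x -> \near x, f x = g x.
    by move=> /box_near; apply: filterS => y; exact: fg.
  split=> [x bx|]; first exact: near_eq_derivable (nfg _ bx) (df _ bx).
  apply: smooth_ext sf => x bx; exact: near_eq_derive (nfg _ bx).
- split=> [x _|]; first exact: derivable_cst.
  by apply: smooth_ext (smooth_cst 0) => x _; rewrite /partial derive_cst.
- have dF x : box I x -> _ := fun bx => @derives_coord i j F x (sF 0%N _ (bx j)).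
  split=> [x bx|]; first by have [] := dF x bx.
  apply: smooth_ext (smooth_mul (smooth_cst (i == j)%:R) (_ : smooth (fun x =>
    derive1 F (x 0 j)))).
    by move=> x bx; have [_ <-] := dF x bx.
  by apply: smooth_coord => k y Iy; have := sF k.+1 y Iy; rewrite derive1Sn.
- have h x (bx : box I x) := derives_add (derivableP (df x bx)) (derivableP (dg x bx)).
  split=> [x bx|]; first by have [] := h x bx.
  by apply: smooth_ext (smooth_add sdf sdg) => x bx; have [_ <-] := h x bx.
- have h x (bx : box I x) := derives_mul (derivableP (df x bx)) (derivableP (dg x bx)).
  split=> [x bx|]; first by have [] := h x bx.
  apply: smooth_ext (smooth_add (smooth_mul sdf sg) (smooth_mul sf sdg)) => x bx.
  by have [_ <-] := h x bx.
- have h x (bx : box I x) := derives_inv (f0 x bx) (derivableP (df x bx)).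
  split=> [x bx|]; first by have [] := h x bx.
  apply: smooth_ext (smooth_mul (smooth_mul (smooth_cst (-1)) sdf)
    (smooth_mul (smooth_inv f0 sf) (smooth_inv f0 sf))) => x bx.
  by rewrite /partial; have [_ ->] := h x bx; rewrite expr2 invfM mulN1r.
Qed.

Lemma smooth_derivable f i x : smooth f -> box I x -> derivable f x (delta_mx 0 i).
Proof. by move=> /(@smooth_derives _ i)[h _] /h. Qed.

Lemma smooth_partial f i : smooth f -> smooth (partial i f).
Proof. by move=> /(@smooth_derives _ i)[]. Qed.

Lemma partialP f i x : smooth f -> box I x -> 
  is_derive x (delta_mx 0 i) f (partial i f x).
Proof. by move=> sf bx; split; first exact: smooth_derivable. Qed.

Lemma smooth_opp f : smooth f -> smooth (fun x => - f x).
Proof.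
by move=> sf; apply: smooth_ext (smooth_mul (smooth_cst (-1)) sf) => x _; rewrite mulN1r.
Qed.

Lemma smooth_sub f g : smooth f -> smooth g -> smooth (fun x => f x - g x).
Proof. by move=> sf sg; exact: smooth_add sf (smooth_opp sg). Qed.

Lemma smooth_div f g : (forall x, box I x -> g x != 0) ->
  smooth f -> smooth g -> smooth (fun x => f x / g x).
Proof. by move=> g0 sf sg; exact: smooth_mul sf (smooth_inv g0 sg). Qed.

Lemma smooth_sum (T : finType) (P : pred T) (F : T -> 'rV[R]_n -> R) :
  (forall t, P t -> smooth (F t)) -> smooth (fun x => \sum_(t | P t) F t x).
Proof.
move=> sF; elim: (index_enum T) => [|t s ih].
  by apply: smooth_ext (smooth_cst 0) => x _; rewrite big_nil.
have [Pt|Pt] := boolP (P t).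
  by apply: smooth_ext (smooth_add (sF t Pt) ih) => x _; rewrite big_cons Pt.
by apply: smooth_ext ih => x _; rewrite big_cons (negbTE Pt).
Qed.

Lemma smooth_var j : smooth (fun x => x 0 j).
Proof.
apply: (@smooth_coord j id) => -[|k] y _; first exact: derivable_id.
rewrite derive1Sn; have -> : derive1 (@id R) = cst 1 by apply/funext => z; exact: derive1_id.
suff -> : derive1n k (cst 1 : R -> R) = cst (k == 0%N)%:R by exact: derivable_cst.
by elim: k => // k ih; rewrite derive1nS ih; apply/funext => z; exact: derive1_cst.
Qed.

Lemma interval_constant (J : set R) (f : R -> R) : is_interval J ->
  (forall x : R, J x -> is_derive x 1 f 0) -> forall x y : R, J x -> J y -> f x = f y.
Proof.
move=> iJ df x y.
wlog xy : x y / x <= y.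
  by move=> h Jx Jy; case/orP: (le_total x y) => xy; [|apply: esym]; exact: h.
move=> Jx Jy.
have Jz z : z \in `[x, y] -> J z.
  by rewrite in_itv /= => /andP[xz zy]; apply: (iJ x y) => //; rewrite xz zy.
have dI z : z \in `]x, y[ -> is_derive z 1 f 0.
  by move=> zI; apply/df/Jz; exact: subset_itv_oo_cc zI.
have cI : {within `[x, y], continuous f}.
  by apply: derivable_within_continuous => z zI; have [] := df z (Jz z zI).
have [c _ h] := @MVT_segment R f (fun=> 0) x y xy dI cI.
by apply/eqP; rewrite eq_sym -subr_eq0 h mul0r.
Qed.

Definition set_coord x i h : 'rV[R]_n := \row_j if j == i then h else x 0 j.

Lemma box_set_coord x i h : box I x -> I i h -> box I (set_coord x i h).
Proof. by move=> bx Ih j; rewrite mxE; case: eqP => [->|]. Qed.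

Lemma derives_set_coord f x i h : smooth f -> box I x -> I i h ->
  is_derive h 1 (fun k => f (set_coord x i k)) (partial i f (set_coord x i h)).
Proof.
move=> sf bx Ih.
have dz := smooth_derivable (i := i) sf (box_set_coord bx Ih).
have q : (fun k : R => k^-1 *: (f (k *: delta_mx 0 i + set_coord x i h) - f (set_coord x i h)))
     = (fun k => k^-1 *: (f (set_coord x i (k *: 1 + h)) - f (set_coord x i h))).
  apply/funext => k; congr (_ *: (f _ - _)); apply/rowP => j.
  by rewrite !mxE eqxx; case: eqP => _; rewrite ?mulr0 ?add0r.
split; first by move: dz; rewrite /derivable q.
by rewrite /partial /derive q.
Qed.

(* Two points of the box are joined by changing one coordinate at a time. *)
Lemma smooth_constant f : smooth f -> (forall i x, box I x -> partial i f x = 0) ->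
  forall x y, box I x -> box I y -> f x = f y.
Proof.
move=> sf df x y bx bY.
pose z k : 'rV[R]_n := \row_j if (j < k)%N then y 0 j else x 0 j.
have bz k : box I (z k) by move=> j; rewrite mxE; case: ifP.
have -> : x = z 0%N by apply/rowP => j; rewrite mxE.
have -> : y = z n by apply/rowP => j; rewrite mxE ltn_ord.
have : (n <= n)%N by [].
elim: {-2}n => // k ih kn; rewrite ih 1?ltnW//.
pose i := Ordinal kn.
have -> : z k.+1 = set_coord (z k) i (y 0 i).
  by apply/rowP => j; rewrite !mxE ltnS leq_eqVlt -(inj_eq val_inj) /=; case: eqP => //= jk;
    congr (y 0 _); exact: val_inj.
have {1}-> : z k = set_coord (z k) i (x 0 i).
  by apply/rowP => j; rewrite !mxE; case: eqP => // ->; rewrite /= ltnn.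
apply: (@interval_constant (I i) (fun h => f (set_coord (z k) i h))) => //.
  by have [] := hI i.
move=> h Ih; rewrite -(df i _ (box_set_coord (bz k) Ih)).
exact: derives_set_coord.
Qed.
End Box.

(** * The Segre subspace *)

Section SegreCoordinates.
Context {R : realType} {m : nat}.
Implicit Types (x : 'rV[R]_m) (j : 'I_m) (v : 'rV[R]_2).

Lemma tpair_linear (P : tensor R m) : linear (tpair P : tensor R m -> R^o).
Proof.
move=> a u v; rewrite /tpair scaler_sumr -big_split; apply: eq_bigr => s _.
by rewrite !ffunE /= mulrDr mulrCA.
Qed.

HB.instance Definition _ (P : tensor R m) :=
  GRing.isLinear.Build R (tensor R m) R^o _ (tpair P) (tpair_linear P).

HB.instance Definition _ x := GRing.Linear.copy (@mu_pair R m x : tensor R m -> R^o)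
  (tpair (pure (fun i => vec2 1 (x 0 i)))).

Lemma ins_linear j (T : tensor R m.-1) : linear (fun v => ins j v T : tensor R m).
Proof.
by move=> a u v; apply/ffunP => s; rewrite !ffunE !mxE mulrDl -mulrA.
Qed.

(** [ins] with the vector as last argument, so that there is a head symbol to carry the linear
    structure. *)
Definition slot j (T : tensor R m.-1) v : tensor R m := ins j v T.

HB.instance Definition _ j (T : tensor R m.-1) :=
  GRing.isLinear.Build R 'rV[R]_2 (tensor R m) _ (slot j T) (ins_linear j T).

Lemma vec2E (v : 'rV[R]_2) : v = vec2 (v 0 0) (v 0 1).
Proof.
apply/rowP => k; rewrite mxE.
by case: k => [[|[|k]] // ?]; rewrite /=; congr (v 0 _); exact: val_inj.
Qed.

(** Under [mu_pair x] the tensors [e0pow m] and [eps j] become the functions 1 and [x_j]; they span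
    [segre]. *)
Definition eps j : tensor R m := ins j (vec2 0 1) (e0pow m.-1).

Lemma prod_lift j (F : 'I_m -> R) : \prod_i F i = F j * \prod_i F (lift j i).
Proof.
case: m j F => [[]//|n] j F; exact: (bigD1_ord j).
Qed.

Lemma ins_e0pow j : ins j (vec2 1 0) (e0pow m.-1) = e0pow m :> tensor R m.
Proof.
apply/ffunP => s; rewrite !ffunE (prod_lift j); congr (_ * _).
by apply: eq_bigr => i _; rewrite !ffunE.
Qed.

Lemma ins_vec2 j a b :
  ins j (vec2 a b) (e0pow m.-1) = a *: e0pow m + b *: eps j :> tensor R m.
Proof.
rewrite -(ins_e0pow j) /eps -[ins j _ _]/(slot j _ _) -[ins j (vec2 1 0) _]/(slot j _ _)
  -[ins j (vec2 0 1) _]/(slot j _ _) -!linearZ -linearD; congr (slot j _ _).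
by apply/rowP => k; rewrite !mxE; case: ifP => _; rewrite ?mulr0 ?mulr1 ?addr0 ?add0r.
Qed.

(** The sum over all multi-indices factors into a product over the slots of two-term sums; every
    slot other than [j] contributes the factor 1. *)
Lemma mu_pair_ins x j a b : mu_pair x (ins j (vec2 a b) (e0pow m.-1)) = a + b * x 0 j.
Proof.
pose G (i : 'I_m) (k : 'I_2) : R :=
  vec2 1 (x 0 i) 0 k * (if i == j then vec2 a b 0 k else vec2 1 0 0 k).
have -> : mu_pair x (ins j (vec2 a b) (e0pow m.-1)) =
    \sum_(s : {ffun 'I_m -> 'I_2}) \prod_i G i (s i).
  apply: eq_bigr => s _; rewrite !ffunE /G big_split /=; congr (_ * _).
  rewrite (prod_lift j) eqxx; congr (_ * _).
  by apply: eq_bigr => i _; rewrite eq_sym (negbTE (neq_lift _ _)) !ffunE.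
rewrite -bigA_distr_bigA (bigD1 j)//= big_ord_recl big_ord1 /G eqxx !mxE /= mul1r.
rewrite [_ * b]mulrC [X in _ * X]big1 ?mulr1// => i ij.
by rewrite big_ord_recl big_ord1 (negbTE ij) !mxE /= mulr0 addr0 mulr1.
Qed.

Lemma mu_pair_e0pow x : (0 < m)%N -> mu_pair x (e0pow m) = 1.
Proof. by move=> m0; rewrite -(ins_e0pow (Ordinal m0)) mu_pair_ins mul0r addr0. Qed.

Lemma mu_pair_eps x j : mu_pair x (eps j) = x 0 j.
Proof. by rewrite mu_pair_ins add0r mul1r. Qed.

Lemma mu_pair_psi x j y : mu_pair x (psi j y) = y - x 0 j.
Proof. by rewrite mu_pair_ins mulN1r. Qed.

Lemma ins_segre j v : (ins j v (e0pow m.-1) : tensor R m) \in segre.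
Proof.
apply: (subvP (sumv_sup j (erefl _) (subvv _))).
by apply/memv_imgP; exists v; rewrite ?memvf// (lfunE (slot j (e0pow m.-1))).
Qed.

Lemma psi_segre j y : (psi j y : tensor R m) \in segre.
Proof. exact: ins_segre. Qed.

Lemma e0pow_segre : (0 < m)%N -> (e0pow m : tensor R m) \in segre.
Proof. by move=> m0; rewrite -(ins_e0pow (Ordinal m0)) ins_segre. Qed.

Lemma segreP (alpha : tensor R m) : alpha \in segre ->
  exists (c0 : R) (c : 'I_m -> R), alpha = c0 *: e0pow m + \sum_j c j *: eps j.
Proof.
move=> /memv_sumP[u hu ->].
have /fin_all_exists[v uv] : forall j, exists v, u j = ins j v (e0pow m.-1).
  by move=> j; have /memv_imgP[v _ ->] := hu j isT; exists v;
    rewrite (lfunE (slot j (e0pow m.-1))).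
exists (\sum_j v j 0 0), (fun j => v j 0 1).
rewrite scaler_suml -big_split; apply: eq_bigr => j _.
by rewrite uv {1}(vec2E (v j)) ins_vec2.
Qed.

Lemma mu_pair_affine x c0 (c : 'I_m -> R) : (0 < m)%N ->
  mu_pair x (c0 *: e0pow m + \sum_j c j *: eps j) = c0 + \sum_j c j * x 0 j.
Proof.
move=> m0; rewrite linearD linearZ linear_sum /= mu_pair_e0pow//.
congr (_ + _); first exact: mulr1.
by apply: eq_bigr => j _; rewrite linearZ /= mu_pair_eps.
Qed.

Lemma affine_segre c0 (c : 'I_m -> R) : (0 < m)%N ->
  (c0 *: e0pow m + \sum_j c j *: eps j : tensor R m) \in segre.
Proof.
move=> m0; apply: memvD; first by rewrite memvZ// e0pow_segre.
by apply: memv_suml => j _; rewrite memvZ// ins_segre.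
Qed.

Lemma coord_mod_span (beta : tensor R m) (tb : m.-tuple (tensor R m)) c :
  basis_of segre (beta :: tb) -> c \in segre ->
  exists a, c = a *: beta + \sum_r coord_mod beta tb r c *: tnth tb r.
Proof.
move=> hb cs; exists (coord [tuple of beta :: tb] ord0 c).
rewrite {1}(coord_basis hb cs) big_ord_recl /=; congr (_ + _).
by apply: eq_bigr => r _; rewrite (tnth_nth 0).
Qed.

End SegreCoordinates.

(** * Metrics invariant under the fibre coordinates *)

Section Bundle.
Context {R : realType} {m : nat} {I : 'I_m -> set R}.
Hypothesis hI : forall j, open_interval (I j).
Implicit Types (p : 'rV[R]_(m + m)) (G : 'rV[R]_(m + m) -> R) (f : 'rV[R]_m -> R).

Lemma tp_domain_near p : tp_domain I p -> \near p, tp_domain I p.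
Proof.
move=> bp.
apply: (@filter_forall _ _ (fun j (q : 'rV[R]_(m + m)) => I j (lsubmx q 0 j)) (nbhs p)) => j.
have [oI _ _] := hI j.
have q : forall q : 'rV[R]_(m + m), lsubmx q 0 j = q 0 (lshift m j).
  by move=> q; rewrite mxE.
have : nbhs p (fun q : 'rV[R]_(m + m) => I j (q 0 (lshift m j))).
  apply: (@coord_continuous R 1 (m + m) 0 (lshift m j) p (I j)).
  apply: (@open_nbhs_nbhs _ (p 0 (lshift m j))); split => //; rewrite -q; exact: bp.
by apply: filterS => q'; rewrite q.
Qed.

Lemma partial_base G f i p : (forall q, tp_domain I q -> G q = f (lsubmx q)) ->
  tp_domain I p -> partial (lshift m i) G p = partial i f (lsubmx p).
Proof.
move=> Gf bp; rewrite /partial.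
rewrite (near_eq_derive (g := fun q => f (lsubmx q))); last first.
  by move: (tp_domain_near bp); apply: filterS => q; exact: Gf.
suff q : (fun h : R => h^-1 *: (f (lsubmx (h *: delta_mx 0 (lshift m i) + p)) - f (lsubmx p)))
    = (fun h => h^-1 *: (f (h *: delta_mx 0 i + lsubmx p) - f (lsubmx p))) by rewrite /derive q.
apply/funext => h; congr (_ *: (f _ - _)); apply/rowP => j.
by rewrite !mxE !eqxx /= (inj_eq (@lshift_inj _ _)).
Qed.

Lemma partial_fiber G f r p : (forall q, tp_domain I q -> G q = f (lsubmx q)) ->
  tp_domain I p -> partial (rshift m r) G p = 0.
Proof.
move=> Gf bp; rewrite /partial.
rewrite (near_eq_derive (g := fun q => f (lsubmx q))); last first.
  by move: (tp_domain_near bp); apply: filterS => q; exact: Gf.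
rewrite /derive.
have -> : (fun h : R => h^-1 *: (f (lsubmx (h *: delta_mx 0 (rshift m r) + p)) - f (lsubmx p)))
    = fun=> 0.
  apply/funext => h.
  have -> : lsubmx (h *: delta_mx 0 (rshift m r) + p) = lsubmx p.
    by apply/rowP => j; rewrite !mxE !eqxx /= eq_lrshift mulr0 add0r.
  by rewrite subrr scaler0.
exact: lim_cst.
Qed.

Variables (g : 'rV[R]_(m + m) -> 'M[R]_(m + m)).
Variables (D : 'I_m -> 'rV[R]_m -> R) (H Hinv : 'rV[R]_m -> 'M[R]_m).
Hypothesis D_neq0 : forall x, box I x -> forall i, D i x != 0.
Hypothesis gE : forall p, tp_domain I p -> let x := lsubmx p in
  g p = block_mx (diag_mx (\row_i (D i x)^-1)) 0 0 (H x).
Hypothesis HinvK : forall x, box I x -> H x *m Hinv x = 1%:M.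
Hypothesis H_sym : forall x, (H x)^T = H x.

Definition dH k r s x := partial k (fun y => H y r s) x.
(** The three families of Christoffel symbols that can be nonzero: all indices in the base, one
    upper base and two lower fibre indices, and one upper fibre with one lower index of each kind.
    The rest vanish because the metric is block diagonal and independent of the fibre
    coordinates. *)
Definition conn_base k i j x : R := 2^-1 * D k x *
  (partial i (fun y => (j == k)%:R / D j y) x + partial j (fun y => (i == k)%:R / D i y) x
   - partial k (fun y => (i == j)%:R / D i y) x).
Definition conn_fiber k r s x : R := - 2^-1 * D k x * dH k r s x.
Definition conn_mixed q i s x : R := 2^-1 * \sum_l Hinv x q l * dH i l s x.

Section AtPoint.
Variable p : 'rV[R]_(m + m).
Hypothesis bp : tp_domain I p.
Let x := lsubmx p.

Lemma invmx_eq n (X Y : 'M[R]_n) : X *m Y = 1%:M -> invmx X = Y.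
Proof. by move=> XY; have [uX _] := mulmx1_unit XY; rewrite -[LHS]mulmx1 -XY mulKmx. Qed.

Lemma inverse_metricE :
  invmx (g p) = block_mx (diag_mx (\row_i D i x)) 0 0 (Hinv x).
Proof.
apply: invmx_eq; rewrite gE// mulmx_block !mulmx0 !mul0mx !addr0 add0r.
rewrite -/x HinvK// mulmx_diag;
  have -> : (\row_j ((\row_i (D i x)^-1) 0 j * (\row_i D i x) 0 j)) = const_mx 1.
  by apply/rowP => j; rewrite !mxE mulVf// D_neq0.
by rewrite diag_const_mx -scalar_mx_block.
Qed.

Lemma metric_bb q i j : tp_domain I q ->
  g q (lshift m i) (lshift m j) = (i == j)%:R / D i (lsubmx q).
Proof. by move=> bq; rewrite gE// block_mxEul !mxE mulr_natl. Qed.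

Lemma metric_bf q i s : tp_domain I q -> g q (lshift m i) (rshift m s) = 0.
Proof. by move=> bq; rewrite gE// block_mxEur mxE. Qed.

Lemma metric_fb q r j : tp_domain I q -> g q (rshift m r) (lshift m j) = 0.
Proof. by move=> bq; rewrite gE// block_mxEdl mxE. Qed.

Lemma metric_ff q r s : tp_domain I q -> g q (rshift m r) (rshift m s) = H (lsubmx q) r s.
Proof. by move=> bq; rewrite gE// block_mxEdr. Qed.

Lemma inverse_metric_bb i j : invmx (g p) (lshift m i) (lshift m j) = (i == j)%:R * D i x.
Proof. by rewrite inverse_metricE block_mxEul !mxE mulr_natl. Qed.

Lemma inverse_metric_bf i s : invmx (g p) (lshift m i) (rshift m s) = 0.
Proof. by rewrite inverse_metricE block_mxEur mxE. Qed.

Lemma inverse_metric_fb r j : invmx (g p) (rshift m r) (lshift m j) = 0.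
Proof. by rewrite inverse_metricE block_mxEdl mxE. Qed.

Lemma inverse_metric_ff r s : invmx (g p) (rshift m r) (rshift m s) = Hinv x r s.
Proof. by rewrite inverse_metricE block_mxEdr. Qed.

Lemma partial_metric_bb k i j :
  partial (lshift m k) (fun q => g q (lshift m i) (lshift m j)) p
  = partial k (fun y => (i == j)%:R / D i y) x.
Proof. by apply: partial_base => // q bq; exact: metric_bb. Qed.

Lemma partial_metric_ff k r s :
  partial (lshift m k) (fun q => g q (rshift m r) (rshift m s)) p = dH k r s x.
Proof. by apply: partial_base => // q bq; exact: metric_ff. Qed.

Lemma partial_metric_bf k i s : partial k (fun q => g q (lshift m i) (rshift m s)) p = 0.
Proof.
case: (split_ordP k) => [k' ->|k' ->].
  rewrite (@partial_base _ (fun=> 0))// /partial ?derive_cst// => q bq; exact: metric_bf.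
by apply: (@partial_fiber _ (fun=> 0)) => // q bq; exact: metric_bf.
Qed.

Lemma partial_metric_fb k i s : partial k (fun q => g q (rshift m s) (lshift m i)) p = 0.
Proof.
case: (split_ordP k) => [k' ->|k' ->].
  rewrite (@partial_base _ (fun=> 0))// /partial ?derive_cst// => q bq; exact: metric_fb.
by apply: (@partial_fiber _ (fun=> 0)) => // q bq; exact: metric_fb.
Qed.

Lemma partial_metric_fiber r i j : partial (rshift m r) (fun q => g q i j) p = 0.
Proof.
case: (split_ordP i) => [i' ->|i' ->]; case: (split_ordP j) => [j' ->|j' ->].
- apply: (@partial_fiber _ (fun y => (i' == j')%:R / D i' y)) => // q bq; exact: metric_bb.
- exact: partial_metric_bf.
- exact: partial_metric_fb.
- apply: (@partial_fiber _ (fun y => H y i' j')) => // q bq; exact: metric_ff.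
Qed.

Definition partial_metricE := (partial_metric_bb, partial_metric_ff, partial_metric_bf,
  partial_metric_fb, partial_metric_fiber).

Lemma sum_delta (T : finType) (k : T) (F : T -> R) :
  \sum_l (k == l)%:R * F l = F k.
Proof.
rewrite (bigD1 k)//= eqxx mul1r big1 ?addr0// => l lk.
by rewrite eq_sym (negbTE lk) mul0r.
Qed.

Lemma christoffel_base k a b : christoffel g (lshift m k) a b p =
  2^-1 * D k x * (partial a (fun q => g q b (lshift m k)) p
    + partial b (fun q => g q a (lshift m k)) p - partial (lshift m k) (fun q => g q a b) p).
Proof.
rewrite /christoffel big_split_ord /= [X in _ + X]big1 => [|s _]; last first.
  by rewrite inverse_metric_bf mul0r.
rewrite addr0 -mulrA; congr (_ * _).
under eq_bigr do rewrite inverse_metric_bb -mulrA.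
exact: sum_delta.
Qed.

Lemma christoffel_fib r a b : christoffel g (rshift m r) a b p =
  2^-1 * \sum_s Hinv x r s * (partial a (fun q => g q b (rshift m s)) p
    + partial b (fun q => g q a (rshift m s)) p).
Proof.
rewrite /christoffel big_split_ord /= [X in X + _]big1 => [|s _]; last first.
  by rewrite inverse_metric_fb mul0r.
rewrite add0r; congr (_ * _); apply: eq_bigr => s _.
by rewrite inverse_metric_ff partial_metric_fiber subr0.
Qed.

Lemma christoffel_bbb k i j :
  christoffel g (lshift m k) (lshift m i) (lshift m j) p = conn_base k i j x.
Proof. by rewrite christoffel_base !partial_metricE. Qed.

Lemma christoffel_bbf k i s :
  christoffel g (lshift m k) (lshift m i) (rshift m s) p = 0.
Proof. by rewrite christoffel_base !partial_metricE !subr0 addr0 mulr0. Qed.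

Lemma christoffel_bfb k i s :
  christoffel g (lshift m k) (rshift m s) (lshift m i) p = 0.
Proof. by rewrite christoffel_base !partial_metricE !subr0 addr0 mulr0. Qed.

Lemma christoffel_bff k r s :
  christoffel g (lshift m k) (rshift m r) (rshift m s) p = conn_fiber k r s x.
Proof. by rewrite christoffel_base !partial_metricE addr0 sub0r mulrN -!mulNr. Qed.

Lemma christoffel_fbb q i j :
  christoffel g (rshift m q) (lshift m i) (lshift m j) p = 0.
Proof.
rewrite christoffel_fib big1 ?mulr0// => s _.
by rewrite !partial_metricE addr0 mulr0.
Qed.

Lemma christoffel_fbf q i s :
  christoffel g (rshift m q) (lshift m i) (rshift m s) p = conn_mixed q i s x.
Proof.
rewrite christoffel_fib; congr (_ * _); apply: eq_bigr => l _.
rewrite !partial_metricE addr0 /dH; congr (_ * partial _ _ _); apply/funext => y.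
by rewrite -{1}H_sym mxE.
Qed.

Lemma christoffel_ffb q i s :
  christoffel g (rshift m q) (rshift m s) (lshift m i) p = conn_mixed q i s x.
Proof.
rewrite -christoffel_fbf !christoffel_fib; congr (_ * _); apply: eq_bigr => l _.
by rewrite addrC.
Qed.

Lemma christoffel_fff q r s :
  christoffel g (rshift m q) (rshift m r) (rshift m s) p = 0.
Proof.
rewrite christoffel_fib big1 ?mulr0// => l _.
by rewrite !partial_metricE addr0 mulr0.
Qed.

End AtPoint.

Definition christoffelE := (christoffel_bbb, christoffel_bbf, christoffel_bfb,
  christoffel_bff, christoffel_fbb, christoffel_fbf, christoffel_ffb, christoffel_fff).

Lemma partial_christoffel_fiber p r k a b : tp_domain I p ->
  partial (rshift m r) (christoffel g k a b) p = 0.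
Proof.
move=> bp; case: (split_ordP k) => [k' ->|k' ->]; case: (split_ordP a) => [a' ->|a' ->];
  case: (split_ordP b) => [b' ->|b' ->].
- by apply: partial_fiber bp => q bq; exact: christoffel_bbb.
- by apply: (@partial_fiber _ (fun=> 0)) bp => q bq; exact: christoffel_bbf.
- by apply: (@partial_fiber _ (fun=> 0)) bp => q bq; exact: christoffel_bfb.
- by apply: partial_fiber bp => q bq; exact: christoffel_bff.
- by apply: (@partial_fiber _ (fun=> 0)) bp => q bq; exact: christoffel_fbb.
- by apply: partial_fiber bp => q bq; exact: christoffel_fbf.
- by apply: partial_fiber bp => q bq; exact: christoffel_ffb.
- by apply: (@partial_fiber _ (fun=> 0)) bp => q bq; exact: christoffel_fff.
Qed.

(** Diagonal entries suffice, since the base block of the inverse metric is diagonal and the scalar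
    curvature sees no other ones. *)
Lemma ricci_base p i : tp_domain I p -> let x := lsubmx p in
  ricci g (lshift m i) (lshift m i) p =
  \sum_k (partial k (conn_base k i i) x - partial i (conn_base k i k) x
          + \sum_l (conn_base k k l x * conn_base l i i x
                    - conn_base k i l x * conn_base l i k x))
  + \sum_q (- partial i (conn_mixed q i q) x
            + \sum_l conn_mixed q l q x * conn_base l i i x
            - \sum_s conn_mixed q i s x * conn_mixed s i q x).
Proof.
move=> bp x; rewrite /ricci big_split_ord /=; congr (_ + _); apply: eq_bigr => k _.
  rewrite (@partial_base _ (conn_base k i i))//; last by move=> q bq; exact: christoffel_bbb.
  rewrite (@partial_base _ (conn_base k i k))//; last by move=> q bq; exact: christoffel_bbb.
  congr (_ + _); rewrite big_split_ord /= [X in _ + X]big1 ?addr0 => [|s _].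
    by apply: eq_bigr => l _; rewrite !christoffelE.
  by rewrite !christoffelE// !(mulr0, mul0r) subrr.
rewrite partial_christoffel_fiber// sub0r.
rewrite (@partial_base _ (conn_mixed k i k))//; last by move=> q bq; exact: christoffel_fbf.
rewrite -addrA; congr (_ + _); rewrite big_split_ord /=.
congr (_ + _).
  by apply: eq_bigr => l _; rewrite !christoffelE// !(mulr0, mul0r) subr0.
rewrite -sumrN; apply: eq_bigr => s _.
by rewrite !christoffelE// !(mulr0, mul0r) sub0r.
Qed.

Lemma ricci_fiber p r s : tp_domain I p -> let x := lsubmx p in
  ricci g (rshift m r) (rshift m s) p =
  \sum_k (partial k (conn_fiber k r s) x
          + \sum_l conn_base k k l x * conn_fiber l r s x
          - \sum_q conn_fiber k s q x * conn_mixed q k r x)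
  + \sum_q \sum_l (conn_mixed q l q x * conn_fiber l r s x
                   - conn_mixed q l s x * conn_fiber l r q x).
Proof.
move=> bp x; rewrite /ricci big_split_ord /=; congr (_ + _); apply: eq_bigr => k _.
  rewrite (@partial_base _ (conn_fiber k r s))//; last by move=> q bq; exact: christoffel_bff.
  rewrite partial_christoffel_fiber// subr0 -addrA; congr (_ + _).
  rewrite big_split_ord /= -sumrN; congr (_ + _); apply: eq_bigr => l _.
    by rewrite !christoffelE// !(mulr0, mul0r) subr0.
  by rewrite !christoffelE// !(mulr0, mul0r) sub0r.
rewrite !partial_christoffel_fiber// subr0 add0r big_split_ord /=.
rewrite [X in _ + X]big1 ?addr0 => [|q _]; last by rewrite !christoffelE// !(mulr0, mul0r) subr0.
by apply: eq_bigr => l _; rewrite !christoffelE.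
Qed.

Lemma scalar_curvature_block p : tp_domain I p -> let x := lsubmx p in
  scalar_curvature g p = \sum_i D i x * ricci g (lshift m i) (lshift m i) p
    + \sum_r \sum_s Hinv x r s * ricci g (rshift m r) (rshift m s) p.
Proof.
move=> bp x; rewrite /scalar_curvature big_split_ord /=; congr (_ + _); apply: eq_bigr => i _.
  rewrite big_split_ord /= [X in _ + X]big1 ?addr0 => [|s _];
    last by rewrite inverse_metric_bf// mul0r.
  under eq_bigr do rewrite inverse_metric_bb// -mulrA.
  exact: sum_delta.
rewrite big_split_ord /= [X in X + _]big1 ?add0r => [|s _];
  last by rewrite inverse_metric_fb// mul0r.
by apply: eq_bigr => s _; rewrite inverse_metric_ff.
Qed.

(** For a vertical field depending on [x] only, the Lie derivative of the metric reduces to terms in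
    the derivatives of the field. Its mixed block is the fibre metric applied to [partial i K], and
    the fibre metric is invertible. *)
Lemma killing_blockP (K : 'rV[R]_(m + m) -> 'cV[R]_(m + m)) (kv : 'I_m -> 'rV[R]_m -> R) :
  (forall p, tp_domain I p -> forall i, K p (lshift m i) 0 = 0) ->
  (forall p, tp_domain I p -> forall r, K p (rshift m r) 0 = kv r (lsubmx p)) ->
  killing_on (tp_domain I) g K <-> forall x, box I x -> forall i r, partial i (kv r) x = 0.
Proof.
move=> Kb Kf.
have dKb p (bp : tp_domain I p) j i : partial j (fun q => K q (lshift m i) 0) p = 0.
  case: (split_ordP j) => [j' ->|j' ->].
    by rewrite (@partial_base _ (fun=> 0))// /partial ?derive_cst// => q bq; exact: Kb.
  by apply: (@partial_fiber _ (fun=> 0)) => // q bq; exact: Kb.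
have dKf p (bp : tp_domain I p) r s : partial (rshift m s) (fun q => K q (rshift m r) 0) p = 0.
  by apply: partial_fiber bp => q bq; exact: Kf.
have dKbf p (bp : tp_domain I p) r i :
    partial (lshift m i) (fun q => K q (rshift m r) 0) p = partial i (kv r) (lsubmx p).
  by apply: partial_base bp => q bq; exact: Kf.
have lieE p (bp : tp_domain I p) a b : lie_metric K g p a b =
    \sum_q (g p (rshift m q) b * partial a (fun y => K y (rshift m q) 0) p
            + g p a (rshift m q) * partial b (fun y => K y (rshift m q) 0) p).
  rewrite /lie_metric big_split_ord /= big1 ?add0r => [|k _]; last first.
    by rewrite Kb// !dKb// !(mul0r, mulr0) !addr0.
  by apply: eq_bigr => q _; rewrite partial_metric_fiber// mulr0 add0r.
split=> [kil x bx i r|dkv p bp a b].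
  pose p := row_mx x (0 : 'rV[R]_m).
  have px : lsubmx p = x by rewrite row_mxKl.
  have bp : tp_domain I p by rewrite /tp_domain /= px.
  pose w : 'cV[R]_m := \col_q partial i (kv q) x.
  suff w0 : w = 0 by have /matrixP/(_ r 0) := w0; rewrite !mxE.
  have Hw : H x *m w = 0.
    apply/matrixP => s j; rewrite !mxE;
      transitivity (lie_metric K g p (lshift m i) (rshift m s)); last exact: kil.
    rewrite lieE//; apply: eq_bigr => q _;
      rewrite metric_bf// mul0r addr0 dKbf// metric_ff// px mxE.
    by rewrite -{1}H_sym mxE.
  by rewrite -[w]mul1mx -(mulmx1C (HinvK bx)) -mulmxA Hw mulmx0.
rewrite lieE// big1// => q _.
have z c : partial c (fun y => K y (rshift m q) 0) p = 0.
  by case: (split_ordP c) => [j ->|j ->]; rewrite ?dKf// dKbf// dkv.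
by rewrite !z !mulr0 addr0.
Qed.

End Bundle.

(** * The scalar curvature *)

Section ArrowSums.
Context {R : realType} {m : nat}.
Implicit Types (k : 'I_m) (u p q : 'I_m -> R).

(** The matrix [diag u - p e_k^T - e_k q^T]: a diagonal altered in column [k] by [p] and in row [k]
    by [q]. All connection matrices below have this shape, up to conjugation and a scalar. *)
Definition arrow u p q k (i j : 'I_m) : R :=
  (i == j)%:R * u i - (k == j)%:R * p i - (k == i)%:R * q j.

Lemma sum_arrow u p q k i (G : 'I_m -> R) :
  \sum_j arrow u p q k i j * G j
  = u i * G i - p i * G k - (k == i)%:R * \sum_j q j * G j.
Proof.
have h1 := sum_delta i (fun j => u i * G j).
have h2 := sum_delta k (fun j => p i * G j).
rewrite /= in h1 h2; rewrite -h1 -h2 mulr_sumr -!sumrB.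
by apply: eq_bigr => j _; rewrite /arrow; ring.
Qed.

Lemma trace_arrow u p q k : \sum_i arrow u p q k i i = \sum_i u i - p k - q k.
Proof.
rewrite -(sum_delta k p) -(sum_delta k q) -!sumrB.
by apply: eq_bigr => i _; rewrite /arrow eqxx mul1r.
Qed.

(** Expansion of the square of [diag u - p e_k^T - e_k q^T] under the trace; the sum over
    [p i * q i] comes from the product of the column with the row, which occurs in both orders. *)
Lemma trace_arrow_sqr u p q k : \sum_i \sum_j arrow u p q k i j * arrow u p q k j i
  = \sum_i u i ^+ 2 - 2 * u k * (p k + q k) + p k ^+ 2 + q k ^+ 2
    + 2 * \sum_i p i * q i.
Proof.
under eq_bigr do rewrite sum_arrow.
have -> : \sum_j (u j * arrow u p q k j j - p j * arrow u p q k k j -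
      (k == j)%:R * (\sum_l q l * arrow u p q k l j))
  = \sum_j u j ^+ 2 - \sum_j (k == j)%:R * (u j * p j) - \sum_j (k == j)%:R * (u j * q j)
    - \sum_j (k == j)%:R * (u k * p j) + \sum_j (k == j)%:R * (p k * p j)
    + \sum_j p j * q j - \sum_l q l * arrow u p q k l k.
  rewrite [X in _ = _ - X](_ : _ = \sum_j (k == j)%:R * (\sum_l q l * arrow u p q k l j)).
    by rewrite -!sumrB -!big_split -sumrB; apply: eq_bigr => j _;
      rewrite /arrow !eqxx mulr1n /=; ring.
  by rewrite (sum_delta k (fun j => \sum_l q l * arrow u p q k l j)).
have -> : \sum_l q l * arrow u p q k l k
  = \sum_l (k == l)%:R * (u l * q l) - \sum_l p l * q l - \sum_l (k == l)%:R * (q l * q k).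
  by rewrite -!sumrB; apply: eq_bigr => l _; rewrite /arrow eqxx mulr1n [l == k]eq_sym; ring.
rewrite !sum_delta; ring.
Qed.

Lemma sum_spike k (e f : R) : \sum_i ((k == i)%:R * e - f) = e - m%:R * f.
Proof.
by rewrite sumrB (sum_delta k (fun=> e)) sumr_const card_ord mulr_natl.
Qed.

Lemma sum_spike_sqr k (e f : R) :
  \sum_i ((k == i)%:R * e - f) ^+ 2 = e ^+ 2 - 2 * e * f + m%:R * f ^+ 2.
Proof.
have -> : e ^+ 2 - 2 * e * f + m%:R * f ^+ 2 =
  \sum_(i : 'I_m) ((k == i)%:R * (e ^+ 2 - 2 * e * f) - (- f ^+ 2)) by rewrite sum_spike; ring.
by apply: eq_bigr => i _; case: (k == i); rewrite ?mulr1n ?mulr0n; ring.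
Qed.

(** Bookkeeping: the base contractions [X] and the fibre contractions [Z] are brought together,
    since only their sum, the full trace of the connection, is simple. *)
Lemma sum_split_base (p1 p2 p3 : 'I_m -> R) (X Y Z W : 'I_m -> 'I_m -> R) :
  \sum_k (p1 k - p2 k + \sum_l (X k l - Y k l))
  + \sum_q (- p3 q + \sum_l Z q l - \sum_s W q s) =
  \sum_k p1 k - (\sum_k p2 k + \sum_q p3 q) + \sum_l (\sum_k X k l + \sum_q Z q l)
  - \sum_k \sum_l Y k l - \sum_q \sum_s W q s.
Proof.
have eX : \sum_l \sum_k X k l = \sum_k \sum_l X k l by exact: exchange_big.
have eZ : \sum_l \sum_q Z q l = \sum_q \sum_l Z q l by exact: exchange_big.
rewrite [\sum_l (_ + _)]big_split /= eX eZ.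
rewrite !(sumrB, big_split, sumrN) /=.
under [\sum_k \sum_l (_ - _)]eq_bigr do rewrite sumrB.
by rewrite sumrB; ring.
Qed.

Lemma sum_split_fiber (p F : 'I_m -> R) (B U T W : 'I_m -> 'I_m -> R) :
  \sum_k (p k + \sum_l B k l * F l - \sum_q U k q)
  + \sum_q \sum_l (T l q * F l - W l q) =
  \sum_k (p k + (\sum_j B j k + \sum_q T k q) * F k - \sum_q U k q - \sum_q W k q).
Proof.
have eB : \sum_k \sum_l B k l * F l = \sum_k (\sum_j B j k) * F k.
  by rewrite exchange_big; apply: eq_bigr => k _; rewrite mulr_suml.
have eT : \sum_q \sum_l (T l q * F l - W l q)
    = \sum_k ((\sum_q T k q) * F k - \sum_q W k q).
  by rewrite exchange_big; apply: eq_bigr => k _; rewrite sumrB mulr_suml.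
rewrite eT !(sumrB, big_split) /= eB.
under [X in _ = _ + X - _ - _]eq_bigr do rewrite mulrDl.
by rewrite big_split /=; ring.
Qed.

Lemma sum2_linear (h p f u w : 'I_m -> 'I_m -> R) (e : R) :
  \sum_r \sum_s h r s * (p r s + e * f r s - u r s - w r s) =
  \sum_r \sum_s h r s * p r s + e * (\sum_r \sum_s h r s * f r s)
  - \sum_r \sum_s h r s * u r s - \sum_r \sum_s h r s * w r s.
Proof.
rewrite mulr_sumr -big_split -!sumrB; apply: eq_bigr => r _ /=.
rewrite mulr_sumr -big_split -!sumrB; apply: eq_bigr => s _ /=.
by ring.
Qed.

End ArrowSums.

(** * Connection, Ricci contractions and scalar curvature for a fibre metric [P^T D P] *)

Section Curvature.
Context {R : realType} {m : nat} {I : 'I_m -> set R}.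
Hypothesis hI : forall j, open_interval (I j).
Variables (A : 'I_m -> R -> R) (L : 'rV[R]_m -> R) (c : 'I_m -> R).
Variables (P Pinv : 'rV[R]_m -> 'M[R]_m).
Hypothesis A_smooth : forall j, smooth_on (I j) (A j).
Hypothesis A_neq0 : forall j x, I j x -> A j x != 0.
Hypothesis L_smooth : smooth I L.
Hypothesis L_neq0 : forall x, box I x -> L x != 0.
Hypothesis dL : forall x i, box I x -> partial i L x = c i.
Hypothesis P_smooth : forall j r, smooth I (fun x => P x j r).
Hypothesis Pinv_smooth : forall r j, smooth I (fun x => Pinv x r j).
Hypothesis PK : forall x, box I x -> P x *m Pinv x = 1%:M.
Hypothesis dP : forall x k j r, box I x ->
  partial k (fun y => P y j r) x = - (c k * P x j r + c j * P x k r) / L x.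
Implicit Types (x : 'rV[R]_m) (i j k l r s q : 'I_m).

Definition cf n i x : R := derive1n n (A i) (x 0 i).
Notation a := (cf 0).
Notation a1 := (cf 1).
Notation a2 := (cf 2).
(** [dg] is the diagonal factor [D] of the metric; [lam] and [dlog] are the logarithmic derivatives
    of [L] and of [A i]. *)
Definition dg i x : R := a i x * L x.
Definition lam i x : R := c i / L x.
Definition dlog i x : R := a1 i x / a i x.

Lemma cf_smooth n i : smooth I (cf n i).
Proof.
apply: (@smooth_coord _ _ _ i (derive1n n (A i))) => k y Iy.
have -> : derive1n k (derive1n n (A i)) = derive1n (k + n) (A i).
  by elim: k => // k ih; rewrite addSn !derive1nS ih.
exact: A_smooth.
Qed.

Lemma derives_cf n i k x : box I x ->
  is_derive x (delta_mx 0 k) (cf n i) ((k == i)%:R * cf n.+1 i x).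
Proof. by move=> bx; apply: derives_coord; exact: A_smooth. Qed.

Lemma a_neq0 i x : box I x -> a i x != 0.
Proof. by move=> bx; exact: A_neq0. Qed.

Lemma dg_neq0 x : box I x -> forall i, dg i x != 0.
Proof. by move=> bx i; rewrite mulf_neq0 ?a_neq0 ?L_neq0. Qed.

Lemma dg_smooth i : smooth I (dg i).
Proof. exact: smooth_mul (cf_smooth 0 i) L_smooth. Qed.

Lemma derives_L k x : box I x -> is_derive x (delta_mx 0 k) L (c k).
Proof. by move=> bx; rewrite -(dL k bx); exact: (partialP hI). Qed.

Lemma derives_dg k i x : box I x ->
  is_derive x (delta_mx 0 k) (dg i) ((k == i)%:R * a1 i x * L x + a i x * c k).
Proof. by move=> bx; exact: derives_mul (derives_cf 0 i k bx) (derives_L k bx). Qed.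

Lemma derives_P k j r x : box I x -> is_derive x (delta_mx 0 k) (fun y => P y j r)
  (- (c k * P x j r + c j * P x k r) / L x).
Proof. by move=> bx; rewrite -(dP k j r bx); exact: (partialP hI). Qed.

Definition hfib x : 'M[R]_m := (P x)^T *m diag_mx (\row_i dg i x) *m P x.
Definition hfib_inv x : 'M[R]_m := Pinv x *m diag_mx (\row_i (dg i x)^-1) *m (Pinv x)^T.

Lemma hfibE x r s : hfib x r s = \sum_j P x j r * dg j x * P x j s.
Proof. by rewrite mxE; apply: eq_bigr => j _; rewrite mul_mx_diag !mxE. Qed.

Lemma hfib_sym x : (hfib x)^T = hfib x.
Proof. by rewrite /hfib !trmx_mul trmxK tr_diag_mx mulmxA. Qed.

Lemma hfib_inv_sym x : (hfib_inv x)^T = hfib_inv x.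
Proof. by rewrite /hfib_inv !trmx_mul trmxK tr_diag_mx mulmxA. Qed.

Lemma PinvK x : box I x -> Pinv x *m P x = 1%:M.
Proof. by move=> bx; apply: mulmx1C; exact: PK. Qed.

Lemma dgK x : box I x ->
  diag_mx (\row_i dg i x) *m diag_mx (\row_i (dg i x)^-1) = 1%:M :> 'M[R]_m.
Proof.
move=> bx; rewrite mulmx_diag -diag_const_mx; congr diag_mx.
by apply/rowP => j; rewrite !mxE divff// dg_neq0.
Qed.

Lemma hfibK x : box I x -> hfib x *m hfib_inv x = 1%:M.
Proof.
move=> bx; rewrite /hfib /hfib_inv !mulmxA -(mulmxA _ (P x)) PK// mulmx1.
by rewrite -(mulmxA _ (diag_mx _) (diag_mx _)) dgK// mulmx1 -trmx_mul PinvK// trmx1.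
Qed.

Lemma hfibVK x : box I x -> hfib_inv x *m hfib x = 1%:M.
Proof. by move=> bx; apply: mulmx1C; exact: hfibK. Qed.

(* [H^-1 d_k H] conjugated by [P]; see [dH_hfib]. *)
Definition Bmx k x : 'M[R]_m := \matrix_(i, j)
  arrow (fun i => (k == i)%:R * dlog k x - lam k x) (lam^~ x)
    (fun j => a j x * lam j x / a k x) k i j.
Definition Mmx k x : 'M[R]_m := Pinv x *m Bmx k x *m P x.

(** By [dP], the derivative of [P] is [E P] with [E = - (lam_k 1 + lam e_k^T)]. Differentiating
    [P^T D P] therefore gives [P^T D B P] with [B = D^-1 E^T D + D^-1 (d_k D) + E], which is
    [Bmx k]: its column comes from [E], its row from the transpose. *)
Lemma dH_hfib k r s x : box I x -> dH hfib k r s x = (hfib x *m Mmx k x) r s.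
Proof.
move=> bx.
have -> : hfib x *m Mmx k x = (P x)^T *m (diag_mx (\row_i dg i x) *m (Bmx k x *m P x)).
  by rewrite /hfib /Mmx -!mulmxA (mulmxA (P x)) PK// mul1mx.
rewrite mxE; have L0 := L_neq0 bx.
have -> : dH hfib k r s x = \sum_j
   ((- (c k * P x j r + c j * P x k r) / L x * dg j x
     + P x j r * ((k == j)%:R * a1 j x * L x + a j x * c k)) * P x j s
    + P x j r * dg j x * (- (c k * P x j s + c j * P x k s) / L x)).
  rewrite /dH /partial; under [fun y => _]eq_fun do rewrite hfibE.
  apply: derive_val; apply: derives_sum => j _.
  by apply: derives_mul; [apply: derives_mul|]; try exact: derives_P; exact: derives_dg.
have -> : \sum_j (P x)^T r j * (diag_mx (\row_i dg i x) *m (Bmx k x *m P x)) j s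
   = \sum_i (P x i r * dg i x * ((k == i)%:R * dlog k x - lam k x) * P x i s
             - P x i r * dg i x * lam i x * P x k s
             - P x k r * L x * (a i x * lam i x) * P x i s).
  (* The row of [Bmx k x] contributes only to the summand of index [k]; it is spread over all
     indices here, to match the derivative term by term. *)
  rewrite sumrB; have -> : \sum_i P x k r * L x * (a i x * lam i x) * P x i s =
     \sum_i (k == i)%:R * (P x i r * dg i x * \sum_j (a j x * lam j x / a i x) * P x j s).
    rewrite sum_delta mulr_sumr; apply: eq_bigr => i _.
    by rewrite /dg; field; rewrite a_neq0.
  rewrite -sumrB; apply: eq_bigr => i _.
  rewrite mul_diag_mx !mxE.
  have -> : \sum_j Bmx k x i j * P x j s =
     ((k == i)%:R * dlog k x - lam k x) * P x i s - lam i x * P x k s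
     - (k == i)%:R * \sum_j (a j x * lam j x / a i x) * P x j s.
    under eq_bigr do rewrite mxE.
    rewrite sum_arrow; have [->|] := eqVneq k i; rewrite // !mul0r//.
  by ring.
apply: eq_bigr => j _; rewrite /lam /dlog /dg; have := a_neq0 k bx; have := a_neq0 j bx => aj0.
move=> ak0; have [<-|_] := eqVneq k j; rewrite ?mulr1n ?mulr0n; field; rewrite ?ak0 ?aj0 ?L0//.
Qed.

Lemma sum_BmxE k x : box I x ->
  \tr (Bmx k x *m Bmx k x) = dlog k x ^+ 2 - 6 * dlog k x * lam k x
    + (m%:R + 6) * lam k x ^+ 2 + 2 / a k x * \sum_j a j x * lam j x ^+ 2.
Proof.
move=> bx; have ak0 := a_neq0 k bx.
rewrite /mxtrace; under eq_bigr => i _.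
  rewrite mxE; under eq_bigr => j _ do rewrite !mxE; over.
rewrite trace_arrow_sqr sum_spike_sqr eqxx mulr1n.
have -> : \sum_i lam i x * (a i x * lam i x / a k x) = (\sum_j a j x * lam j x ^+ 2) / a k x.
  by rewrite mulr_suml; apply: eq_bigr => i _; ring.
by field.
Qed.

(** Conjugation by [P] does not change the trace; the value is the logarithmic derivative of the
    determinant of the fibre metric. *)
Lemma trace_Mmx k x : box I x -> \tr (Mmx k x) = dlog k x - (m%:R + 2) * lam k x.
Proof.
move=> bx; have ak0 := a_neq0 k bx.
rewrite /Mmx mxtrace_mulC mulmxA PK// mul1mx /mxtrace.
under eq_bigr do rewrite mxE.
by rewrite trace_arrow sum_spike; field.
Qed.

Lemma trace_Mmx_sqr k x : box I x -> \tr (Mmx k x *m Mmx k x) = \tr (Bmx k x *m Bmx k x).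
Proof.
move=> bx; have -> : Mmx k x *m Mmx k x = Pinv x *m (Bmx k x *m Bmx k x) *m P x.
  by rewrite /Mmx !mulmxA -(mulmxA _ (P x)) PK// mulmx1.
by rewrite mxtrace_mulC !mulmxA PK// mul1mx.
Qed.

Lemma conn_mixed_Mmx q i s x : box I x ->
  conn_mixed hfib hfib_inv q i s x = 2^-1 * Mmx i x q s.
Proof.
move=> bx; congr (_ * _).
under eq_bigr do rewrite dH_hfib//.
have h : Mmx i x = hfib_inv x *m (hfib x *m Mmx i x) by rewrite mulmxA hfibVK// mul1mx.
by rewrite [in RHS]h mxE.
Qed.

Lemma conn_fiber_Mmx k r s x : box I x ->
  conn_fiber dg hfib k r s x = - 2^-1 * dg k x * (hfib x *m Mmx k x) r s.
Proof. by move=> bx; rewrite /conn_fiber dH_hfib. Qed.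

(** With the lower index [i] fixed, the base Christoffel symbols again form an arrow matrix in
    [(k, j)], located at [i], so the trace formulas apply to them as well. The proof distinguishes
    the coincidences among the three indices. *)
Lemma conn_baseE k i j x : box I x -> conn_base dg k i j x =
  - 2^-1 * arrow (fun k => lam i x + (i == k)%:R * dlog i x)
    (fun k => a k x * lam k x / a i x) (fun l => - lam l x) i k j.
Proof.
move=> bx.
have d1 b n l : partial b (fun y => n / dg l y) x =
    - (n * ((b == l)%:R * a1 l x * L x + a l x * c b)) / dg l x ^+ 2.
  apply: derive_val; apply: is_derive_eq.
    exact: derives_div (dg_neq0 bx l) (derives_cst n _ _) (derives_dg b l bx).
  by rewrite mul0r sub0r mulNr.
rewrite /conn_base !d1 /arrow /dg /lam /dlog.
have L0 := L_neq0 bx; have ai0 := a_neq0 i bx; have aj0 := a_neq0 j bx.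
have ak0 := a_neq0 k bx.
have [ij|ij] := eqVneq i j.
  rewrite -{j}ij in aj0 *; have [ik|ik] := eqVneq i k.
    by rewrite -{k}ik in ak0 *; rewrite ?eqxx mulr1n; field; rewrite L0 ai0.
  by rewrite ?[k == i]eq_sym ?(negbTE ik) mulr1n mulr0n; field; rewrite L0 ai0.
have [ik|ik] := eqVneq i k.
  rewrite -{k}ik in ak0 *; rewrite ?eqxx ?[j == i]eq_sym ?(negbTE ij) mulr1n mulr0n.
  by field; rewrite L0 ai0 aj0.
have [jk|jk] := eqVneq j k.
  by rewrite -{k}jk in ak0 ik *; rewrite ?eqxx mulr1n mulr0n; field; rewrite ?L0 ?ai0 ?aj0.
by rewrite ?[k == j]eq_sym ?(negbTE jk) mulr0n; ring.
Qed.

Lemma conn_base_sym k i j : conn_base dg k i j = conn_base dg k j i.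
Proof.
have e : (fun y => (i == j)%:R / dg i y) = (fun y => (j == i)%:R / dg j y).
  by apply/funext => y; rewrite eq_sym; have [->|] := eqVneq j i; rewrite // !mul0r.
by apply/funext => x; rewrite /conn_base e [partial i _ _ + _]addrC.
Qed.

Lemma conn_base_smooth k i j : smooth I (conn_base dg k i j).
Proof.
have h b i' j' : smooth I (partial b (fun y => (i' == j')%:R / dg i' y)).
  apply: (smooth_partial hI); apply: smooth_div (smooth_cst _ _) (dg_smooth _) => x bx.
  exact: dg_neq0.
by apply: smooth_mul; [apply: smooth_mul (smooth_cst _ _) (dg_smooth _)|
  apply: smooth_sub => //; exact: smooth_add].
Qed.

Lemma lam_smooth i : smooth I (lam i).
Proof. exact: smooth_div (smooth_cst _ _) L_smooth. Qed.

Lemma Mmx_smooth k r s : smooth I (fun x => Mmx k x r s).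
Proof.
have a0 i x (bx : box I x) : a i x != 0 := a_neq0 i bx.
have Bsm i j : smooth I (fun x => Bmx k x i j).
  apply: smooth_ext (smooth_sub (smooth_sub
    (smooth_mul (smooth_cst I (i == j)%:R) (smooth_sub (smooth_mul (smooth_cst I (k == i)%:R)
      (smooth_div (a0 k) (cf_smooth 1 k) (cf_smooth 0 k))) (lam_smooth k)))
    (smooth_mul (smooth_cst I (k == j)%:R) (lam_smooth i)))
    (smooth_mul (smooth_cst I (k == i)%:R)
      (smooth_div (a0 k) (smooth_mul (cf_smooth 0 j) (lam_smooth j)) (cf_smooth 0 k)))) => x _.
  by rewrite mxE.
have : smooth I (fun x => \sum_j (\sum_i Pinv x r i * Bmx k x i j) * P x j s).
  apply: smooth_sum => j _; apply: smooth_mul => //; apply: smooth_sum => i _.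
  exact: smooth_mul.
apply: smooth_ext => x _; rewrite mxE; apply: eq_bigr => j _; congr (_ * _).
by rewrite mxE.
Qed.

Lemma conn_mixed_smooth q i s : smooth I (conn_mixed hfib hfib_inv q i s).
Proof.
apply: smooth_ext (smooth_mul (smooth_cst I 2^-1) (Mmx_smooth i q s)) => x bx.
by rewrite conn_mixed_Mmx.
Qed.

Lemma hfib_smooth r s : smooth I (fun x => hfib x r s).
Proof.
have : smooth I (fun x => \sum_j P x j r * dg j x * P x j s).
  by apply: smooth_sum => j _; apply: smooth_mul => //; exact: smooth_mul (dg_smooth j).
by apply: smooth_ext => x _; rewrite hfibE.
Qed.

(** This is the logarithmic derivative of the square root of [det g]. The factors [D_i] of base and
    fibre cancel and leave [|det P|], whose logarithmic derivative is [- (m + 1) lam l]; so the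
    functions [A i] drop out. *)
Lemma conn_trace l x : box I x ->
  \sum_k conn_base dg k k l x + \sum_q conn_mixed hfib hfib_inv q l q x
  = - (m%:R + 1) * lam l x.
Proof.
move=> bx; under eq_bigr do rewrite conn_base_sym conn_baseE//.
under [X in _ + X]eq_bigr do rewrite conn_mixed_Mmx//.
rewrite -!mulr_sumr -[X in _ + _ * X]/(\tr (Mmx l x)) trace_Mmx// trace_arrow.
rewrite [X in X - _ - _](_ : _ = dlog l x + m%:R * lam l x); last first.
  rewrite big_split /= sumr_const card_ord mulr_natl addrC; congr (_ + _).
  exact: (sum_delta l (fun=> dlog l x)).
by field; rewrite a_neq0.
Qed.

Lemma derives_lam i k x : box I x ->
  is_derive x (delta_mx 0 k) (lam i) (- lam i x * lam k x).
Proof.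
move=> bx; have L0 := L_neq0 bx; apply: is_derive_eq.
  exact: derives_div L0 (derives_cst _ _ _) (derives_L k bx).
by rewrite /lam; field.
Qed.

Lemma partial_on f f' i x d : (forall y, box I y -> f y = f' y) -> box I x ->
  is_derive x (delta_mx 0 i) f' d -> partial i f x = d.
Proof.
move=> ff' bx h; apply: derive_val; apply: derives_near h.
by move: (box_near hI bx); apply: filterS => y /ff'.
Qed.

Lemma partial_conn_base k i x : box I x -> partial k (conn_base dg k i i) x =
  2^-1 * (a1 k x * lam k x - a k x * lam k x ^+ 2) / a i x
  + (i == k)%:R * (- 2^-1 * dlog i x * lam i x + lam i x ^+ 2
                   - 2^-1 * a2 i x / a i x + 2^-1 * dlog i x ^+ 2).
Proof.
move=> bx; have ai0 := a_neq0 i bx; have L0 := L_neq0 bx.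
have [ik|ik] := eqVneq i k.
  rewrite -{k}ik; apply: (partial_on (f' := fun y => - 2^-1 * (lam i y + a1 i y / a i y))).
  - by move=> y bY; rewrite conn_baseE// /arrow eqxx mulr1n /dlog; field; rewrite a_neq0.
  - by [].
  apply: is_derive_eq.
    apply: derives_mul (derives_cst _ _ _) _; apply: derives_add (derives_lam i i bx) _.
    exact: derives_div ai0 (derives_cf 1 i i bx) (derives_cf 0 i i bx).
  by rewrite eqxx mulr1n /dlog; field.
apply: (partial_on (f' := fun y => 2^-1 * (a k y * lam k y / a i y))).
- move=> y bY; rewrite conn_baseE// /arrow eqxx (negbTE ik) eq_sym (negbTE ik) mulr0n mulr1n.
  by field; rewrite a_neq0.
- by [].
apply: is_derive_eq.
  apply: derives_mul (derives_cst _ _ _) _; apply: derives_div ai0 _ (derives_cf 0 i k bx).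
  exact: derives_mul (derives_cf 0 k k bx) (derives_lam k k bx).
by rewrite eqxx eq_sym (negbTE ik) mulr0n mulr1n; field.
Qed.

Lemma hfib_inv_contract x (X : 'M[R]_m) :
  \sum_r \sum_s hfib_inv x r s * X r s = \tr (hfib_inv x *m X).
Proof.
rewrite exchange_big; apply: eq_bigr => s _; rewrite mxE; apply: eq_bigr => r _.
by rewrite -{1}hfib_inv_sym mxE.
Qed.

(** Writing [d_k H = H M_k], the product rule for [H (D_k M_k)] and contraction with the inverse of
    [H] leave [D_k] times the trace of [M_k^2], plus the derivative of [D_k \tr M_k]. So no entry of
    [M_k] has to be differentiated explicitly, only its known trace. *)
Lemma partial_conn_fiber k x : box I x ->
  \sum_r \sum_s hfib_inv x r s * partial k (conn_fiber dg hfib k r s) x =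
  - 2^-1 * (dg k x * \tr (Mmx k x *m Mmx k x)
            + (a2 k x * L x - (m%:R + 1) * a1 k x * c k)).
Proof.
move=> bx.
pose N q s y := dg k y * Mmx k y q s.
have Nsm q s : smooth I (N q s) by exact: smooth_mul (dg_smooth k) (Mmx_smooth k q s).
pose dN := \matrix_(q, s) partial k (N q s) x.
have -> : \sum_r \sum_s hfib_inv x r s * partial k (conn_fiber dg hfib k r s) x =
   \tr (hfib_inv x *m (- 2^-1 *: (hfib x *m Mmx k x *m (dg k x *: Mmx k x) + hfib x *m dN))).
  rewrite -hfib_inv_contract; apply: eq_bigr => r _; apply: eq_bigr => s _; congr (_ * _).
  apply: (partial_on (f' := fun y => - 2^-1 * \sum_q hfib y r q * N q s y)).
  - move=> y bY; rewrite conn_fiber_Mmx// mxE -mulrA mulr_sumr; congr (_ * _).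
    by apply: eq_bigr => q _; rewrite mulrCA.
  - by [].
  apply: is_derive_eq.
    apply: derives_mul (derives_cst _ _ _) _.
    apply: (derives_sum (dF := fun q => dH hfib k r q x * N q s x
      + hfib x r q * partial k (N q s) x)) => q _.
    by apply: derives_mul; [exact: (partialP hI k (hfib_smooth r q) bx)|exact: (partialP hI)].
  rewrite mul0r add0r big_split 2!mxE [(_ *m dN) _ _]mxE [(_ *m (_ *: _)) _ _]mxE;
    congr (_ * (_ + _)); apply: eq_bigr => q _.
    by rewrite dH_hfib//; congr (_ * _); rewrite [RHS]mxE.
  by congr (_ * _); rewrite [RHS]mxE.
have -> : hfib_inv x *m (- 2^-1 *: (hfib x *m Mmx k x *m (dg k x *: Mmx k x) + hfib x *m dN))
    = - 2^-1 *: (dg k x *: (Mmx k x *m Mmx k x) + dN).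
  rewrite -[LHS]scalemxAr; congr (_ *: _); rewrite mulmxDr -(mulmxA (hfib x)).
  by rewrite 2!(mulmxA (hfib_inv x) (hfib x)) hfibVK// !mul1mx -scalemxAr.
rewrite mxtraceZ mxtraceD mxtraceZ; congr (_ * (_ + _)).
have -> : \tr dN = partial k (fun y => \sum_q N q q y) x.
  rewrite /mxtrace; apply: esym; apply: derive_val; apply: is_derive_eq.
    apply: (derives_sum (dF := fun q => partial k (N q q) x)) => q _; exact: (partialP hI).
  by apply: eq_bigr => q _; rewrite mxE.
apply: (partial_on (f' := fun y => a1 k y * L y - (m%:R + 2) * (a k y * c k))).
- move=> y bY; rewrite -mulr_sumr -[X in _ * X]/(\tr (Mmx k y)) trace_Mmx//.
  by rewrite /dg /dlog /lam; field; rewrite a_neq0 ?L_neq0.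
- by [].
apply: is_derive_eq.
  apply: derives_sub; first exact: derives_mul (derives_cf 1 k k bx) (derives_L k bx).
  apply: derives_mul (derives_cst _ _ _) _.
  exact: derives_mul (derives_cf 0 k k bx) (derives_cst _ _ _).
by rewrite eqxx mulr1n; ring.
Qed.

Variable g : 'rV[R]_(m + m) -> 'M[R]_(m + m).
Hypothesis gE : forall p, tp_domain I p -> let x := lsubmx p in
  g p = block_mx (diag_mx (\row_i (dg i x)^-1)) 0 0 (hfib x).

Lemma sum_conn_base_trace i x : box I x ->
  \sum_l lam l x * conn_base dg l i i x =
  - 2^-1 * ((2 * lam i x + dlog i x) * lam i x
            - (\sum_l a l x * lam l x ^+ 2) / a i x).
Proof.
move=> bx; rewrite mulrBr mulr_suml [X in _ - X]mulr_sumr.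
have h := sum_delta i (fun l => - 2^-1 * ((2 * lam i x + dlog i x) * lam l x)).
rewrite /= in h; rewrite -h -sumrB; apply: eq_bigr => l _.
rewrite conn_baseE// /arrow eqxx mulr1n [l == i]eq_sym.
by have [->|_] := eqVneq i l; rewrite ?mulr1n ?mulr0n; field; rewrite a_neq0.
Qed.

Lemma sum_conn_base_sqr i x : box I x ->
  \sum_k \sum_l conn_base dg k i l x * conn_base dg l i k x =
  4^-1 * ((m%:R + 2) * lam i x ^+ 2 + dlog i x ^+ 2 + 2 * lam i x * dlog i x
          - 2 / a i x * \sum_l a l x * lam l x ^+ 2).
Proof.
move=> bx.
under eq_bigr => k _ do under eq_bigr => l _ do rewrite !conn_baseE// mulrACA.
under eq_bigr => k _ do rewrite -mulr_sumr.
rewrite -mulr_sumr trace_arrow_sqr.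
have -> : \sum_k (lam i x + (i == k)%:R * dlog i x) ^+ 2 =
   \sum_k ((i == k)%:R * dlog i x - (- lam i x)) ^+ 2.
  by apply: eq_bigr => k _; rewrite opprK addrC.
rewrite sum_spike_sqr eqxx mulr1n.
have -> : \sum_k a k x * lam k x / a i x * (- lam k x) =
    - ((\sum_l a l x * lam l x ^+ 2) / a i x).
  by rewrite mulr_suml -sumrN; apply: eq_bigr => k _; ring.
by field; rewrite a_neq0.
Qed.

Lemma sum_conn_mixed_sqr i x : box I x ->
  \sum_q \sum_s conn_mixed hfib hfib_inv q i s x * conn_mixed hfib hfib_inv s i q x =
  4^-1 * \tr (Mmx i x *m Mmx i x).
Proof.
move=> bx; rewrite mulr_sumr; apply: eq_bigr => q _; rewrite mxE mulr_sumr.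
by apply: eq_bigr => s _; rewrite !conn_mixed_Mmx//; field.
Qed.

Lemma partial_conn_trace i x : box I x ->
  \sum_k partial i (conn_base dg k i k) x
  + \sum_q partial i (conn_mixed hfib hfib_inv q i q) x = (m%:R + 1) * lam i x ^+ 2.
Proof.
move=> bx.
have <- : partial i (fun y => \sum_k conn_base dg k i k y
   + \sum_q conn_mixed hfib hfib_inv q i q y) x
   = \sum_k partial i (conn_base dg k i k) x
     + \sum_q partial i (conn_mixed hfib hfib_inv q i q) x.
  apply: derive_val; apply: derives_add; apply: derives_sum => k _; apply: (partialP hI) => //.
    exact: conn_base_smooth.
  exact: conn_mixed_smooth.
apply: (partial_on (f' := fun y => - (m%:R + 1) * lam i y)) => //.
  move=> y bY; rewrite -conn_trace//; congr (_ + _); apply: eq_bigr => k _.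
  by rewrite conn_base_sym.
apply: is_derive_eq; first exact: derives_mul (derives_cst _ _ _) (derives_lam i i bx).
by rewrite /=; ring.
Qed.

Lemma ricci_baseE p i : tp_domain I p -> let x := lsubmx p in
  let Lam := \sum_l a l x * lam l x ^+ 2 in let V := \sum_l a1 l x * lam l x in
  ricci g (lshift m i) (lshift m i) p =
  2^-1 * (V - Lam) / a i x
  + (- 2^-1 * dlog i x * lam i x + lam i x ^+ 2 - 2^-1 * a2 i x / a i x
     + 2^-1 * dlog i x ^+ 2)
  - (m%:R + 1) * lam i x ^+ 2
  + 2^-1 * (m%:R + 1) * ((2 * lam i x + dlog i x) * lam i x - Lam / a i x)
  - 4^-1 * ((m%:R + 2) * lam i x ^+ 2 + dlog i x ^+ 2 + 2 * lam i x * dlog i x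
            - 2 / a i x * Lam)
  - 4^-1 * \tr (Mmx i x *m Mmx i x).
Proof.
move=> bp x Lam V; have bx : box I x := bp.
rewrite (ricci_base hI dg_neq0 gE hfibK hfib_sym)//.
rewrite -/x -sum_conn_base_sqr// -sum_conn_mixed_sqr// -partial_conn_trace//.
have -> : 2^-1 * (m%:R + 1) * ((2 * lam i x + dlog i x) * lam i x - Lam / a i x)
    = \sum_l (\sum_k conn_base dg k k l x + \sum_q conn_mixed hfib hfib_inv q l q x)
       * conn_base dg l i i x.
  under eq_bigr do rewrite conn_trace// -mulrA.
  by rewrite -mulr_sumr sum_conn_base_trace// /Lam; field; rewrite a_neq0.
have -> : 2^-1 * (V - Lam) / a i x + (- 2^-1 * dlog i x * lam i x + lam i x ^+ 2
     - 2^-1 * a2 i x / a i x + 2^-1 * dlog i x ^+ 2) = \sum_k partial k (conn_base dg k i i) x.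
  under [RHS]eq_bigr do rewrite partial_conn_base//.
  rewrite big_split sum_delta /=; congr (_ + _).
  by rewrite /V /Lam -sumrB mulr_sumr mulr_suml.
etransitivity; first exact: sum_split_base.
congr (_ - _ + _ - _ - _); apply: eq_bigr => l _.
by rewrite mulrDl !mulr_suml.
Qed.

Lemma fiber_conn_trace l x : box I x ->
  \sum_r \sum_s hfib_inv x r s * conn_fiber dg hfib l r s x =
  - 2^-1 * dg l x * \tr (Mmx l x).
Proof.
move=> bx; have -> : Mmx l x = hfib_inv x *m (hfib x *m Mmx l x).
  by rewrite mulmxA hfibVK// mul1mx.
rewrite -hfib_inv_contract mulr_sumr; apply: eq_bigr => r _; rewrite mulr_sumr.
by apply: eq_bigr => s _; rewrite conn_fiber_Mmx// mulrCA.
Qed.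

Lemma fiber_conn_sqr k x : box I x ->
  \sum_r \sum_s hfib_inv x r s *
    \sum_q conn_fiber dg hfib k r q x * conn_mixed hfib hfib_inv q k s x =
  - 4^-1 * dg k x * \tr (Mmx k x *m Mmx k x).
Proof.
move=> bx; have -> : Mmx k x *m Mmx k x = hfib_inv x *m (hfib x *m Mmx k x *m Mmx k x).
  by rewrite -(mulmxA (hfib x)) (mulmxA (hfib_inv x)) hfibVK// mul1mx.
rewrite -hfib_inv_contract mulr_sumr; apply: eq_bigr => r _; rewrite mulr_sumr.
apply: eq_bigr => s _; rewrite mulrCA; congr (_ * _).
rewrite [in RHS]mxE mulr_sumr; apply: eq_bigr => q _.
by rewrite conn_fiber_Mmx// conn_mixed_Mmx//; field.
Qed.

(** Contracting before expanding leaves only traces. The two quadratic terms agree by symmetry of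
    the inverse fibre metric, and together they cancel the trace of [M_k^2] from
    [partial_conn_fiber]. *)
Lemma ricci_fiberE p : tp_domain I p -> let x := lsubmx p in
  \sum_r \sum_s hfib_inv x r s * ricci g (rshift m r) (rshift m s) p =
  \sum_k (- 2^-1 * (a2 k x * L x - (m%:R + 1) * a1 k x * c k)
    + 2^-1 * (m%:R + 1) * lam k x * dg k x * \tr (Mmx k x)).
Proof.
move=> bp x; have bx : box I x := bp.
pose F l r s := conn_fiber dg hfib l r s x.
pose C l r s := conn_mixed hfib hfib_inv r l s x.
pose B k l := conn_base dg k k l x.
have e r s : ricci g (rshift m r) (rshift m s) p =
   \sum_k (partial k (conn_fiber dg hfib k r s) x
     + (\sum_j B j k + \sum_q C k q q) * F k r s
     - \sum_q F k s q * C k q r - \sum_q F k r q * C k q s).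
  rewrite (ricci_fiber hI dg_neq0 gE hfibK hfib_sym)// -/x.
  etransitivity; first exact: sum_split_fiber.
  apply: eq_bigr => k _; congr (_ - _); apply: eq_bigr => q _; exact: mulrC.
transitivity (\sum_k \sum_r \sum_s hfib_inv x r s * (partial k (conn_fiber dg hfib k r s) x
     + (\sum_j B j k + \sum_q C k q q) * F k r s
     - \sum_q F k s q * C k q r - \sum_q F k r q * C k q s)).
  apply: esym; rewrite exchange_big; apply: eq_bigr => r _ /=.
  by rewrite exchange_big; apply: eq_bigr => s _ /=; rewrite e mulr_sumr.
apply: eq_bigr => k _; rewrite sum2_linear.
have h1 := partial_conn_fiber k bx; have h2 := fiber_conn_trace k bx.
have h3 := fiber_conn_sqr k bx.
have h4 : \sum_r \sum_s hfib_inv x r s * (\sum_q F k s q * C k q r) =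
    - 4^-1 * dg k x * \tr (Mmx k x *m Mmx k x).
  rewrite -h3 exchange_big; apply: eq_bigr => r _; apply: eq_bigr => s _.
  by rewrite -{1}hfib_inv_sym mxE.
have -> : 2^-1 * (m%:R + 1) * lam k x * dg k x * \tr (Mmx k x) =
   (\sum_j B j k + \sum_q C k q q) * \sum_r \sum_s hfib_inv x r s * F k r s.
  by rewrite h2 conn_trace//; ring.
by rewrite h1 h4 h3; field.
Qed.

Definition scal x : R := \sum_k (- a2 k x * L x + 2 * (m%:R + 1) * a1 k x * c k
  - (m%:R + 1) * (m%:R + 2) * a k x * c k ^+ 2 / L x).

Lemma scalar_curvatureE p : tp_domain I p -> scalar_curvature g p = scal (lsubmx p).
Proof.
move=> bp; set x := lsubmx p; have bx : box I x := bp.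
have L0 := L_neq0 bx.
rewrite (scalar_curvature_block dg_neq0 gE hfibK)// ricci_fiberE// -/x.
under eq_bigr do rewrite ricci_baseE//.
rewrite -/x -big_split /= /scal.
move eLam: (\sum_l a l x * lam l x ^+ 2) => Lam.
move eV: (\sum_l a1 l x * lam l x) => V.
(* The global sums [Lam] and [V] occur in every summand, so the two sides agree only after
   summation. [kappa] is their contribution to each summand, and [w k] redistributes the total
   [m * kappa] over the indices; with the correction [kappa - w k] the identity holds term by
   term. *)
pose kappa := L x * (2^-1 * (V - Lam) - 2^-1 * (m%:R + 1) * Lam).
pose w k := m%:R * L x * (2^-1 * (a1 k x * lam k x - a k x * lam k x ^+ 2)
  - 2^-1 * (m%:R + 1) * (a k x * lam k x ^+ 2)).
have sum_w : \sum_k w k = \sum_(k < m) kappa.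
  rewrite sumr_const card_ord -mulr_natl -mulr_sumr sumrB -!mulr_sumr sumrB.
  by rewrite eLam eV /kappa; ring.
apply/eqP; rewrite -subr_eq0 -sumrB; apply/eqP.
rewrite -[RHS](subrr (\sum_k w k)) {1}sum_w -sumrB; apply: eq_bigr => k _.
have ak0 := a_neq0 k bx.
rewrite trace_Mmx_sqr// sum_BmxE// trace_Mmx// eLam /kappa /w /dg /dlog /lam.
by field; rewrite L0 ak0.
Qed.

End Curvature.

(** * The twisted product of Riemann surfaces *)

Section TwistedProductCurvature.
Context {R : realType} {m : nat}.
Hypothesis m_gt0 : (0 < m)%N.
Variables (I : 'I_m -> set R) (A : 'I_m -> R -> R).
Variables (beta : tensor R m) (tb : m.-tuple (tensor R m)).
Hypothesis hI : forall j, open_interval (I j).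
Hypothesis A_smooth : forall j, smooth_on (I j) (A j).
Hypothesis A_neq0 : forall j x, I j x -> A j x != 0.
Variables (c0 : R) (c : 'I_m -> R).
Hypothesis betaE : beta = c0 *: e0pow m + \sum_j c j *: eps j.
Hypothesis mu_neq0 : forall x, box I x -> mu_pair x beta != 0.
Hypothesis tb_basis : basis_of segre (beta :: tb).
Implicit Types (x : 'rV[R]_m) (i j k r s : 'I_m).

Let L x := mu_pair x beta.

Lemma mu_pair_smooth alpha : alpha \in segre -> smooth I (fun x => mu_pair x alpha).
Proof.
move=> /segreP[d0 [d ->]].
have : smooth I (fun x => d0 + \sum_j d j * x 0 j).
  apply: smooth_add (smooth_cst _ _) _; apply: smooth_sum => j _.
  exact: smooth_mul (smooth_cst _ _) (smooth_var _ _).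
by apply: smooth_ext => x _; rewrite mu_pair_affine.
Qed.

Lemma derives_mu_pair d0 (d : 'I_m -> R) i x :
  is_derive x (delta_mx 0 i) (fun y => mu_pair y (d0 *: e0pow m + \sum_j d j *: eps j)) (d i).
Proof.
have -> : (fun y => mu_pair y (d0 *: e0pow m + \sum_j d j *: eps j)) =
    (fun y => d0 + \sum_j d j * y 0 j).
  by apply/funext => y; rewrite mu_pair_affine.
apply: is_derive_eq.
  apply: derives_add (derives_cst _ _ _) _.
  apply: (derives_sum (dF := fun j => 0 * x 0 j + d j * ((i == j)%:R * 1))) => j _.
  apply: derives_mul (derives_cst _ _ _) _.
  have dx : derivable (@id R) (x 0 j) 1 by exact: derivable_id.
  by have := derives_coord i dx; rewrite derive1_id.
rewrite add0r -[RHS](sum_delta i d); apply: eq_bigr => j _; ring.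
Qed.

Lemma beta_segre : beta \in segre.
Proof. by rewrite betaE affine_segre. Qed.

Lemma tb_segre r : tnth tb r \in segre.
Proof. by apply: (basis_mem tb_basis); rewrite inE mem_tnth orbT. Qed.

Lemma mu_beta_smooth : smooth I L.
Proof. exact: mu_pair_smooth beta_segre. Qed.

Lemma derives_mu_beta x i : is_derive x (delta_mx 0 i) L (c i).
Proof. by rewrite /L betaE; exact: derives_mu_pair. Qed.

Lemma dmuE d0 (d : 'I_m -> R) j x : box I x ->
  dmu beta j x (d0 *: e0pow m + \sum_j d j *: eps j) =
  (d j * L x - mu_pair x (d0 *: e0pow m + \sum_j d j *: eps j) * c j) / L x ^+ 2.
Proof.
move=> bx; have L0 := mu_neq0 bx; apply: derive_val; apply: is_derive_eq.
  exact: derives_div L0 (derives_mu_pair d0 d j x) (derives_mu_beta x j).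
by rewrite /L; field.
Qed.

Definition mom_jac x : 'M[R]_m := \matrix_(j, r) dmu beta j x (tnth tb r).
(** At [x] the function [<mu, psi_j(x_j)>] is zero, and its derivative along [x_i] is [-1] for
    [i = j] and 0 otherwise. Hence the derivative of its quotient by [L] is minus the Kronecker
    delta over [L], and the inverse Jacobian is [- L] times the components of [psi_j] mod [beta]. *)
Definition mom_jac_inv x : 'M[R]_m :=
  \matrix_(r, j) (- (L x * coord_mod beta tb r (psi j (x 0 j)))).

Lemma dmu_smooth j alpha : alpha \in segre -> smooth I (fun x => dmu beta j x alpha).
Proof.
move=> al; apply: (smooth_partial hI); apply: smooth_div mu_neq0 _ mu_beta_smooth.
exact: mu_pair_smooth.
Qed.

Lemma mom_jac_smooth j r : smooth I (fun x => mom_jac x j r).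
Proof. by apply: smooth_ext (dmu_smooth j (tb_segre r)) => x _; rewrite mxE. Qed.

Lemma mom_jac_inv_smooth r j : smooth I (fun x => mom_jac_inv x r j).
Proof.
have : smooth I (fun x => - (L x * (x 0 j * coord_mod beta tb r (e0pow m)
    + (- 1) * coord_mod beta tb r (eps j)))).
  apply: smooth_opp; apply: smooth_mul mu_beta_smooth _.
  by apply: smooth_add; apply: smooth_mul; try exact: smooth_cst; exact: smooth_var.
apply: smooth_ext => x _; rewrite mxE /psi ins_vec2 /coord_mod linearD !linearZ //.
Qed.

(** [<mu_beta, beta>] is identically 1 on the box; this is what makes [dmu] well defined on classes
    mod [beta]. *)
Lemma dmu_beta j x : box I x -> dmu beta j x beta = 0.
Proof.
by move=> bx; rewrite {2}betaE dmuE// -betaE /L [c j * _]mulrC subrr mul0r.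
Qed.

Lemma dmu_linear j x : box I x -> forall (T : finType) (d : R) (e : T -> R) (al : T ->
  tensor R m),
  (forall t, al t \in segre) ->
  dmu beta j x (d *: beta + \sum_t e t *: al t) = \sum_t e t * dmu beta j x (al t).
Proof.
move=> bx T d e al als;
  transitivity (d * dmu beta j x beta + \sum_t e t * dmu beta j x (al t)); last first.
  by rewrite dmu_beta// mulr0 add0r.
apply: derive_val.
have -> : (fun y => mu_pair y (d *: beta + \sum_t e t *: al t) / mu_pair y beta) =
   (fun y => d * (mu_pair y beta / mu_pair y beta)
             + \sum_t e t * (mu_pair y (al t) / mu_pair y beta)).
  apply/funext => y; rewrite linearD linearZ linear_sum /= mulrDl mulr_suml mulrA; congr (_ + _).
  by apply: eq_bigr => t _; rewrite linearZ /= mulrA.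
have sm al' : al' \in segre -> smooth I (fun y => mu_pair y al' / mu_pair y beta).
  by move=> h; apply: smooth_div mu_neq0 (mu_pair_smooth h) mu_beta_smooth.
have D al' (h : al' \in segre) := partialP hI j (sm al' h) bx.
apply: is_derive_eq.
  apply: derives_add; first exact: derives_mul (derives_cst d _ _) (D _ beta_segre).
  apply: derives_sum => t _; exact: derives_mul (derives_cst (e t) _ _) (D _ (als t)).
rewrite mul0r add0r; congr (_ + _).
by apply: eq_bigr => t _; rewrite mul0r add0r.
Qed.

Lemma mom_jacK x : box I x -> mom_jac x *m mom_jac_inv x = 1%:M.
Proof.
move=> bx; have L0 := mu_neq0 bx; apply/matrixP => j i; rewrite !mxE.
have [a e] := coord_mod_span tb_basis (psi_segre i (x 0 i)).
have d := dmu_linear j bx a (fun r => coord_mod beta tb r (psi i (x 0 i))) tb_segre.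
rewrite -e in d.
have p : psi i (x 0 i) = x 0 i *: e0pow m + \sum_k (- (i == k)%:R) *: eps k :> tensor R m.
  rewrite /psi ins_vec2; congr (_ + _); rewrite (bigD1 i)//= eqxx big1 ?addr0// => k ki.
  by rewrite eq_sym (negbTE ki) oppr0 scale0r.
transitivity (- L x * dmu beta j x (psi i (x 0 i))).
  rewrite d mulr_sumr; apply: eq_bigr => r _; rewrite !mxE; ring.
rewrite p dmuE// -p mu_pair_psi subrr mul0r subr0 [j == i]eq_sym /L.
by field.
Qed.

(** The second derivative of a quotient of two affine functions: the second derivatives of numerator
    and denominator vanish, and what remains is expressed by first derivatives of the quotient. *)
Lemma partial_mom_jac x k j r : box I x ->
  partial k (fun y => mom_jac y j r) x =
  - (c k * mom_jac x j r + c j * mom_jac x k r) / L x.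
Proof.
move=> bx; have [d0 [d e]] := segreP (tb_segre r); have L0 := mu_neq0 bx.
apply: (partial_on hI (f' :=
  fun y => (d j * L y - mu_pair y (tnth tb r) * c j) / (L y * L y))) => //.
  by move=> y bY; rewrite mxE e dmuE// expr2.
apply: is_derive_eq.
  apply: derives_div; first by rewrite mulf_neq0.
    apply: derives_sub; first exact: derives_mul (derives_cst _ _ _) (derives_mu_beta x k).
    apply: derives_mul _ (derives_cst _ _ _); rewrite e; exact: derives_mu_pair.
  exact: derives_mul (derives_mu_beta x k) (derives_mu_beta x k).
rewrite !mxE e !dmuE// -e /L; by field.
Qed.

Let hf := hfib A L mom_jac.

Lemma theta_row j p : theta beta tb j p = row_mx 0 (row j (mom_jac (lsubmx p))).
Proof.
apply/rowP => a; rewrite summxE; case: (split_ordP a) => [i ->|s ->].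
  by rewrite row_mxEl mxE big1// => r _; rewrite !mxE eqxx eq_lrshift mulr0.
rewrite row_mxEr !mxE -[RHS](sum_delta s (fun r => dmu beta j (lsubmx p) (tnth tb r))).
by apply: eq_bigr => r _; rewrite !mxE eqxx /= (inj_eq (@rshift_inj _ _)) mulrC.
Qed.

Lemma dx_row j : dx j = row_mx (delta_mx 0 j) 0 :> 'rV[R]_(m + m).
Proof.
apply/rowP => a; case: (split_ordP a) => [i ->|s ->].
  by rewrite row_mxEl !mxE (inj_eq (@lshift_inj _ _)).
by rewrite row_mxEr !mxE eqxx eq_rlshift.
Qed.

Lemma dt_row j : dt j = row_mx 0 (delta_mx 0 j) :> 'rV[R]_(m + m).
Proof.
apply/rowP => a; case: (split_ordP a) => [i ->|s ->].
  by rewrite row_mxEl !mxE eqxx eq_lrshift.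
by rewrite row_mxEr !mxE (inj_eq (@rshift_inj _ _)).
Qed.

Lemma tp_metric_block p : tp_domain I p -> let x := lsubmx p in
  tp_metric beta tb A p = block_mx (diag_mx (\row_i (dg A L i x)^-1)) 0 0 (hf x).
Proof.
move=> bp x; rewrite /tp_metric.
under eq_bigr do rewrite theta_row dx_row !tr_row_mx !mul_col_row !trmx0 !mulmx0 !mul0mx
  !scale_block_mx !scaler0 add_block_mx !addr0 add0r -/x.
have e : forall (F G : 'I_m -> 'M[R]_m),
   \sum_j block_mx (F j) 0 0 (G j) = block_mx (\sum_j F j) 0 0 (\sum_j G j).
  move=> F G; elim/big_rec3: _ => [|j a b d _ ->]; first by rewrite block_mx0.
  by rewrite add_block_mx !addr0.
clearbody x; rewrite e; congr block_mx; apply/matrixP => r s; rewrite summxE.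
  transitivity (\sum_j (r == j)%:R * ((j == s)%:R / dg A L j x)).
    apply: eq_bigr => j _; rewrite !mxE big_ord1 !mxE !eqxx /= [s == j]eq_sym.
    by rewrite /dg /cf; ring.
  by rewrite sum_delta !mxE mulr_natl.
rewrite hfibE; apply: eq_bigr => j _; rewrite !mxE big_ord1 !mxE /dg /cf /L /=; ring.
Qed.

Let sc x := scal A L c x.

Lemma twisted_scalar_curvature p : tp_domain I p ->
  scalar_curvature (tp_metric beta tb A) p = sc (lsubmx p).
Proof.
move=> bp.
apply: (scalar_curvatureE hI A_smooth A_neq0 mu_beta_smooth mu_neq0 _ mom_jac_smooth
  mom_jac_inv_smooth mom_jacK partial_mom_jac tp_metric_block bp).
by move=> x i bx; apply: derive_val; exact: derives_mu_beta.
Qed.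

Lemma sc_smooth : smooth I sc.
Proof.
apply: smooth_sum => k _; apply: smooth_sub; [apply: smooth_add|].
- by apply: smooth_mul mu_beta_smooth; apply: smooth_opp; exact: cf_smooth.
- apply: smooth_mul (smooth_cst _ _); apply: smooth_mul (smooth_cst _ _) _.
  exact: (cf_smooth A_smooth 1).
- apply: smooth_div mu_neq0 _ mu_beta_smooth; apply: smooth_mul (smooth_cst _ _).
  by apply: smooth_mul (smooth_cst _ _) _; exact: (cf_smooth A_smooth 0).
Qed.

(** * The Killing condition for the scalar curvature *)

Definition killing_fiber r x : R := \sum_j mom_jac_inv x r j * partial j sc x.

Lemma killing_fiber_smooth r : smooth I (killing_fiber r).
Proof.
apply: smooth_sum => j _; apply: smooth_mul (mom_jac_inv_smooth r j) _.
exact: (smooth_partial hI) sc_smooth.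
Qed.

Let K := cplx_vector (twisted_product beta tb A)
  (grad (tp_metric beta tb A) (scalar_curvature (tp_metric beta tb A))).

Lemma sum_tr_delta_mx n d (w : 'I_n -> 'rV[R]_d) :
  \sum_a (delta_mx 0 a : 'rV[R]_n)^T *m w a = \matrix_(a, l) w a 0 l.
Proof.
apply/matrixP => b l; rewrite summxE mxE -[RHS](sum_delta b (fun a => w a 0 l)).
by apply: eq_bigr => a _; rewrite !mxE big_ord1 !mxE eqxx.
Qed.

Lemma sum_block_mx n (F G H Q : 'I_n -> 'M[R]_m) :
  \sum_a block_mx (F a) (G a) (H a) (Q a)
  = block_mx (\sum_a F a) (\sum_a G a) (\sum_a H a) (\sum_a Q a).
Proof.
elim: (index_enum _) => [|a s ih]; first by rewrite !big_nil block_mx0.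
by rewrite !big_cons ih add_block_mx.
Qed.

Lemma tp_cplx_block p : let x := lsubmx p in
  tp_cplx beta tb A p = block_mx 0 (diag_mx (\row_i dg A L i x) *m mom_jac x)
    (\matrix_(r, j) (coord_mod beta tb r (psi j (x 0 j)) / A j (x 0 j))) 0.
Proof.
move=> x; rewrite /tp_cplx -/x.
under eq_bigr do rewrite theta_row dx_row scale_row_mx scaler0 tr_row_mx mul_col_row
  trmx0 !mul0mx mulmx0 -/x.
under [X in _ + X]eq_bigr => r _.
  have -> : \sum_j (coord_mod beta tb r (psi j (x 0 j)) / A j (x 0 j)) *: dx j =
      row_mx (\row_j (coord_mod beta tb r (psi j (x 0 j)) / A j (x 0 j))) 0 :> 'rV[R]_(m + m).
    under eq_bigr do rewrite dx_row scale_row_mx scaler0.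
    rewrite [RHS](_ : _ = row_mx (\sum_j (coord_mod beta tb r (psi j (x 0 j)) / A j (x 0 j)) *:
      delta_mx 0 j) 0).
      elim/big_rec2: _ => [|j a b _ ->]; first by rewrite row_mx0.
      by rewrite add_row_mx addr0.
    congr row_mx; rewrite [LHS]row_sum_delta; apply: eq_bigr => j _.
    by congr (_ *: _); rewrite [LHS]mxE.
  rewrite dt_row tr_row_mx mul_col_row trmx0 !mul0mx mulmx0; over.
rewrite !sum_block_mx !big1_eq add_block_mx !addr0 !add0r.
clearbody x; congr block_mx; (etransitivity; first exact: sum_tr_delta_mx);
  apply/matrixP => i j; rewrite ?mul_diag_mx !mxE//.
Qed.

Lemma gradE p : tp_domain I p -> let x := lsubmx p in
  grad (tp_metric beta tb A) (scalar_curvature (tp_metric beta tb A)) p =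
  col_mx (\col_j (dg A L j x * partial j sc x)) 0.
Proof.
move=> bp x; have bx : box I x := bp; rewrite /grad.
rewrite (inverse_metricE _ tp_metric_block (hfibK A_neq0 mu_neq0 mom_jacK))//; last first.
  by move=> y bY i; rewrite mulf_neq0 ?A_neq0 ?mu_neq0.
have -> : (differential (scalar_curvature (tp_metric beta tb A)) p)^T =
    col_mx (\col_j partial j sc x) 0.
  apply/colP => a; case: (split_ordP a) => [i ->|s ->]; rewrite ?(col_mxEu, col_mxEd) !mxE.
    by apply: (partial_base hI) bp => q bq; exact: twisted_scalar_curvature.
  by apply: (partial_fiber hI) bp => q bq; exact: twisted_scalar_curvature.
rewrite mul_block_col !mulmx0 !mul0mx !addr0; congr col_mx.
by apply/colP => i; rewrite mul_diag_mx !mxE.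
Qed.

(** The factor [A_j] in the gradient cancels against [1 / A_j] in [J dt]; the remaining factor
    [- L psi_j] mod [beta] is the column [j] of the inverse Jacobian. *)
Lemma killing_vectorE p : tp_domain I p ->
  K p = col_mx 0 (\col_r killing_fiber r (lsubmx p)).
Proof.
move=> bp; have bx : box I (lsubmx p) := bp; rewrite /K /cplx_vector /= tp_cplx_block gradE//.
rewrite mul_block_col !mulmx0 !mul0mx !addr0 opp_col_mx oppr0; congr col_mx.
move: (lsubmx p) bx => x bx.
apply/colP => r; rewrite !mxE /killing_fiber -sumrN; apply: eq_bigr => j _; rewrite !mxE /dg /cf.
rewrite /L /=; by field; rewrite A_neq0.
Qed.

Lemma extremal_killing_fiber :
  extremal_on (tp_domain I) (twisted_product beta tb A) <->
  forall x, box I x -> forall i r, partial i (killing_fiber r) x = 0.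
Proof.
apply: (killing_blockP hI tp_metric_block (hfibK A_neq0 mu_neq0 mom_jacK)).
- by move=> x; exact: hfib_sym.
- by move=> p bp i; rewrite -/(K p) killing_vectorE// col_mxEu mxE.
- by move=> p bp r; rewrite -/(K p) killing_vectorE// col_mxEd mxE.
Qed.

Lemma box_nonempty : exists x, box I x.
Proof.
have /fin_all_exists[y Iy] : forall j, exists y, I j y by move=> j; have [_ _ [y Iy]] := hI j;
  exists y.
by exists (\row_j y j) => j; rewrite mxE.
Qed.

(** If [P^-1 (d s)] is a constant vector [C], then [d s] is the differential of [<mu, al> / L] with
    [al] the combination of the basis with coefficients [C]; so [s] is this quotient plus a
    constant, and multiplication by [L] gives an affine function. Conversely, an affine [s L] is
    [<mu, al>] for some [al], and then [P^-1 (d s)] consists of the coordinates of [al] mod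
    [beta]. *)
Lemma extremal_affine :
  extremal_on (tp_domain I) (twisted_product beta tb A) <->
  exists (e0 : R) (e : 'I_m -> R), forall x, box I x -> sc x * L x = e0 + \sum_j e j * x 0 j.
Proof.
rewrite extremal_killing_fiber; split=> [kf|[e0 [e se]]].
  have [x0 bx0] := box_nonempty.
  pose C r := killing_fiber r x0.
  have kfC x r : box I x -> killing_fiber r x = C r.
    by move=> bx; apply: (smooth_constant hI (killing_fiber_smooth r)) => // i y bY; exact: kf.
  pose al := \sum_r C r *: tnth tb r.
  have als : al \in segre by apply: memv_suml => r _; rewrite memvZ// tb_segre.
  have dal j x : box I x -> dmu beta j x al = partial j sc x.
    move=> bx; rewrite -[al]add0r -(scale0r beta) dmu_linear//; last exact: tb_segre.
    have : mom_jac x *m (mom_jac_inv x *m (\col_k partial k sc x)) = \col_k partial k sc x.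
      by rewrite mulmxA mom_jacK// mul1mx.
    move=> /colP/(_ j); rewrite !mxE => <-; apply: eq_bigr => r _.
    rewrite mulrC -(kfC x r bx) !mxE /killing_fiber; congr (_ * _).
    by apply: eq_bigr => k _; rewrite [(\col_k _) _ _]mxE.
  have fs : smooth I (fun x => mu_pair x al / mu_pair x beta).
    by apply: smooth_div mu_neq0 (mu_pair_smooth als) mu_beta_smooth.
  pose h x := sc x - mu_pair x al / mu_pair x beta.
  have hs : smooth I h := smooth_sub sc_smooth fs.
  have hc x : box I x -> h x = h x0.
    move=> bx; apply: (smooth_constant hI hs) => // i y bY; apply: derive_val.
    apply: is_derive_eq.
      exact: derives_sub (partialP hI i sc_smooth bY) (partialP hI i fs bY).
    by rewrite -/(dmu beta i y al) dal// subrr.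
  have [d0 [d ald]] := segreP als.
  exists (h x0 * c0 + d0), (fun j => h x0 * c j + d j) => x bx.
  have L0 := mu_neq0 bx.
  have -> : sc x = h x0 + mu_pair x al / mu_pair x beta by rewrite -(hc x bx) /h; ring.
  rewrite mulrDl divfK// /L {1}betaE ald !mu_pair_affine// mulrDr mulr_sumr.
  under [X in _ = _ + X]eq_bigr do rewrite mulrDl -mulrA.
  by rewrite big_split /=; ring.
pose al : tensor R m := e0 *: e0pow m + \sum_j e j *: eps j.
have als : al \in segre by exact: affine_segre.
have scE x : box I x -> sc x = mu_pair x al / mu_pair x beta.
  by move=> bx; rewrite /al mu_pair_affine// -se// mulfK// mu_neq0.
have [a ea] := coord_mod_span tb_basis als.
move=> x bx i r.
apply: (partial_on hI (f' := fun=> coord_mod beta tb r al)) => //.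
move=> y bY.
have dsc j : partial j sc y = \sum_s mom_jac y j s * coord_mod beta tb s al.
  have -> : partial j sc y = dmu beta j y al.
    apply: near_eq_derive; move: (box_near hI bY); apply: filterS => z; exact: scE.
  rewrite {1}ea dmu_linear//; last exact: tb_segre.
  by apply: eq_bigr => s _; rewrite mxE mulrC.
have : mom_jac_inv y *m (mom_jac y *m (\col_s coord_mod beta tb s al)) =
    \col_s coord_mod beta tb s al.
  by rewrite mulmxA (mulmx1C (mom_jacK bY)) mul1mx.
move=> /colP/(_ r); rewrite !mxE => <-; apply: eq_bigr => j _; congr (_ * _).
by rewrite dsc [RHS]mxE; apply: eq_bigr => s _; rewrite [(\col_s _) _ _]mxE.
Qed.

End TwistedProductCurvature.

(** * Polynomials on intervals *)

Section PolynomialsOnIntervals.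
Context {R : realType}.
Implicit Types (J : set R) (f : R -> R) (q : {poly R}).

Lemma derives_horner q (x : R) : is_derive x 1 (fun y => q.[y]) q^`().[x].
Proof.
elim/poly_ind: q => [|q a ih].
  rewrite derivC horner0; under [fun y => _]eq_fun do rewrite horner0.
  exact: derives_cst.
under [fun y => _]eq_fun do rewrite hornerMXaddC.
have dx : is_derive x 1 (fun y : R => y) 1 by exact: is_derive_id.
rewrite derivMXaddC hornerD hornerM hornerX.
apply: (is_derive_eq (derives_add (derives_mul ih dx) (derives_cst a x 1))).
by rewrite addr0 mulr1 addrC.
Qed.

Lemma open_near J (x : R) : open J -> J x -> \near x, J x.
Proof. by move=> oJ Jx; exact: open_nbhs_nbhs. Qed.

Lemma derives_on J f f' (x : R) d : open J -> (forall y, J y -> f y = f' y) -> J x ->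
  is_derive x 1 f' d -> is_derive x 1 f d.
Proof.
move=> oJ ff' Jx h; apply: derives_near h.
by move: (open_near oJ Jx); apply: filterS => y /ff'.
Qed.

Lemma derive1_on J f f' (x : R) d : open J -> (forall y, J y -> f y = f' y) -> J x ->
  is_derive x 1 f' d -> derive1 f x = d.
Proof.
by move=> oJ ff' Jx h; rewrite derive1E; apply: derive_val; exact: (derives_on oJ ff' Jx h).
Qed.

Lemma derive1n_horner J f q n : open J -> (forall x, J x -> f x = q.[x]) ->
  forall x, J x -> derive1n n f x = q^`(n).[x].
Proof.
move=> oJ fq; elim: n => [|n ih] x Jx; first by rewrite derivn0 -fq.
by rewrite derive1nS derivnS; apply: (derive1_on oJ ih Jx); exact: derives_horner.
Qed.

Lemma poly_zero_on J q : open J -> J !=set0 -> (forall x, J x -> q.[x] = 0) -> q = 0.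
Proof.
move=> oJ [x Jx] q0.
have /nbhs_ballP[e /= e0 be] := open_near oJ Jx.
(* Infinitely many distinct zeros in the ball; the shift to [k.+2] keeps them strictly inside. *)
pose pt (k : nat) : R := x + e / k.+2%:R.
have pt_inj : injective pt.
  move=> k l /addrI/(mulfI (lt0r_neq0 e0))/invr_inj/eqP.
  by rewrite eqr_nat => /eqP[].
apply: (@roots_geq_poly_eq0 _ q (map pt (iota 0 (size q)))).
- apply/allP => _ /mapP[k _ ->]; apply/eqP/q0/be.
  rewrite /ball /= /pt opprD addNKr normrN ger0_norm; last by rewrite divr_ge0// ltW.
  by rewrite ltr_pdivrMr// ltr_pMr// ltr1n.
- by rewrite map_inj_uniq// iota_uniq.
- by rewrite size_map size_iota.
Qed.

(** Quartics are given by a coefficient function and their derivatives are written out, so that the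
    identities below are within reach of [ring] and [field]. *)
Definition quartic (p : nat -> R) (x : R) : R :=
  p 0%N + p 1%N * x + p 2%N * x ^+ 2 + p 3%N * x ^+ 3 + p 4%N * x ^+ 4.
Definition quartic' (p : nat -> R) (x : R) : R :=
  p 1%N + 2 * p 2%N * x + 3 * p 3%N * x ^+ 2 + 4 * p 4%N * x ^+ 3.
Definition quartic'' (p : nat -> R) (x : R) : R :=
  2 * p 2%N + 6 * p 3%N * x + 12 * p 4%N * x ^+ 2.

Lemma quartic_zero_on J (p : nat -> R) : open J -> J !=set0 ->
  (forall x, J x -> quartic p x = 0) -> forall i, (i < 5)%N -> p i = 0.
Proof.
move=> oJ nJ h i i5; pose q := \poly_(k < 5) p k.
have q0 : q = 0.
  apply: (poly_zero_on oJ nJ) => x Jx; apply: etrans (h x Jx).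
  by rewrite horner_poly !big_ord_recl big_ord0 /= /quartic; ring.
by have := coef_poly 5 p i; rewrite i5 -/q q0 coef0.
Qed.

(** The constant coefficient is a quotient by 0, hence 0 by convention; the derivative does not see
    it. *)
Definition primitive q : {poly R} := \poly_(i < (size q).+1) (q`_i.-1 / i%:R).

Lemma deriv_primitive q : (primitive q)^`() = q.
Proof.
apply/polyP => i; rewrite coef_deriv coef_poly ltnS.
case: ltnP => [iq|iq]; first by rewrite -[LHS]mulr_natr divfK// pnatr_eq0.
by rewrite mul0rn nth_default.
Qed.

Lemma poly_deg_primitive J d f : open J -> is_interval J -> J !=set0 ->
  (forall x, J x -> derivable f x 1) ->
  poly_deg_le_on J d (derive1 f) -> poly_deg_le_on J d.+1 f.
Proof.
move=> oJ iJ [x0 Jx0] df [q [sq fq]].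
pose h x := f x - (primitive q).[x].
have hc x : J x -> h x = h x0.
  move=> Jx; apply: (interval_constant iJ) Jx Jx0 => y Jy.
  apply: (is_derive_eq (derives_sub (derivableP (df y Jy)) (derives_horner (primitive q) y))).
  by rewrite deriv_primitive -fq// derive1E subrr.
exists (primitive q + (h x0)%:P); split.
  apply: (leq_trans (size_polyD _ _)); rewrite geq_max.
  apply/andP; split; first by apply: (leq_trans (size_poly _ _)).
  by apply: (leq_trans (size_polyC_leq1 _)).
by move=> x Jx; rewrite hornerD hornerC -(hc x Jx) /h; ring.
Qed.

Lemma poly_deg_primitive2 J d f : open_interval J -> smooth_on J f ->
  poly_deg_le_on J d (derive1n 2 f) -> poly_deg_le_on J d.+2 f.
Proof.
move=> [oJ iJ nJ] sf h2.
apply: poly_deg_primitive => // [x Jx|]; first exact: (sf 0%N).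
by apply: poly_deg_primitive => // x Jx; exact: (sf 1%N).
Qed.

End PolynomialsOnIntervals.

(** * The extremality equation restricted to two variables *)

Section TwoVariables.
Context {R : realType}.

Definition pair_equation (J1 J2 : set R) (n s b d Q r T k e h : R)
    (f f1 f2 g g1 g2 : R -> R) : Prop :=
  forall x z, J1 x -> J2 z -> let L := s + b * x + d * z in
    (f2 x * L ^+ 2 - 2 * n * b * f1 x * L + n * (n + 1) * b ^+ 2 * f x)
    + (g2 z * L ^+ 2 - 2 * n * d * g1 z * L + n * (n + 1) * d ^+ 2 * g z)
    + (Q * L ^+ 2 + r * L + T) = k + e * x + h * z.

Section Quartics.
Variables (J1 J2 : set R) (n s b d Q r T k e h : R) (p q : nat -> R).
Hypothesis (oJ1 : open J1) (nJ1 : J1 !=set0) (oJ2 : open J2) (nJ2 : J2 !=set0).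
Hypothesis pqE : pair_equation J1 J2 n s b d Q r T k e h
  (quartic p) (quartic' p) (quartic'' p) (quartic q) (quartic' q) (quartic'' q).
Hypothesis (b_neq0 : b != 0) (d_neq0 : d != 0).

(** Comparison of coefficients of, in order, [x^2], [x^3], [x^2 z], [x^3 z]; [z^2], [z^3], [x z^3];
    [x z]; [x^2 z^2]. The affine right-hand side does not reach any of these monomials. *)
Lemma pair_equation_coefficients :
  [/\ [/\ (n - 1) * (n - 2) * b ^+ 2 * p 2%N + 6 * (2 - n) * s * b * p 3%N
           + 12 * s ^+ 2 * p 4%N + b ^+ 2 * (2 * q 2%N + Q) = 0,
         (n - 2) * (n - 3) * b ^+ 2 * p 3%N + 8 * (3 - n) * s * b * p 4%N = 0,
         6 * (2 - n) * b * d * p 3%N + 24 * s * d * p 4%N + 6 * b ^+ 2 * q 3%N = 0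
       & 8 * (3 - n) * b * d * p 4%N = 0],
     [/\ (n - 1) * (n - 2) * d ^+ 2 * q 2%N + 6 * (2 - n) * s * d * q 3%N
           + 12 * s ^+ 2 * q 4%N + d ^+ 2 * (2 * p 2%N + Q) = 0,
         (n - 2) * (n - 3) * d ^+ 2 * q 3%N + 8 * (3 - n) * s * d * q 4%N = 0
       & 8 * (3 - n) * b * d * q 4%N = 0],
     2 * b * d * (2 * p 2%N + 2 * q 2%N + Q) - 4 * n * b * d * (p 2%N + q 2%N)
       + 12 * s * (d * p 3%N + b * q 3%N) = 0
   & 12 * (b ^+ 2 * q 4%N + d ^+ 2 * p 4%N) = 0].
Proof.
(* [W]_ik is the coefficient of [x^i z^k]. *)
pose W (i : nat) := nth 0 (nth [::] [::
  [:: Q * s ^+ 2 + T - 2 * b * n * p 1%N * s + b ^+ 2 * n * p 0%N + b ^+ 2 * n ^+ 2 * p 0%N - 2 *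
    d * n * q 1%N * s + d ^+ 2 * n * q 0%N + d ^+ 2 * n ^+ 2 * q 0%N - k + 2 * p 2%N * s ^+ 2 +
    2 * q 2%N * s ^+ 2 + r * s;
    2 * Q * d * s - 2 * b * d * n * p 1%N - 4 * d * n * q 2%N * s + 4 * d * p 2%N * s + 4 * d *
    q 2%N * s + d * r - d ^+ 2 * n * q 1%N + d ^+ 2 * n ^+ 2 * q 1%N - h + 6 * q 3%N * s ^+ 2;
    Q * d ^+ 2 - 6 * d * n * q 3%N * s + 12 * d * q 3%N * s - 3 * d ^+ 2 * n * q 2%N + d ^+ 2 *
    n ^+ 2 * q 2%N + 2 * d ^+ 2 * p 2%N + 2 * d ^+ 2 * q 2%N + 12 * q 4%N * s ^+ 2;
    - 8 * d * n * q 4%N * s + 24 * d * q 4%N * s - 5 * d ^+ 2 * n * q 3%N + d ^+ 2 * n ^+ 2 * q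
    3%N + 6 * d ^+ 2 * q 3%N;
    - 7 * d ^+ 2 * n * q 4%N + d ^+ 2 * n ^+ 2 * q 4%N + 12 * d ^+ 2 * q 4%N];
  [:: 2 * Q * b * s - 2 * b * d * n * q 1%N - 4 * b * n * p 2%N * s + 4 * b * p 2%N * s + 4 * b *
    q 2%N * s + b * r - b ^+ 2 * n * p 1%N + b ^+ 2 * n ^+ 2 * p 1%N - e + 6 * p 3%N * s ^+ 2;
    2 * Q * b * d - 4 * b * d * n * p 2%N - 4 * b * d * n * q 2%N + 4 * b * d * p 2%N + 4 * b *
    d * q 2%N + 12 * b * q 3%N * s + 12 * d * p 3%N * s;
    - 6 * b * d * n * q 3%N + 12 * b * d * q 3%N + 24 * b * q 4%N * s + 6 * d ^+ 2 * p 3%N;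
    - 8 * b * d * n * q 4%N + 24 * b * d * q 4%N;
    0];
  [:: Q * b ^+ 2 - 6 * b * n * p 3%N * s + 12 * b * p 3%N * s - 3 * b ^+ 2 * n * p 2%N + b ^+ 2 *
    n ^+ 2 * p 2%N + 2 * b ^+ 2 * p 2%N + 2 * b ^+ 2 * q 2%N + 12 * p 4%N * s ^+ 2;
    - 6 * b * d * n * p 3%N + 12 * b * d * p 3%N + 6 * b ^+ 2 * q 3%N + 24 * d * p 4%N * s;
    12 * b ^+ 2 * q 4%N + 12 * d ^+ 2 * p 4%N;
    0;
    0];
  [:: - 8 * b * n * p 4%N * s + 24 * b * p 4%N * s - 5 * b ^+ 2 * n * p 3%N + b ^+ 2 * n ^+ 2 * p
    3%N + 6 * b ^+ 2 * p 3%N;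
    - 8 * b * d * n * p 4%N + 24 * b * d * p 4%N;
    0;
    0;
    0];
  [:: - 7 * b ^+ 2 * n * p 4%N + b ^+ 2 * n ^+ 2 * p 4%N + 12 * b ^+ 2 * p 4%N;
    0;
    0;
    0;
    0]] i).
(* The coefficients are separated in two rounds: first as a polynomial in [x] for each fixed [z],
   then as polynomials in [z]. *)
have Wx z : J2 z -> forall i, (i < 5)%N -> quartic (W i) z = 0.
  move=> Jz; apply: (quartic_zero_on oJ1 nJ1 (p := fun i => quartic (W i) z)) => x Jx.
  have /eqP := pqE Jx Jz; rewrite /= -subr_eq0 => /eqP e0; apply: etrans e0.
  by rewrite /quartic /quartic' /quartic'' /W /=; ring.
have V i j : (i < 5)%N -> (j < 5)%N -> W i j = 0.
  by move=> i5 j5; apply: (quartic_zero_on oJ2 nJ2) => // z Jz; exact: Wx.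
have v20 := V 2 0 isT isT; have v30 := V 3 0 isT isT; have v21 := V 2 1 isT isT.
have v31 := V 3 1 isT isT; have v02 := V 0 2 isT isT; have v03 := V 0 3 isT isT.
have v13 := V 1 3 isT isT; have v11 := V 1 1 isT isT; have v22 := V 2 2 isT isT.
rewrite /W /= in v20 v30 v21 v31 v02 v03 v13 v11 v22.
split; [split|split| |].
- by rewrite -[RHS]v20; ring.
- by rewrite -[RHS]v30; ring.
- by rewrite -[RHS]v21; ring.
- by rewrite -[RHS]v31; ring.
- by rewrite -[RHS]v02; ring.
- by rewrite -[RHS]v03; ring.
- by rewrite -[RHS]v13; ring.
- by rewrite -[RHS]v11; ring.
- by rewrite -[RHS]v22; ring.
Qed.

(** For [n] different from 3 the mixed monomials [x^3 z] and [x z^3] remove the quartic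
    coefficients, and then [x^3] and [z^3] remove the cubic ones. *)
Lemma pair_equation_degenerate : 3 < n ->
  [/\ p 2%N = 0, p 3%N = 0, p 4%N = 0 & Q = 0].
Proof.
move=> n3; have [[v20 v30 _ v31] [v02 v03 v13] v11 _] := pair_equation_coefficients.
have nn3 : n - 3 != 0 by rewrite subr_eq0 gt_eqF.
have nn2 : n - 2 != 0 by rewrite subr_eq0 gt_eqF//; lra.
have nn1 : n + 1 != 0 by rewrite gt_eqF//; lra.
have n0 : n != 0 by rewrite gt_eqF//; lra.
have two0 : 2 != 0 :> R by rewrite pnatr_eq0.
have h31 : -8 * (n - 3) * b * d != 0 by rewrite !mulf_neq0// oppr_eq0 pnatr_eq0.
have p40 : p 4%N = 0 by apply: (mulfI h31); rewrite mulr0 -[RHS]v31; ring.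
have q40 : q 4%N = 0 by apply: (mulfI h31); rewrite mulr0 -[RHS]v13; ring.
have p30 : p 3%N = 0.
  have h0 : (n - 2) * (n - 3) * b ^+ 2 != 0 by rewrite !mulf_neq0// expf_neq0.
  by apply: (mulfI h0); rewrite mulr0 -[RHS]v30 p40; ring.
have q30 : q 3%N = 0.
  have h0 : (n - 2) * (n - 3) * d ^+ 2 != 0 by rewrite !mulf_neq0// expf_neq0.
  by apply: (mulfI h0); rewrite mulr0 -[RHS]v03 q40; ring.
(* What remains is a linear system in [p 2], [q 2] and [Q]. Eliminating [Q] leaves a symmetric two
   by two system with diagonal [n - 1] and off-diagonal 2, of determinant [(n + 1) (n - 3)]. *)
have w11 : Q = (2 * n - 2) * (p 2%N + q 2%N).
  have h0 : 2 * b * d != 0 by rewrite !mulf_neq0.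
  apply/eqP; rewrite -subr_eq0; apply/eqP; apply: (mulfI h0).
  by rewrite mulr0 -[RHS]v11 p30 q30; ring.
have w20 : (n - 1) * p 2%N + 2 * q 2%N = 0.
  have h0 : n * b ^+ 2 != 0 by rewrite mulf_neq0// expf_neq0.
  by apply: (mulfI h0); rewrite mulr0 -[RHS]v20 p30 p40 w11; ring.
have w02 : (n - 1) * q 2%N + 2 * p 2%N = 0.
  have h0 : n * d ^+ 2 != 0 by rewrite mulf_neq0// expf_neq0.
  by apply: (mulfI h0); rewrite mulr0 -[RHS]v02 q30 q40 w11; ring.
have pq : q 2%N = - p 2%N.
  apply/eqP; rewrite -subr_eq0 opprK; apply/eqP; apply: (mulfI nn1).
  by rewrite mulr0 -[RHS](addr0 0) -{1}w20 -w02; ring.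
have p20 : p 2%N = 0 by apply: (mulfI nn3); rewrite mulr0 -[RHS]w20 pq; ring.
by split=> //; rewrite w11 pq p20; ring.
Qed.

(** The coefficients of [x^2 z^2], [x^2 z] and [x^2] determine [q 4], [q 3] and [q 2]
    respectively. *)
Lemma pair_equation_relations : n = 3 -> Q = 0 ->
  [/\ q 4%N = - (d ^+ 2 / b ^+ 2) * p 4%N,
      q 3%N = - 4 * (s * d / b ^+ 2) * p 4%N + d / b * p 3%N
    & q 2%N = - 6 * (s ^+ 2 / b ^+ 2) * p 4%N + 3 * (s / b) * p 3%N - p 2%N].
Proof.
move=> n3 Q0; have [[v20 _ v21 _] _ _ v22] := pair_equation_coefficients.
have h0 (u : R) : u != 0 -> u * b ^+ 2 != 0 by move=> u0; rewrite mulf_neq0// expf_neq0.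
have h22 : 12 * b ^+ 2 != 0 by rewrite h0// pnatr_eq0.
have h21 : 6 * b ^+ 2 != 0 by rewrite h0// pnatr_eq0.
have h20 : 2 * b ^+ 2 != 0 by rewrite h0// pnatr_eq0.
split; apply/eqP; rewrite -subr_eq0; apply/eqP.
- by apply: (mulfI h22); rewrite mulr0 -[RHS]v22; field.
- by apply: (mulfI h21); rewrite mulr0 -[RHS]v21 n3; field.
- by apply: (mulfI h20); rewrite mulr0 -[RHS]v20 n3 Q0; field.
Qed.

End Quartics.

Lemma poly_deg_of_quadratic (J : set R) (f : R -> R) (c0 c1 c2 : R) :
  (forall x, J x -> f x = c0 + c1 * x + c2 * x ^+ 2) -> poly_deg_le_on J 2 f.
Proof.
move=> h; exists (Poly [:: c0; c1; c2]); split; first exact: size_Poly.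
by move=> x /h ->; rewrite horner_Poly /=; ring.
Qed.

(* For fixed [x] the terms in [f] are quadratic in [z] with leading coefficient
   [d^2 f2 x]; for fixed [z] all other terms are quadratic in [x].  Hence a second
   difference in [z] expresses [f2] as a quadratic polynomial. *)
Lemma second_derivative_quadratic (J1 J2 : set R) (f f1 f2 g g1 g2 : R -> R)
    (n s b d Q r T k e h : R) : d != 0 -> open J2 -> J2 !=set0 ->
  pair_equation J1 J2 n s b d Q r T k e h f f1 f2 g g1 g2 ->
  poly_deg_le_on J1 2 f2.
Proof.
move=> d0 oJ [z0 Jz0] eqL.
(* Three equally spaced points of [J2]; a quarter of the radius of a ball in [J2] is a safe step. *)
have [y [y0 Jz1 Jz2]] : exists y : R, [/\ y != 0, J2 (z0 + y) & J2 (z0 + 2 * y)].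
  have /nbhs_ballP[y /= ygt0 yJ] := open_near oJ Jz0.
  exists (y / 4); split; first by rewrite mulf_neq0// gt_eqF.
    by apply: yJ; rewrite /ball /= opprD addNKr normrN gtr0_norm; lra.
  by apply: yJ; rewrite /ball /= opprD addNKr normrN gtr0_norm; lra.
pose z1 := z0 + y; pose z2 := z0 + 2 * y.
(* [a0 z + a1 z * x + a2 z * x ^+ 2] is the [g]-part of the equation. The second difference in [z]
   of [L^2] is [2 (d y)^2], and it annihilates the affine right-hand side and the terms in [f1] and
   [f], which have degree at most 1 in [z]. *)
pose a0 z := g2 z * (s + d * z) ^+ 2 - 2 * n * d * g1 z * (s + d * z) + n * (n +
  1) * d ^+ 2 * g z.
pose a1 z := 2 * b * (s + d * z) * g2 z - 2 * n * d * b * g1 z.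
pose a2 z := b ^+ 2 * g2 z.
pose sd (u : R -> R) := - (u z0 - 2 * u z1 + u z2) / (2 * (d * y) ^+ 2).
apply: (@poly_deg_of_quadratic _ _ (sd a0 - Q) (sd a1) (sd a2)) => x Jx.
have e0 := eqL x z0 Jx Jz0; have e1 := eqL x z1 Jx Jz1; have e2 := eqL x z2 Jx Jz2.
rewrite /= in e0 e1 e2.
have dy0 : 2 * (d * y) ^+ 2 != 0 by rewrite mulf_neq0// ?pnatr_eq0// expf_neq0// mulf_neq0.
apply: (mulfI dy0).
have -> : 2 * (d * y) ^+ 2 * (sd a0 - Q + sd a1 * x + sd a2 * x ^+ 2) =
   - (a0 z0 - 2 * a0 z1 + a0 z2) - Q * (2 * (d * y) ^+ 2)
   - (a1 z0 - 2 * a1 z1 + a1 z2) * x - (a2 z0 - 2 * a2 z1 + a2 z2) * x ^+ 2.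
  by rewrite /sd; field; rewrite d0 y0.
apply/eqP; rewrite -subr_eq0; apply/eqP.
have E : forall u v w u' v' w' : R, u = u' -> v = v' -> w = w' ->
  (u - u') - 2 * (v - v') + (w - w') = 0 by move=> ? ? ? ? ? ? -> -> ->; ring.
rewrite -[RHS](E _ _ _ _ _ _ e0 e1 e2) /a0 /a1 /a2 /z1 /z2; ring.
Qed.

End TwoVariables.

(** * Explicit first and second derivatives on an interval *)

Section SecondDerivatives.
Context {R : realType}.
Implicit Types (J : set R) (f F : R -> R).

Lemma derives_affine (a b x : R) : is_derive x 1 (fun y => a + b * y) b.
Proof.
have dx : is_derive x 1 (fun y : R => y) 1 by exact: is_derive_id.
apply: (is_derive_eq (derives_add (derives_cst a x 1) (derives_mul (derives_cst b x 1) dx))).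
by ring.
Qed.

Lemma derives_power f (x df : R) n : is_derive x 1 f df ->
  is_derive x 1 (fun y => f y ^+ n) (n%:R * f x ^+ n.-1 * df).
Proof.
move=> h; elim: n => [|n ih].
  by apply: (is_derive_eq (derives_cst 1 x 1)); ring.
have e : (fun y => f y ^+ n.+1) = (fun y => f y * f y ^+ n).
  by apply/funext => y; rewrite exprS.
rewrite e; apply: (is_derive_eq (derives_mul h ih)).
by case: n {ih e} => [|n] /=; rewrite ?exprS -?[in RHS]natr1; ring.
Qed.

Lemma quartic_derives J f (p : nat -> R) : open J ->
  (forall x, J x -> f x = quartic p x) ->
  (forall x, J x -> derive1n 1 f x = quartic' p x)
  /\ (forall x, J x -> derive1n 2 f x = quartic'' p x).
Proof.
move=> oJ f0.
have dx (x : R) : is_derive x 1 (fun y : R => y) 1 by exact: is_derive_id.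
have dm k a (x : R) : is_derive x 1 (fun y => a * y ^+ k) (a * (k%:R * x ^+ k.-1 * 1)).
  apply: (is_derive_eq (derives_mul (derives_cst a x 1) (derives_power k (dx x)))).
  by rewrite mul0r add0r.
have f1 x : J x -> derive1n 1 f x = quartic' p x.
  move=> Jx; apply: (derive1_on oJ f0 Jx).
  apply: (is_derive_eq (derives_add (derives_add (derives_add (derives_affine _ _ _)
    (dm 2 _ x)) (dm 3 _ x)) (dm 4 _ x))).
  by rewrite /quartic' /=; ring.
split=> // x Jx; rewrite derive1nS; apply: (derive1_on oJ f1 Jx).
apply: (is_derive_eq (derives_add (derives_add (derives_affine _ _ _) (dm 2 _ x)) (dm 3 _ x))).
by rewrite /quartic'' /=; ring.
Qed.

Lemma quartic_expand J f d : open J -> (d <= 4)%N -> poly_deg_le_on J d f ->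
  exists p : nat -> R, [/\ forall i, (d < i)%N -> p i = 0,
    forall x, J x -> f x = quartic p x,
    forall x, J x -> derive1n 1 f x = quartic' p x
    & forall x, J x -> derive1n 2 f x = quartic'' p x].
Proof.
move=> oJ d4 [q [sq fq]]; pose p i := q`_i; exists p.
have f0 x : J x -> f x = quartic p x.
  move=> Jx; rewrite fq// (@horner_coef_wide _ 5) ?(leq_trans sq)//.
  by rewrite !big_ord_recl big_ord0 /= /quartic /p; ring.
have [f1 f2] := quartic_derives oJ f0.
by split=> // i di; rewrite /p nth_default// (leq_trans sq).
Qed.

Lemma cubic_second_derive J f : open J -> poly_deg_le_on J 3 f ->
  exists u v, forall x, J x -> derive1n 2 f x = u + v * x.
Proof.
move=> oJ h3; have [p [p0 _ _ f2]] := quartic_expand oJ (isT : (3 <= 4)%N) h3.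
by exists (2 * p 2%N), (6 * p 3%N) => x Jx; rewrite f2// /quartic'' (p0 4%N)//; ring.
Qed.

Lemma affine_derives J f : open J -> poly_deg_le_on J 1 f ->
  exists u v, forall x, J x ->
    [/\ f x = u + v * x, derive1n 1 f x = v & derive1n 2 f x = 0].
Proof.
move=> oJ h1; have [p [p0 f0 f1 f2]] := quartic_expand oJ (isT : (1 <= 4)%N) h1.
exists (p 0%N), (p 1%N) => x Jx.
by rewrite f0// f1// f2// /quartic /quartic' /quartic'' (p0 2%N)// (p0 3%N)// (p0 4%N)//;
  split; ring.
Qed.

(** The link between the derivative of [A_j / L^(m+1)] and its expanded form: for [n = m + 1] the
    numerator is the term of the extremality equation and the denominator is [L^(m+3)]. [F] is
    prescribed on [J] only, so it may be a given second antiderivative. *)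
Lemma second_derive_div_power J f F (a b : R) n : open J -> smooth_on J f ->
  (forall x, J x -> a + b * x != 0) ->
  (forall x, J x -> F x = f x / (a + b * x) ^+ n) ->
  forall x, J x -> [/\ derivable F x 1, derivable (derive1 F) x 1
    & derive1n 2 F x = (derive1n 2 f x * (a + b * x) ^+ 2
        - 2 * n%:R * b * derive1n 1 f x * (a + b * x)
        + n%:R * (n%:R + 1) * b ^+ 2 * f x) / (a + b * x) ^+ (n + 2)].
Proof.
move=> oJ sf l0 FE.
have dl k (x : R) : J x -> is_derive x 1 (fun y => (a + b * y) ^- k)
    (- k%:R * b / (a + b * x) ^+ k.+1).
  move=> Jx; have lx := l0 x Jx.
  have lk : (a + b * x) ^+ k != 0 by rewrite expf_neq0.
  apply: (is_derive_eq (derives_inv (f := fun y => (a + b * y) ^+ k) lk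
    (derives_power k (derives_affine a b x)))).
  case: k lk => [|k] lk; first by rewrite /= !mulr0n !(mul0r, oppr0).
  by rewrite /= !exprS; field; rewrite lx expf_neq0.
have df k (x : R) (Jx : J x) : is_derive x 1 (derive1n k f) (derive1n k.+1 f x).
  by apply: DeriveDef; [exact: sf|rewrite derive1nS derive1E].
have d1 x (Jx : J x) := derives_mul (df 0%N x Jx) (dl n x Jx).
have F1 x : J x -> derive1 F x = derive1n 1 f x * (a + b * x) ^- n
    + - n%:R * b * (f x * (a + b * x) ^- n.+1).
  by move=> Jx; apply: (derive1_on oJ FE Jx); apply: (is_derive_eq (d1 x Jx));
    rewrite derive1n0; ring.
have d2 x (Jx : J x) := derives_add (derives_mul (df 1%N x Jx) (dl n x Jx))
  (derives_mul (derives_cst (- n%:R * b) x 1) (derives_mul (df 0%N x Jx) (dl n.+1 x Jx))).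
move=> x Jx; split.
- by have [] := derives_on oJ FE Jx (d1 x Jx).
- by have [] := derives_on oJ F1 Jx (d2 x Jx).
rewrite derive1nS; apply: (derive1_on oJ F1 Jx); apply: (is_derive_eq (d2 x Jx)).
have lx := l0 x Jx; have lk : (a + b * x) ^+ n != 0 by rewrite expf_neq0.
rewrite addn2 !exprS /= -[n.+1%:R]natr1.
by field; rewrite lx lk.
Qed.

End SecondDerivatives.

(** * The extremality equation *)

Section AffineOnBox.
Context {R : realType} {m : nat}.
Variable I : 'I_m -> set R.
Implicit Types (F G : 'rV[R]_m -> R).

Definition affine_on F : Prop :=
  exists (e0 : R) (e : 'I_m -> R), forall x, box I x -> F x = e0 + \sum_j e j * x 0 j.

Lemma affine_on_ext F G : (forall x, box I x -> F x = G x) -> affine_on F -> affine_on G.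
Proof. by move=> FG [e0 [e Fe]]; exists e0, e => x bx; rewrite -FG// Fe. Qed.

Lemma affine_on_cst k : affine_on (fun=> k).
Proof. by exists k, (fun=> 0) => x _; rewrite big1 ?addr0// => j _; rewrite mul0r. Qed.

Lemma affine_on_add F G : affine_on F -> affine_on G -> affine_on (fun x => F x + G x).
Proof.
move=> [e0 [e Fe]] [h0 [h Gh]]; exists (e0 + h0), (fun j => e j + h j) => x bx.
by rewrite Fe// Gh// addrACA -big_split; congr (_ + _); apply: eq_bigr => j _; rewrite mulrDl.
Qed.

Lemma affine_on_scale k F : affine_on F -> affine_on (fun x => k * F x).
Proof.
move=> [e0 [e Fe]]; exists (k * e0), (fun j => k * e j) => x bx.
by rewrite Fe// mulrDr mulr_sumr; congr (_ + _); apply: eq_bigr => j _; rewrite mulrA.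
Qed.

Lemma affine_on_coord j : affine_on (fun x => x 0 j).
Proof. by exists 0, (fun k => (j == k)%:R) => x _; rewrite add0r sum_delta. Qed.

Lemma affine_on_sum (T : finType) (P : pred T) (F : T -> 'rV[R]_m -> R) :
  (forall t, P t -> affine_on (F t)) -> affine_on (fun x => \sum_(t | P t) F t x).
Proof.
move=> aF; elim: (index_enum T) => [|t s ih].
  by apply: affine_on_ext (affine_on_cst 0) => x _; rewrite big_nil.
have [Pt|Pt] := boolP (P t).
  by apply: affine_on_ext (affine_on_add (aF t Pt) ih) => x _; rewrite big_cons Pt.
by apply: affine_on_ext ih => x _; rewrite big_cons (negbTE Pt).
Qed.

End AffineOnBox.

Section ExtremalEquation.
Context {R : realType} {m : nat}.
Variables (I : 'I_m -> set R) (A : 'I_m -> R -> R) (c0 : R) (c : 'I_m -> R).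
Hypothesis hI : forall j, open_interval (I j).
Hypothesis A_smooth : forall j, smooth_on (I j) (A j).
Implicit Types (x : 'rV[R]_m) (i j k : 'I_m).

Definition aff x : R := c0 + \sum_j c j * x 0 j.
Hypothesis aff_neq0 : forall x, box I x -> aff x != 0.
Notation n := (m%:R + 1 : R).

Definition ee_term k (y l : R) : R :=
  derive1n 2 (A k) y * l ^+ 2 - 2 * n * c k * derive1n 1 (A k) y * l
  + n * (n + 1) * c k ^+ 2 * A k y.
(* [ee_term k] is [L^(m+3) d_k^2 (A_k / L^(m+1))] with the derivative expanded. *)
Definition ee x : R := \sum_k ee_term k (x 0 k) (aff x).

Let oI i : open (I i). Proof. by have [] := hI i. Qed.
Let nI i : I i !=set0. Proof. by have [] := hI i. Qed.

Lemma scal_ee (L : 'rV[R]_m -> R) x : (forall y, L y = aff y) -> box I x ->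
  scal A L c x * L x = - ee x.
Proof.
move=> Laff bx; rewrite /scal /ee mulr_suml -sumrN; apply: eq_bigr => k _.
rewrite /ee_term /cf Laff; have := aff_neq0 bx; move: (aff x) => l l0 /=.
by field.
Qed.

Lemma sum_set_coord (F : 'I_m -> R -> R) x i h :
  \sum_k F k (set_coord x i h 0 k) = \sum_k F k (x 0 k) + (F i h - F i (x 0 i)).
Proof.
rewrite (bigD1 i)//= [X in _ = X + _](bigD1 i)//= mxE eqxx.
under eq_bigr => k ki do rewrite mxE (negbTE ki).
by ring.
Qed.

Lemma aff_set_coord x i h : aff (set_coord x i h) = aff x + c i * (h - x 0 i).
Proof. by rewrite /aff (sum_set_coord (fun k y => c k * y)); ring. Qed.

Lemma ee_term_off k y l : c k = 0 -> ee_term k y l = derive1n 2 (A k) y * l ^+ 2.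
Proof.
move=> ck; rewrite /ee_term ck.
by move: (derive1n 2 _ _) (derive1n 1 _ _) (A k y) => u v w; ring.
Qed.

Lemma ee_set_coord x i h : c i = 0 ->
  ee (set_coord x i h) = ee x
  + (derive1n 2 (A i) h - derive1n 2 (A i) (x 0 i)) * aff x ^+ 2.
Proof.
move=> ci; rewrite /ee aff_set_coord ci mul0r addr0.
have := sum_set_coord (fun k y => ee_term k y (aff x)) x i h; rewrite /= => ->.
by rewrite !ee_term_off// mulrBl.
Qed.

(** * Consequences of the extremality equation *)

Section Necessary.
Variables (e0 : R) (e : 'I_m -> R).
Hypothesis eeE : forall x, box I x -> ee x = e0 + \sum_j e j * x 0 j.

Lemma off_support_second_derive x i h : box I x -> I i h -> c i = 0 ->
  (derive1n 2 (A i) h - derive1n 2 (A i) (x 0 i)) * aff x ^+ 2 = e i * (h - x 0 i).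
Proof.
move=> bx Ih ci; have := ee_set_coord x h ci.
have := sum_set_coord (fun k y => e k * y) x i h; rewrite /= => es.
rewrite !eeE//; last exact: box_set_coord.
by rewrite es addrA => /addrI <-; rewrite mulrBr.
Qed.

Lemma cubic_of_constant : (forall j, c j = 0) -> forall i, poly_deg_le_on (I i) 3 (A i).
Proof.
move=> cz i; have [x0 bx0] := box_nonempty hI.
apply: (poly_deg_primitive2 (d := 1)) => //.
have a0 : aff x0 ^+ 2 != 0 by rewrite expf_neq0// aff_neq0.
exists ((derive1n 2 (A i) (x0 0 i) - e i * x0 0 i / aff x0 ^+ 2)%:P + (e i / aff x0 ^+ 2) *: 'X).
split=> [|h Ih].
  apply: (leq_trans (size_polyD _ _)); rewrite geq_max (leq_trans (size_polyC_leq1 _))//=.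
  by rewrite (leq_trans (size_scale_leq _ _))// size_polyX.
rewrite !hornerE; have := off_support_second_derive bx0 Ih (cz i).
move: (aff x0 ^+ 2) a0 => l l0; move: (derive1n 2 (A i) h) (derive1n 2 (A i) (x0 0 i)) => u v uv.
apply: (mulIf l0); rewrite -[u](subrK v) mulrDl uv; by field.
Qed.

(** Changing [x_i] alone gives [dd * L^2 = e_i (h - x_i)], where [dd] is the increment of [A_i''].
    The right-hand side does not contain [x_j], while the left-hand side is quadratic in it with
    leading coefficient [dd * c_j^2]; so [dd] vanishes. *)
Lemma off_support_second_derive_const i j : c i = 0 -> c j != 0 ->
  exists C, forall h, I i h -> derive1n 2 (A i) h = C.
Proof.
move=> ci cj; have [x0 bx0] := box_nonempty hI.
exists (derive1n 2 (A i) (x0 0 i)) => h Ih.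
set dd := derive1n 2 (A i) h - derive1n 2 (A i) (x0 0 i).
suff : dd = 0 by move/eqP; rewrite subr_eq0 => /eqP.
have ij : i != j by apply: contraNneq cj => <-; rewrite ci.
pose s := aff x0 - c j * x0 0 j.
pose w := nth 0 [:: dd * s ^+ 2 - e i * (h - x0 0 i); dd * (2 * s * c j); dd * c j ^+ 2].
have u2 : dd * c j ^+ 2 = 0.
  apply: (quartic_zero_on (@oI j) (@nI j) (p := w) _ (i := 2)) => // y Jy.
  have := off_support_second_derive (box_set_coord bx0 Jy) Ih ci.
  rewrite mxE (negbTE ij) -/dd aff_set_coord => /eqP; rewrite -subr_eq0 => /eqP hh.
  by rewrite -[RHS]hh /quartic /w /= /s; clear hh w; move: dd (aff x0) => w l; ring.
by move/eqP: u2; rewrite mulf_eq0 sqrf_eq0 (negbTE cj) orbF => /eqP.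
Qed.

Lemma off_support_quadratic i j : c i = 0 -> c j != 0 -> poly_deg_le_on (I i) 2 (A i).
Proof.
move=> ci cj; have [C hC] := off_support_second_derive_const ci cj.
apply: (poly_deg_primitive2 (d := 0)) => //; exists C%:P; split; first exact: size_polyC_leq1.
by move=> x Ix; rewrite hornerC hC.
Qed.

(** All variables except [x_i] and [x_k] are frozen at the values of [x0]. The values of [s] and of
    the coefficient of [L^2] stay visible: the former enters the quartic relations, and the
    vanishing of the latter is the condition on the remaining [A_l'']. *)
Lemma two_variable_equation i k x0 : i != k -> box I x0 ->
  exists s r T ka u v : R, s = aff x0 - c i * x0 0 i - c k * x0 0 k /\
    pair_equation (I i) (I k) n s (c i) (c k)
      (\sum_(l | (l != i) && (l != k)) derive1n 2 (A l) (x0 0 l)) r T ka u v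
      (A i) (derive1n 1 (A i)) (derive1n 2 (A i)) (A k) (derive1n 1 (A k)) (derive1n 2 (A k)).
Proof.
move=> ik bx0.
pose O l := (l != i) && (l != k).
exists (aff x0 - c i * x0 0 i - c k * x0 0 k),
  (\sum_(l | O l) - (2 * n * c l * derive1n 1 (A l) (x0 0 l))),
  (\sum_(l | O l) n * (n + 1) * c l ^+ 2 * A l (x0 0 l)),
  (e0 + \sum_(l | O l) e l * x0 0 l), (e i), (e k); split=> // x z Ix Iz L.
pose y := set_coord (set_coord x0 i x) k z.
have yi : y 0 i = x by rewrite !mxE (negbTE ik) eqxx.
have yk : y 0 k = z by rewrite !mxE eqxx.
have yO l : O l -> y 0 l = x0 0 l by move=> /andP[li lk]; rewrite !mxE (negbTE li) (negbTE lk).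
have aL : aff y = L.
  by rewrite /y !aff_set_coord mxE eq_sym (negbTE ik) /L; ring.
have by_ : box I y by apply: box_set_coord => //; exact: box_set_coord.
have split2 (F : 'I_m -> R) : \sum_l F l = F i + F k + \sum_(l | O l) F l.
  rewrite (bigD1 i)//= (bigD1 k)//=; last by rewrite eq_sym.
  by rewrite addrA.
have eO : \sum_(l | O l) ee_term l (y 0 l) L =
    (\sum_(l | O l) derive1n 2 (A l) (x0 0 l)) * L ^+ 2
    + (\sum_(l | O l) - (2 * n * c l * derive1n 1 (A l) (x0 0 l))) * L
    + \sum_(l | O l) n * (n + 1) * c l ^+ 2 * A l (x0 0 l).
  rewrite !mulr_suml -!big_split /=; apply: eq_bigr => l Ol; rewrite yO// /ee_term.
  by rewrite mulNr.
have sO : \sum_(l | O l) e l * y 0 l = \sum_(l | O l) e l * x0 0 l.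
  by apply: eq_bigr => l Ol; rewrite yO.
have := eeE by_; rewrite /ee !split2 aL yi yk eO sO => hh.
by apply: etrans hh _; ring.
Qed.

Lemma quartic_on_support i k : i != k -> c k != 0 -> poly_deg_le_on (I i) 4 (A i).
Proof.
move=> ik ck; have [x0 bx0] := box_nonempty hI.
have [s [r [T [ka [u [v [_ eq2]]]]]]] := two_variable_equation ik bx0.
apply: (poly_deg_primitive2 (d := 2)) => //.
exact: (second_derivative_quadratic ck (@oI k) (@nI k) eq2).
Qed.

(** Here [n = m + 1] exceeds 3, so the degenerate case applies: the coefficients of degree at least
    2 vanish, and so does [Q], which is the asserted sum. *)
Lemma affine_on_support i k x0 : (2 < m)%N -> i != k -> c i != 0 -> c k != 0 -> box I x0 ->
  poly_deg_le_on (I i) 1 (A i)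
  /\ \sum_(l | (l != i) && (l != k)) derive1n 2 (A l) (x0 0 l) = 0.
Proof.
move=> m2 ik ci ck bx0.
have [s [r [T [ka [u [v [_ eq2]]]]]]] := two_variable_equation ik bx0.
have ki : k != i by rewrite eq_sym.
have [p [_ fp fp1 fp2]] := quartic_expand (@oI i) (leqnn 4) (quartic_on_support ik ck).
have [q [_ gq gq1 gq2]] := quartic_expand (@oI k) (leqnn 4) (quartic_on_support ki ci).
have n3 : 3 < n by rewrite natr1 ltr_nat.
have pqE : pair_equation (I i) (I k) n s (c i) (c k)
    (\sum_(l | (l != i) && (l != k)) derive1n 2 (A l) (x0 0 l)) r T ka u v
    (quartic p) (quartic' p) (quartic'' p) (quartic q) (quartic' q) (quartic'' q).
  move=> x z Ix Iz; have := eq2 x z Ix Iz.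
  by rewrite fp// fp1// fp2// gq// gq1// gq2//; exact.
have [p20 p30 p40 Q0] :=
  pair_equation_degenerate (@oI i) (@nI i) (@oI k) (@nI k) pqE ci ck n3.
split=> //; exists (Poly [:: p 0%N; p 1%N]); split; first exact: size_Poly.
by move=> x Ix; rewrite fp// /quartic p20 p30 p40 horner_Poly /=; ring.
Qed.

(** For [m = 2] nothing is frozen: [Q] is an empty sum, [s] is [c0], and [n] is the exceptional
    value 3. *)
Lemma quartic_relations i k : m = 2%N -> i != k -> c i != 0 -> c k != 0 ->
  exists p q : nat -> R, [/\
    forall x : R, I i x -> A i x = \sum_(r < 5) p r * x ^+ r,
    forall x : R, I k x -> A k x = \sum_(r < 5) q r * x ^+ r
  & [/\ q 4%N = - (c k ^+ 2 / c i ^+ 2) * p 4%N,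
      q 3%N = - 4 * (c0 * c k / c i ^+ 2) * p 4%N + c k / c i * p 3%N
    & q 2%N = - 6 * (c0 ^+ 2 / c i ^+ 2) * p 4%N + 3 * (c0 / c i) * p 3%N - p 2%N]].
Proof.
move=> m2 ik ci ck; have [x0 bx0] := box_nonempty hI.
have [s [r [T [ka [u [v [sE eq2]]]]]]] := two_variable_equation ik bx0.
have ki : k != i by rewrite eq_sym.
have only l : (l != i) && (l != k) = false.
  apply/negP => /andP[li lk].
  have lt2 (j : 'I_m) : (j < 2)%N by rewrite -[X in (_ < X)%N]m2.
  move: ik li lk (lt2 i) (lt2 k) (lt2 l); rewrite -!(inj_eq val_inj) /=.
  by case: (nat_of_ord i) (nat_of_ord k) (nat_of_ord l) => [|[|?]] [|[|?]] [|[|?]].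
have [p [_ fp fp1 fp2]] := quartic_expand (@oI i) (leqnn 4) (quartic_on_support ik ck).
have [q [_ gq gq1 gq2]] := quartic_expand (@oI k) (leqnn 4) (quartic_on_support ki ci).
have s0 : s = c0.
  rewrite sE /aff (bigD1 i)//= (bigD1 k)//= big_pred0//; ring.
have n3 : n = 3 by rewrite natr1 m2.
have Q0 : \sum_(l | (l != i) && (l != k)) derive1n 2 (A l) (x0 0 l) = 0.
  exact: big_pred0 only.
have pqE : pair_equation (I i) (I k) n s (c i) (c k)
    (\sum_(l | (l != i) && (l != k)) derive1n 2 (A l) (x0 0 l)) r T ka u v
    (quartic p) (quartic' p) (quartic'' p) (quartic q) (quartic' q) (quartic'' q).
  move=> x z Ix Iz; have := eq2 x z Ix Iz.
  by rewrite fp// fp1// fp2// gq// gq1// gq2//; exact.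
have [] := pair_equation_relations (@oI i) (@nI i) (@oI k) (@nI k) pqE ci n3 Q0.
move=> q4 q3 q2; exists p, q; split; last by rewrite -s0; split.
  by move=> x Ix; rewrite fp// !big_ord_recl big_ord0 /quartic /=; ring.
by move=> x Ix; rewrite gq// !big_ord_recl big_ord0 /quartic /=; ring.
Qed.

End Necessary.

(** * Sufficiency of the conditions in each case *)

Lemma ee_affine_constant : (forall j, c j = 0) ->
  (forall i, poly_deg_le_on (I i) 3 (A i)) -> affine_on I ee.
Proof.
move=> cz h3.
have /fin_all_exists[u /fin_all_exists[v uv]] :=
  fun i => cubic_second_derive (@oI i) (h3 i).
have aF : affine_on I (fun x => \sum_k c0 ^+ 2 * (u k + v k * x 0 k)).
  apply: affine_on_sum => k _; apply: affine_on_scale; apply: affine_on_add.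
    exact: affine_on_cst.
  by apply: affine_on_scale; exact: affine_on_coord.
apply: affine_on_ext aF => x bx; apply: eq_bigr => k _; rewrite ee_term_off// uv//.
by rewrite /aff big1 ?addr0 1?mulrC// => j _; rewrite cz mul0r.
Qed.

Lemma aff_single j x : (forall i, i != j -> c i = 0) -> aff x = c0 + c j * x 0 j.
Proof.
by move=> cz; rewrite /aff (bigD1 j)//= big1 ?addr0// => i /cz ->; rewrite mul0r.
Qed.

Lemma single_neq0 j : (forall i, i != j -> c i = 0) ->
  forall y, I j y -> c0 + c j * y != 0.
Proof.
move=> cz y Iy; have [x0 bx0] := box_nonempty hI.
by have := aff_neq0 (box_set_coord bx0 Iy); rewrite (aff_single _ cz) mxE eqxx.
Qed.

Lemma ee_single j x : (forall i, i != j -> c i = 0) ->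
  ee x = ee_term j (x 0 j) (aff x)
    + (\sum_(i | i != j) derive1n 2 (A i) (x 0 i)) * aff x ^+ 2.
Proof.
move=> cz; rewrite /ee (bigD1 j)//= mulr_suml; congr (_ + _).
by apply: eq_bigr => i /cz ci; rewrite ee_term_off.
Qed.

Lemma ee_term_single j F : (forall i, i != j -> c i = 0) ->
  (forall y, I j y -> F y = A j y / (c0 + c j * y) ^+ (m + 1)) ->
  forall y, I j y -> [/\ derivable F y 1, derivable (derive1 F) y 1
    & derive1n 2 F y = ee_term j y (c0 + c j * y) / (c0 + c j * y) ^+ (m + 3)].
Proof.
move=> cz FE y Iy.
have := second_derive_div_power (@oI j) (@A_smooth j) (single_neq0 cz) FE Iy.
by rewrite -addnA natrD.
Qed.

(** The equation for [F] says that the term of index [j] is the quadratic with coefficients [g0],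
    [g1], [g2]. The other terms add [C L^2] with [C = - g2 / c_j^2], which cancels the quadratic
    part. *)
Lemma ee_affine_single j F (g0 g1 g2 : R) : (forall i, i != j -> c i = 0) -> c j != 0 ->
  second_antiderivative_on (I j)
    (fun y => (g0 + g1 * y + g2 * y ^+ 2) / (c0 + c j * y) ^+ (m + 3)) F ->
  (forall y, I j y -> A j y = (c0 + c j * y) ^+ (m + 1) * F y) ->
  (forall x, box I x -> g2 + c j ^+ 2 * \sum_(i | i != j) derive1n 2 (A i) (x 0 i) = 0) ->
  affine_on I ee.
Proof.
move=> cz cj0 dF AF sA.
have aF : affine_on I (fun x => (g0 - g2 / c j ^+ 2 * c0 ^+ 2)
     + (g1 - 2 * g2 / c j * c0) * x 0 j).
  by apply: affine_on_add; [exact: affine_on_cst|apply/affine_on_scale/affine_on_coord].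
apply: affine_on_ext aF => x bx; rewrite (ee_single _ cz) (aff_single _ cz).
set C := \sum_(i | i != j) _.
have CE : C = - g2 / c j ^+ 2.
  have c2 : c j ^+ 2 != 0 by rewrite expf_neq0.
  by apply: (mulfI c2); apply: (addrI g2); rewrite sA//; field.
have l0 := single_neq0 cz (bx j); have lm0 := expf_neq0 (m + 3) l0.
have FE y : I j y -> F y = A j y / (c0 + c j * y) ^+ (m + 1).
  by move=> Iy; rewrite AF// mulrC mulKf// expf_neq0// single_neq0.
have [_ _ e1] := ee_term_single cz FE (bx j).
have [_ _ e2] := dF _ (bx j).
have -> : ee_term j (x 0 j) (c0 + c j * x 0 j) = g0 + g1 * x 0 j + g2 * x 0 j ^+ 2.
  by apply: (mulIf (invr_neq0 lm0)); rewrite -e1 e2.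
by rewrite CE; move: (x 0 j) (c j) cj0 => y b b0; field.
Qed.

(** If [A_k] is affine, its term has no [L^2] part and is a combination of [L], [x_k] and constants.
    The terms outside [S] add up to a multiple of [L^2] whose factor is the vanishing sum. *)
Lemma ee_affine_multiple (S : {set 'I_m}) : (forall j, j \notin S -> c j = 0) ->
  case_affine I A S -> affine_on I ee.
Proof.
move=> cz [h1 h2 sA].
have /fin_all_exists[u /fin_all_exists[v uv]] : forall j, exists u v, j \in S ->
    forall y, I j y -> [/\ A j y = u + v * y, derive1n 1 (A j) y = v & derive1n 2 (A j) y = 0].
  move=> j; have [jS|_] := boolP (j \in S); last by exists 0, 0.
  by have [u [v uv]] := affine_derives (@oI j) (h1 j jS); exists u, v.
have aA : affine_on I aff.
  apply: affine_on_add; first exact: affine_on_cst.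
  by apply: affine_on_sum => j _; apply/affine_on_scale/affine_on_coord.
have aF : affine_on I (fun x => \sum_(k in S)
    (- (2 * n * c k * v k) * aff x + n * (n + 1) * c k ^+ 2 * (u k + v k * x 0 k))).
  apply: affine_on_sum => k _; apply: affine_on_add; apply: affine_on_scale => //.
  by apply: affine_on_add; [exact: affine_on_cst|apply/affine_on_scale/affine_on_coord].
apply: affine_on_ext aF => x bx.
rewrite /ee [RHS](bigID (mem S))/= [X in _ = _ + X](_ : _ = 0) ?addr0; last first.
  under eq_bigr => k kS do rewrite ee_term_off ?cz//.
  by rewrite -mulr_suml sA// mul0r.
apply: eq_bigr => k kS; have [e0 e1 e2] := uv k kS _ (bx k).
by rewrite /ee_term e1 e2 e0; move: (aff x) (x 0 k) => l y; ring.
Qed.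

Lemma ee_affine_quartic (i k : 'I_m) (p q : nat -> R) : m = 2%N -> i = 0%N :> nat ->
  k = 1%N :> nat ->
  c i != 0 ->
  (forall y, I i y -> A i y = \sum_(r < 5) p r * y ^+ r) ->
  (forall y, I k y -> A k y = \sum_(r < 5) q r * y ^+ r) ->
  q 4%N = - (c k ^+ 2 / c i ^+ 2) * p 4%N ->
  q 3%N = - 4 * (c0 * c k / c i ^+ 2) * p 4%N + c k / c i * p 3%N ->
  q 2%N = - 6 * (c0 ^+ 2 / c i ^+ 2) * p 4%N + 3 * (c0 / c i) * p 3%N - p 2%N ->
  affine_on I ee.
Proof.
move=> m2 i0 k1 ci fp gq q4 q3 q2.
have sum2 (F : 'I_m -> R) : \sum_l F l = F i + F k.
  have ki : k != i by rewrite -(inj_eq val_inj) /= i0 k1.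
  rewrite (bigD1 i)//= (bigD1 k)//= big_pred0 ?addr0// => l; apply/negP => /andP[].
  have : (l < 2)%N by rewrite -[X in (_ < X)%N]m2.
  by rewrite -!(inj_eq val_inj) /= i0 k1; case: (nat_of_ord l) => [|[|?]].
have quart (f : R -> R) (w : nat -> R) J : (forall y, J y -> f y = \sum_(r < 5) w r * y ^+ r) ->
    forall y, J y -> f y = quartic w y.
  by move=> h y Jy; rewrite h// !big_ord_recl big_ord0 /quartic /=; ring.
have fq := quart _ _ _ fp; have gq' := quart _ _ _ gq.
have [f1 f2] := quartic_derives (@oI i) fq; have [g1 g2] := quartic_derives (@oI k) gq'.
have n3 : n = 3 by rewrite natr1 m2.
have affE x : aff x = c0 + c i * x 0 i + c k * x 0 k by rewrite /aff sum2 addrA.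
(* The coefficients of 1, [x_i] and [x_k] in [ee] for [n = 3]. All higher ones vanish, by the three
   relations or because they contain the factor [n - 3]. *)
pose v00 := - 6 * c i * p 1%N * c0 + 12 * c i ^+ 2 * p 0%N - 6 * c k * q 1%N * c0
  + 12 * c k ^+ 2 * q 0%N + 2 * p 2%N * c0 ^+ 2 + 2 * q 2%N * c0 ^+ 2.
pose v10 := - 6 * c i * c k * q 1%N - 8 * c i * p 2%N * c0 + 4 * c i * q 2%N * c0
  + 6 * c i ^+ 2 * p 1%N + 6 * p 3%N * c0 ^+ 2.
pose v01 := - 6 * c i * c k * p 1%N - 8 * c k * q 2%N * c0 + 4 * c k * p 2%N * c0
  + 6 * c k ^+ 2 * q 1%N + 6 * q 3%N * c0 ^+ 2.
have aF : affine_on I (fun x => v00 + (v10 * x 0 i + v01 * x 0 k)).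
  apply: affine_on_add; first exact: affine_on_cst.
  by apply: affine_on_add; apply: affine_on_scale; exact: affine_on_coord.
apply: affine_on_ext aF => x bx; rewrite /ee sum2 /ee_term affE n3.
rewrite (f1 _ (bx i)) (f2 _ (bx i)) (fq _ (bx i)) (g1 _ (bx k)) (g2 _ (bx k)) (gq' _ (bx k)).
rewrite /v00 /v10 /v01 /quartic /quartic' /quartic'' q4 q3 q2;
  move: (x 0 i) (x 0 k) (q 0%N) (q 1%N) => y z w0 w1.
by field.
Qed.

End ExtremalEquation.

(** One second antiderivative is found explicitly as a quadratic polynomial over [(a + b x)^(m+1)];
    any other one differs from it by an affine function. *)
Lemma twice_integrated_quadratic (R : realType) (J : set R) (f F : R -> R)
    (a b g0 g1 g2 : R) (m : nat) : (2 <= m)%N -> open_interval J -> b != 0 ->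
  (forall x, J x -> a + b * x != 0) ->
  second_antiderivative_on J (fun x => (g0 + g1 * x + g2 * x ^+ 2) / (a + b * x) ^+ (m + 3)) F ->
  (forall x, J x -> f x = (a + b * x) ^+ (m + 1) * F x) ->
  exists (Ups : {poly R}) (nu0 nu1 : R), (size Ups <= 3)%N /\
    forall x, J x -> f x = Ups.[x] + (a + b * x) ^+ (m + 1) * (nu0 + nu1 * x).
Proof.
(* [m >= 2] gives [N >= 3], so [N], [N + 1], [N - 1] and [N - 2] are nonzero and the double
   integration never produces a logarithm. *)
move=> m2 [oJ iJ nJ] b0 l0 dF fF; move NE: ((m + 1)%:R : R) => N.
have N3 : 3 <= N by rewrite -NE ler_nat addn1.
have N0 : N != 0 by rewrite gt_eqF//; lra.
have N1 : N + 1 != 0 by rewrite gt_eqF//; lra.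
have N1' : N - 1 != 0 by rewrite gt_eqF//; lra.
have N2' : N - 2 != 0 by rewrite gt_eqF//; lra.
(* The coefficients of [Ups] in powers of [l = a + b x]: [l^r / l^(m+1)] has
   second derivative [b^2 (r - m - 1) (r - m - 2) l^r / l^(m+3)]. *)
pose t2 := g2 / b ^+ 2 / (b ^+ 2 * ((N - 1) * (N - 2))).
pose t1 := (g1 / b - 2 * a * g2 / b ^+ 2) / (b ^+ 2 * (N * (N - 1))).
pose t0 := (g0 - g1 * a / b + g2 * a ^+ 2 / b ^+ 2) / (b ^+ 2 * (N * (N + 1))).
pose p (i : nat) := nth 0 [:: t0 + t1 * a + t2 * a ^+ 2; b * (t1 + 2 * a * t2); b ^+ 2 * t2; 0;
  0] i.
pose Ups := Poly [:: p 0%N; p 1%N; p 2%N].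
have U0 x : Ups.[x] = quartic p x by rewrite horner_Poly /quartic /p /=; ring.
have [U1 U2] := quartic_derives oJ (fun x _ => U0 x).
have sU : smooth_on J (fun x => Ups.[x]).
  move=> k x Jx.
  have hk := @derive1n_horner _ _ (fun y => Ups.[y]) Ups k oJ (fun y _ => erefl).
  by have [] := derives_on oJ hk Jx (derives_horner _ _).
pose G x := Ups.[x] / (a + b * x) ^+ (m + 1).
have dG := second_derive_div_power oJ sU l0 (fun x (_ : J x) => erefl (G x)).
have FG x : J x -> derive1n 2 F x = derive1n 2 G x.
  move=> Jx; have [_ _ ->] := dG x Jx; have [_ _ ->] := dF x Jx.
  have lx := l0 x Jx; rewrite -addnA; congr (_ / _);
    rewrite U1// U2// U0 /quartic /quartic' /quartic'' /p /= NE /t0 /t1 /t2.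
  by field; rewrite b0 N0 N1 N1' N2'.
pose h x := F x - G x.
have h1 x : J x -> is_derive x 1 h (derive1 F x - derive1 G x).
  move=> Jx; have [dFx _ _] := dF x Jx; have [dGx _ _] := dG x Jx.
  by rewrite !derive1E; exact: derives_sub (derivableP dFx) (derivableP dGx).
have h1E x : J x -> derive1 h x = derive1 F x - derive1 G x.
  by move=> Jx; rewrite derive1E; apply: derive_val; exact: h1.
have h2 x : J x -> is_derive x 1 (derive1 h) 0.
  move=> Jx; apply: (derives_on oJ h1E Jx).
  have [_ dFx _] := dF x Jx; have [_ dGx _] := dG x Jx.
  apply: (is_derive_eq (derives_sub (derivableP dFx) (derivableP dGx))).
  by rewrite -!derive1E -[derive1 (derive1 F) x]/(derive1n 2 F x) FG// subrr.
have [x0 Jx0] := nJ.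
have hpoly : poly_deg_le_on J 1 h.
  apply: poly_deg_primitive => // [x Jx|]; first by have [] := h1 x Jx.
  exists (derive1 h x0)%:P; split; first exact: size_polyC_leq1.
  by move=> x Jx; rewrite hornerC; exact: (interval_constant iJ h2).
have [u [v uv]] := affine_derives oJ hpoly.
exists Ups, u, v; split; first exact: size_Poly.
move=> x Jx; have [<- _ _] := uv x Jx.
rewrite fF// /h /G mulrBr mulrCA divff ?mulr1; last by rewrite expf_neq0// l0.
by ring.
Qed.

(** * From the extremality equation to the cases of the classification *)

Section Cases.
Context {R : realType} {m : nat}.
Variables (I : 'I_m -> set R) (A : 'I_m -> R -> R).
Variables (beta : tensor R m) (c0 : R) (c : 'I_m -> R).
Hypothesis m_ge2 : (2 <= m)%N.
Hypothesis hI : forall j, open_interval (I j).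
Hypothesis A_smooth : forall j, smooth_on (I j) (A j).
Hypothesis betaE : beta = c0 *: e0pow m + \sum_j c j *: eps j.
Hypothesis mu_neq0 : forall x, box I x -> mu_pair x beta != 0.

Lemma mu_pair_aff x : mu_pair x beta = aff c0 c x.
Proof. by rewrite betaE mu_pair_affine// (leq_trans _ m_ge2). Qed.

Lemma aff_neq0 x : box I x -> aff c0 c x != 0.
Proof. by move=> bx; rewrite -mu_pair_aff mu_neq0. Qed.

Lemma extremal_ee (tb : m.-tuple (tensor R m)) :
  (forall j x, I j x -> A j x != 0) -> basis_of segre (beta :: tb) ->
  extremal_on (tp_domain I) (twisted_product beta tb A) <-> affine_on I (ee A c0 c).
Proof.
move=> A_neq0 hb; have m0 : (0 < m)%N by rewrite (leq_trans _ m_ge2).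
rewrite (extremal_affine m0 hI A_smooth A_neq0 betaE mu_neq0 hb).
have E x : box I x -> scal A (fun y => mu_pair y beta) c x * mu_pair x beta = - ee A c0 c x.
  by move=> bx; apply: (scal_ee _ aff_neq0) => // y; exact: mu_pair_aff.
split=> aF.
  apply: affine_on_ext (affine_on_scale (-1) aF) => x bx.
  by rewrite /= E// mulN1r opprK.
by apply: affine_on_ext (affine_on_scale (-1) aF) => x bx; rewrite /= E// mulN1r.
Qed.

Lemma case_single_of_ee j : (forall i, i != j -> c i = 0) -> c j != 0 ->
  affine_on I (ee A c0 c) -> case_single beta I A j c0 (c j).
Proof.
move=> cz cj [e0 [e eeE]]; split=> //.
- rewrite betaE ins_vec2 (bigD1 j)//= big1 ?addr0// => i /cz ->; exact: scale0r.
- by move=> i ij; exact: (off_support_quadratic hI A_smooth eeE (cz i ij) cj).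
have [x0 bx0] := box_nonempty hI.
pose C := \sum_(i | i != j) derive1n 2 (A i) (x0 0 i).
have CE x : box I x -> \sum_(i | i != j) derive1n 2 (A i) (x 0 i) = C.
  move=> bx; apply: eq_bigr => i ij.
  have [D hD] := off_support_second_derive_const hI eeE (cz i ij) cj.
  by rewrite !hD.
(* With the other variables at [x0], the equation says that the term of index [j] is
   [ka + e_j y - C (c0 + c_j y)^2]; the three witnesses below are the coefficients of this quadratic
   in [y]. *)
pose ka := e0 + \sum_(i | i != j) e i * x0 0 i.
pose F y := A j y / (c0 + c j * y) ^+ (m + 1).
exists (ka - C * c0 ^+ 2), (e j - 2 * C * c0 * c j), (- (C * c j ^+ 2)), F; split.
- move=> y Iy.
  have [dF ddF ->] := ee_term_single hI A_smooth aff_neq0 cz (F := F) (fun z _ => erefl) Iy.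
  split=> //; congr (_ / _).
  have bs := box_set_coord bx0 Iy; have := eeE _ bs.
  rewrite (ee_single A c0 _ cz) CE// (aff_single _ _ cz) (bigD1 j)//= mxE eqxx.
  under eq_bigr => i ij do rewrite mxE (negbTE ij).
  by move=> h; apply: (addIr (C * (c0 + c j * y) ^+ 2)); rewrite h /ka; ring.
- by move=> y Iy; rewrite mulrC divfK// expf_neq0// (single_neq0 hI aff_neq0 cz).
- by move=> x bx; rewrite CE//; ring.
Qed.

Lemma case_multiple_of_ee i k : i != k -> c i != 0 -> c k != 0 ->
  affine_on I (ee A c0 c) -> case_multiple beta I A.
Proof.
move=> ik ci ck [e0 [e eeE]].
pose S : {set 'I_m} := finset (fun j => c j != 0).
have inS j : (j \in S) = (c j != 0) by rewrite inE.
(* The constant [c0] must be distributed over the slots in [S]; all of it goes to the slot [i]. *)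
exists S, (fun j => (j == i)%:R * c0), c; split.
- by apply/card_gt1P; exists i, k; rewrite !inS.
- by move=> j; rewrite inS.
- rewrite betaE; under [RHS]eq_bigr do rewrite ins_vec2.
  rewrite big_split /= -scaler_suml; congr (_ *: _ + _).
    rewrite (bigD1 i) ?inS//= eqxx mul1r big1 ?addr0// => j /andP[_ /negbTE ->].
    exact: mul0r.
  rewrite [LHS](bigID (mem S))/= [X in _ + X]big1 ?addr0// => j; rewrite inS negbK => /eqP ->.
  exact: scale0r.
have a0 : \sum_(j in S) (j == i)%:R * c0 = c0.
  rewrite (bigD1 i) ?inS//= eqxx mul1r big1 ?addr0// => j /andP[_ /negbTE ->].
  exact: mul0r.
have [m3|] := ltnP 2 m.
  have degS j : j \in S -> poly_deg_le_on (I j) 1 (A j).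
    rewrite inS => cj; have [x0 bx0] := box_nonempty hI.
    have [->|ji] := eqVneq j i.
      by have [] := affine_on_support hI A_smooth eeE m3 ik ci ck bx0.
    by have [] := affine_on_support hI A_smooth eeE m3 ji cj ci bx0.
  right; split=> //; split => //.
  - move=> r; rewrite inS negbK => /eqP cr.
    exact: (off_support_quadratic hI A_smooth eeE cr ci).
  (* The available sum omits only [i] and [k]. The other indices of [S] contribute 0, since their
     [A_j] are affine, which leaves the sum over the complement of [S]. *)
  - move=> x bx; have [_] := affine_on_support hI A_smooth eeE m3 ik ci ck bx.
    rewrite (bigID (mem S))/= big1 ?add0r => [|j /andP[_ /degS hj]]; last first.
      have [oI _ _] := hI j; have [u [v uv]] := affine_derives oI hj.
      by have [_ _ h] := uv _ (bx j); exact: h.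
    move=> h; apply: etrans h; apply: eq_bigl => j; rewrite /= inS negbK.
    have [cj|_] := eqVneq (c j) 0; rewrite ?andbF// andbT; apply: esym; apply/andP; split.
      by apply: contraNneq ci => <-; rewrite cj.
    by apply: contraNneq ck => <-; rewrite cj.
move=> m2; left; have m2' : m = 2%N by apply/eqP; rewrite eqn_leq m2.
split=> //; rewrite a0.
(* [case_quartic] refers to the indices 0 and 1 in this order, while [i] and [k] may come in either
   order; for [m = 2] both coefficients are nonzero anyway. *)
have [i1 [k1 [i10 k11 i1k1]]] : exists i1 k1 : 'I_m, [/\ i1 = 0%N :> nat, k1 = 1%N :> nat & i1
  != k1].
  by exists (Ordinal (ltnW m_ge2)), (Ordinal m_ge2).
have cS j : c j != 0.
  have : (j == i) || (j == k).
    have lt2 (l : 'I_m) : (l < 2)%N by rewrite -[X in (_ < X)%N]m2'.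
    move: ik (lt2 i) (lt2 k) (lt2 j); rewrite -!(inj_eq val_inj) /=.
    by case: (nat_of_ord i) (nat_of_ord k) (nat_of_ord j) => [|[|?]] [|[|?]] [|[|?]].
  by case/orP => /eqP ->.
have [p [q [fp gq [q4 q3 q2]]]] :=
  quartic_relations hI A_smooth eeE m2' i1k1 (cS i1) (cS k1).
by exists i1, k1, p, q.
Qed.

End Cases.

Theorem theorem4p3p1 (R : realType) (m : nat) (hm : (2 <= m)%N)
    (beta : tensor R m) (beta_segre : beta \in segre) (beta_neq0 : beta != 0)
    (I : 'I_m -> set R) (hI : forall j, open_interval (I j))
    (A : 'I_m -> R -> R)
    (A_smooth : forall j, smooth_on (I j) (A j))
    (A_neq0 : forall j x, I j x -> A j x != 0)
    (mu_neq0 : forall x, box I x -> mu_pair x beta != 0)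
    (tb : m.-tuple (tensor R m)) (tb_basis : basis_of segre (beta :: tb))
    (g_posdef : positive_definite_on (tp_domain I)
                  (metric (twisted_product beta tb A))) :
  (extremal_on (tp_domain I) (twisted_product beta tb A) <->
    [\/ case_const beta I A,
        exists (j : 'I_m) (a b : R), case_single beta I A j a b
      | case_multiple beta I A])
  /\ (forall (j : 'I_m) (a b : R), case_single beta I A j a b ->
      exists (Ups : {poly R}) (nu0 nu1 : R), (size Ups <= 3)%N /\
        forall x, I j x ->
          A j x = Ups.[x] + (a + b * x) ^+ (m + 1) * (nu0 + nu1 * x)).
Proof.
have extE c0 c betaE :=
  @extremal_ee R m I A beta c0 c hm hI A_smooth betaE mu_neq0 tb A_neq0 tb_basis.
have affN0 c0 c betaE := @aff_neq0 R m I beta c0 c hm betaE mu_neq0.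
split; [split|].
- have [c0 [c betaE]] := segreP beta_segre; move=> /(extE _ _ betaE) aF.
  (* The three cases correspond to none, exactly one, or at least two of the [c j] being nonzero. *)
  have [/existsP[j cj]|c_eq0] := boolP [exists j, c j != 0]; last first.
    have cz j : c j = 0 by apply/eqP; move: c_eq0; rewrite negb_exists => /forallP/(_ j)/negPn.
    have betaE' : beta = c0 *: e0pow m.
      by rewrite betaE big1 ?addr0// => j _; rewrite cz scale0r.
    apply: Or31; exists c0; split=> //.
      by apply: contraNneq beta_neq0 => c00; rewrite betaE' c00 scale0r.
    by have [e0 [e eeE]] := aF; exact: (cubic_of_constant hI A_smooth (affN0 _ _ betaE) eeE).
  have [/existsP[k /andP[kj ck]]|others] := boolP [exists k, (k != j) && (c k != 0)].
    by apply: Or33; exact: (case_multiple_of_ee hm hI A_smooth betaE kj ck cj aF).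
  have cz i : i != j -> c i = 0.
    move=> ij; apply/eqP; move: others; rewrite negb_exists => /forallP/(_ i).
    by rewrite ij negbK.
  apply: Or32; exists j, c0, (c j).
  exact: (case_single_of_ee hm hI A_smooth betaE mu_neq0 cz cj aF).
- case=> [[t [t0 betaE h3]]|[j [a [b [b0 betaE h2 [g0 [g1 [g2 [F [dF AF sA]]]]]]]]]|
    [S [a [b [S2 bS betaE hS]]]]].
  + have betaE' : beta = t *: e0pow m + \sum_j 0 *: eps j.
      by rewrite big1 ?addr0// => j _; rewrite scale0r.
    by apply/(extE _ _ betaE'); exact: ee_affine_constant.
  + pose c i := if i == j then b else 0.
    have cj : c j = b by rewrite /c eqxx.
    have cz i : i != j -> c i = 0 by rewrite /c => /negbTE ->.
    have betaE' : beta = a *: e0pow m + \sum_i c i *: eps i.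
      rewrite betaE ins_vec2 (bigD1 j)//= cj big1 ?addr0// => i /cz ->; exact: scale0r.
    apply/(extE _ _ betaE').
    apply: (ee_affine_single hI A_smooth (affN0 _ _ betaE') cz (F := F) (g0 := g0) (g1 := g1)
      (g2 := g2)); by rewrite ?cj.
  + pose c i := if i \in S then b i else 0.
    have cS i : i \in S -> c i = b i by rewrite /c => ->.
    have cz i : i \notin S -> c i = 0 by rewrite /c => /negbTE ->.
    have betaE' : beta = (\sum_(j in S) a j) *: e0pow m + \sum_i c i *: eps i.
      rewrite betaE; under eq_bigr do rewrite ins_vec2.
      rewrite big_split /= -scaler_suml; congr (_ + _).
      rewrite [RHS](bigID (mem S))/= [X in _ = _ + X]big1 ?addr0 => [|i /cz ->];
        last exact: scale0r.
      by apply: eq_bigr => i /cS ->.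
    apply/(extE _ _ betaE').
    case: hS => [[m2 [i [k [p [q [i0 k1 [fp gq] [q4 q3 q2]]]]]]]|[m3 hA]]; last first.
      exact: (ee_affine_multiple _ hI cz hA).
    (* A subset of cardinality at least two in a set of two indices is everything. *)
    have inS j : j \in S.
      have eS : #|S| = #|'I_m| by apply/eqP;
        rewrite eqn_leq max_card card_ord [X in (X <= _)%N]m2.
      by rewrite (subset_cardP eS (subset_predT _)).
    apply: (ee_affine_quartic hI m2 i0 k1 _ fp gq); by rewrite ?cS// bS.
move=> j a b [b0 betaE _ [g0 [g1 [g2 [F [dF AF _]]]]]].
(* It remains to see that [a + b y] is nonzero on [I j]: it is the value of [<mu, beta>] at a point
   of the box with [j]-th coordinate [y]. *)
apply: (twice_integrated_quadratic hm (hI j) b0 _ dF AF) => y Iy.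
have [x0 bx0] := box_nonempty hI.
by have := mu_neq0 _ (box_set_coord bx0 Iy); rewrite betaE mu_pair_ins mxE eqxx.
Qed.
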